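(* Let $n\geqslant1$. Suppose that we are given a homogeneous polynomial $P_{w_0}(X,Y)\in\mathbb{Z}[X,Y]$, and for each $w\in W_n$ define $P_w(X,Y)=\partial'_{w^{-1}w_0}(P_{w_0}(X,Y))$. Let $P_\varpi(X)=P_\varpi(X,0)$ and $P_\lambda(X)=P_{w_\lambda}(X,0)$ for every pair $(\varpi,\lambda)\in S_n\times\mathcal{D}_n$. Assume that these polynomials satisfy the following properties: (i) $P_{w_0}(X,Y)=\sum_{\varpi,\lambda}P_{\varpi\omega_0}(-\omega_0X)\,P_{\lambda'}(X)\,P_\varpi(\omega_0Y)\,P_\lambda(Y)$, summed over all $\varpi\in S_n$ and $\lambda\in\mathcal{D}_n$; (ii) $P_{\omega_0}(X)=\mathfrak{S}_{\omega_0}(\omega_0X)=x_2x_3^2\cdots x_n^{n-1}$ and $P_{\rho_n}(X)=\widetilde Q_{\rho_n}(X)$. Then $P_w(X,Y)=\mathfrak{C}_w(X,Y)$ for all $w\in W_n$.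
   Context: $X=(x_1,\ldots,x_n)$, $Y=(y_1,\ldots,y_n)$ are commuting independent variables; $\omega_0=(n,n-1,\ldots,1)$ is the longest element of $S_n$; $f(\omega_0X)=f(x_n,\ldots,x_1)$, $f(-\omega_0X)=f(-x_n,\ldots,-x_1)$, $f(\omega_0Y)=f(y_n,\ldots,y_1)$. $\mathfrak{S}_{\omega_0}(X)=x_1^{n-1}x_2^{n-2}\cdots x_{n-1}$ is the type $A$ Schubert polynomial of $\omega_0$. Weyl group and divided differences. $W_n$ is the hyperoctahedral group of signed permutations (a bar denotes a negative entry), generated by simple transpositions $s_i$ ($1\leqslant i\leqslant n-1$), generating $S_n\subset W_n$, and $s_0$; right multiplication by $s_i$ interchanges the entries in positions $i,i+1$, and $(u_1,\ldots,u_n)s_0=(\overline{u}_1,u_2,\ldots,u_n)$; $w_0=(\overline1,\ldots,\overline n)$ is the longest element. $W_n$ acts on $\mathbb{Z}[Y][X]$: $s_i$ interchanges $x_i,x_{i+1}$, $s_0$ sends $x_1$ to $-x_1$. $\partial_i(f)=(f-s_if)/(x_i-x_{i+1})$ for $1\leqslant i\leqslant n-1$, $\partial_0(f)=(f-s_0f)/(2x_1)$; $\partial'_i=-\partial_i$ for $1\leqslant i\leqslant n-1$, $\partial'_0=\partial_0$; $\partial'_w=\partial'_{a_1}\circ\cdots\circ\partial'_{a_r}$ for a reduced word $w=s_{a_1}\cdots s_{a_r}$. Polynomials. $\widetilde Q_i(X)=e_i(X)$ (elementary symmetric), $\widetilde Q_{i,j}=\widetilde Q_i\widetilde Q_j+2\sum_{k=1}^j(-1)^k\widetilde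 Q_{i+k}\widetilde Q_{j-k}$, and for $\lambda=(\lambda_1\geqslant\cdots\geqslant\lambda_r\geqslant0)$ with $r$ even (put $\lambda_r=0$ if necessary), $\widetilde Q_\lambda=\mathrm{Pfaffian}[\widetilde Q_{\lambda_i,\lambda_j}]_{1\leqslant i<j\leqslant r}$. $\mathcal{D}_n$ is the set of strict partitions (distinct nonzero parts, possibly none) with all parts at most $n$; $\rho_n=(n,n-1,\ldots,1)$; $\lambda'$ is the strict partition whose parts are the complement of those of $\lambda$ in $\{1,\ldots,n\}$. For $\lambda\in\mathcal{D}_n$ with $\ell$ nonzero parts and $k=n-\ell$, $w_\lambda=(\overline{\lambda}_1,\ldots,\overline{\lambda}_\ell,\lambda'_k,\ldots,\lambda'_1)\in W_n$. $\widetilde Q(X,Y)=\sum_{\lambda\in\mathcal{D}_n}\widetilde Q_\lambda(X)\widetilde Q_{\lambda'}(Y)$, $\Delta(X,Y)=\prod_{i+j\leqslant n}(x_i-y_j)$, and for $w\in W_n$ the type $C$ double Schubert polynomial is $\mathfrak{C}_w(X,Y)=(-1)^{n(n-1)/2}\,\partial'_{w^{-1}w_0}(\Delta(X,Y)\widetilde Q(X,Y))$. *)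

(* Defs.v *)
From HB Require Import structures.
From mathcomp Require Import all_boot all_order all_algebra all_fingroup.
From mathcomp Require Import mpoly.

Set Implicit Arguments.
Unset Strict Implicit.
Unset Printing Implicit Defensive.

Import GroupScope GRing.Theory.
Local Open Scope ring_scope.

(* Indices are 0-based: the ordinal i : 'I_n stands for i + 1 in {1, ..., n}. *)

(* The signed permutation w is the word (w_1, ..., w_n) where |w_i| is        *)
(* [sp_abs w i] and w_i is barred exactly when [sp_neg w i].                  *)
Record signed_perm (n : nat) :=
  SignedPerm { sp_pair : 'S_n * {ffun 'I_n -> bool} }.

Definition sp_abs (n : nat) (w : signed_perm n) : 'S_n := (sp_pair w).1.
Definition sp_neg (n : nat) (w : signed_perm n) : {ffun 'I_n -> bool} :=
  (sp_pair w).2.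

HB.instance Definition _ (n : nat) := [isNew for @sp_pair n].
HB.instance Definition _ (n : nat) := [Finite of signed_perm n by <:].

Section SignedPermGroup.
Variable n : nat.
Implicit Types u v w : signed_perm n.

Lemma signed_permP u v :
  sp_abs u =1 sp_abs v -> sp_neg u =1 sp_neg v -> u = v.
Proof.
case: u v => [[s e]] [[t f]]; rewrite /sp_abs /sp_neg /= => st ef.
by congr SignedPerm; congr pair; [apply/permP | apply/ffunP].
Qed.

(* Composition u \o v of the bijections of {+-1, ..., +-n}.  The group law of *)
(* 'S_n is the opposite one, so the embedding [sp_of] of 'S_n reverses        *)
(* products.                                                                  *)
Definition sp_mul u v : signed_perm n :=
  SignedPerm ((sp_abs v * sp_abs u)%g,
              [ffun i => sp_neg v i (+) sp_neg u (sp_abs v i)]).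

Definition sp_one : signed_perm n := SignedPerm (1%g, [ffun=> false]).

Definition sp_inv u : signed_perm n :=
  SignedPerm ((sp_abs u)^-1%g, [ffun i => sp_neg u ((sp_abs u)^-1%g i)]).

Fact sp_mulA : associative sp_mul.
Proof.
move=> u v w; apply: signed_permP => i; rewrite /sp_abs /sp_neg /=.
  by rewrite mulgA.
by rewrite !ffunE permM addbA.
Qed.

Fact sp_mul1 : left_id sp_one sp_mul.
Proof.
move=> u; apply: signed_permP => i; rewrite /sp_abs /sp_neg /=.
  by rewrite mulg1.
by rewrite !ffunE addbF.
Qed.

Fact sp_mulV : left_inverse sp_one sp_inv sp_mul.
Proof.
move=> u; apply: signed_permP => i; rewrite /sp_abs /sp_neg /=.
  by rewrite mulgV.
by rewrite !ffunE permK addbb.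
Qed.

HB.instance Definition _ :=
  Finite_isGroup.Build (signed_perm n) sp_mulA sp_mul1 sp_mulV.

Lemma sp_absM u v : sp_abs (u * v)%g = (sp_abs v * sp_abs u)%g.
Proof. by []. Qed.

Lemma sp_negM u v i :
  sp_neg (u * v)%g i = sp_neg v i (+) sp_neg u (sp_abs v i).
Proof. by rewrite [LHS]ffunE. Qed.

Definition sp_of (s : 'S_n) : signed_perm n := SignedPerm (s, [ffun=> false]).

Definition longest_sp : signed_perm n := SignedPerm (1%g, [ffun=> true]).

Definition longest_perm : 'S_n := perm (@rev_ord_inj n).

Definition ord_below (i : 'I_n) : 'I_n :=
  Ordinal (leq_ltn_trans (leq_pred i) (ltn_ord i)).

(* The letter i : 'I_n names the generator s_i, for 0 <= i <= n - 1; for      *)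
(* i > 0 the positions i and i + 1 are the ordinals i - 1 and i.              *)
Definition simple_sp (i : 'I_n) : signed_perm n :=
  if i == 0 :> nat then SignedPerm (1%g, [ffun j => j == i])
  else sp_of (tperm (ord_below i) i).

Definition word_prod (a : seq 'I_n) : signed_perm n :=
  (\prod_(i <- a) simple_sp i)%g.

Lemma word_prod_cat a b : word_prod (a ++ b) = (word_prod a * word_prod b)%g.
Proof. exact: big_cat. Qed.

Let gen w := exists a, word_prod a = w.

Let gen1 : gen 1%g.
Proof. by exists [::]; rewrite /word_prod big_nil. Qed.

Let genM u v : gen u -> gen v -> gen (u * v)%g.
Proof. by move=> [a <-] [b <-]; exists (a ++ b); rewrite word_prod_cat. Qed.

Let gens i : gen (simple_sp i).
Proof. by exists [:: i]; rewrite /word_prod big_seq1. Qed.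

Lemma sp_ofM s t : sp_of (s * t)%g = (sp_of t * sp_of s)%g.
Proof. by apply: signed_permP => i; rewrite /sp_abs /sp_neg //= !ffunE. Qed.

Let gen_tperm_lt d (i j : 'I_n) : j = (i + d)%N :> nat ->
  gen (sp_of (tperm i j)).
Proof.
elim: d j => [|d IHd] j jE.
  have -> : j = i by apply/val_inj; rewrite /= jE addn0.
  rewrite tperm1; suff -> : sp_of 1%g = 1%g by [].
  by apply: signed_permP => k; rewrite /sp_abs /sp_neg.
have j_gt0 : (j != 0 :> nat) by rewrite jE addnS.
have gj : gen (sp_of (tperm (ord_below j) j)).
  by have := gens j; rewrite /simple_sp (negPf j_gt0).
have jbE : ord_below j = (i + d)%N :> nat by rewrite /= jE addnS.
have [d0|d_gt0] := posnP d.
  suff -> : i = ord_below j by [].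
  by apply/val_inj; rewrite [RHS]jbE d0 addn0.
have -> : tperm i j =
  (tperm (ord_below j) j * (tperm i (ord_below j) * tperm (ord_below j) j))%g.
  have ib : ord_below j != i.
    apply/eqP => /(congr1 val); rewrite [val _]jbE => /eqP.
    by rewrite -[X in _ == X]addn0 eqn_add2l => /eqP d0; rewrite d0 in d_gt0.
  have ij : j != i.
    apply/eqP => /(congr1 val); rewrite [val _]jE => /eqP.
    by rewrite -[X in _ == X]addn0 eqn_add2l.
  rewrite -{1}(tpermV (ord_below j) j) -conjgE tpermJ tpermL.
  by rewrite tpermD.
by rewrite !sp_ofM; apply: genM => //; apply: genM => //; apply: IHd.
Qed.

Let gen_tperm (i j : 'I_n) : gen (sp_of (tperm i j)).
Proof.
have [ij|/ltnW ji] := leqP i j.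
  by apply: (gen_tperm_lt (d := j - i)); rewrite subnKC.
by rewrite tpermC; apply: (gen_tperm_lt (d := i - j)); rewrite subnKC.
Qed.

Let gen_sp_of s : gen (sp_of s).
Proof.
have [ts -> _] := prod_tpermP s; elim: ts => [|t ts IHts].
  rewrite big_nil; suff -> : sp_of 1%g = 1%g by [].
  by apply: signed_permP => k; rewrite /sp_abs /sp_neg.
by rewrite big_cons sp_ofM; apply: genM.
Qed.

Let flip (r : seq 'I_n) : signed_perm n :=
  SignedPerm (1%g, [ffun j => j \in r]).

Let gen_flip1 i : gen (flip [:: i]).
Proof.
have n_gt0 : (0 < n)%N by apply: leq_ltn_trans (ltn_ord i).
pose o := Ordinal n_gt0.
have -> : flip [:: i] =
    (sp_of (tperm o i) * (simple_sp o * sp_of (tperm o i)))%g.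
  apply: signed_permP => j; rewrite ?sp_absM ?sp_negM /simple_sp.
    by rewrite /sp_abs /= mulg1 tperm2.
  rewrite /sp_abs /sp_neg /= !ffunE addbF inE.
  by rewrite -(inj_eq (@perm_inj _ (tperm o i)) j) tpermR.
by apply: genM => //; apply: genM => //; apply: gens.
Qed.

Let gen_flip r : uniq r -> gen (flip r).
Proof.
elim: r => [_|i r IHr /= /andP[ir /IHr gr]].
  suff -> : flip [::] = 1%g by [].
  by apply: signed_permP => k; rewrite /sp_abs /sp_neg //= !ffunE.
suff -> : flip (i :: r) = (flip [:: i] * flip r)%g by apply: genM.
apply: signed_permP => j; rewrite ?sp_absM ?sp_negM /sp_abs /sp_neg /=.
  by rewrite mulg1.
rewrite !ffunE perm1 !inE.
by case: eqP => [->|_]; rewrite ?(negPf ir) ?addbF.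
Qed.

Lemma word_exists w :
  exists k, [exists a : k.-tuple 'I_n, word_prod a == w].
Proof.
suff [a aE] : gen w.
  by exists (size a); apply/existsP; exists (in_tuple a); apply/eqP.
have -> : w = (sp_of (sp_abs w) * flip (enum [pred i | sp_neg w i]))%g.
  apply: signed_permP => i; rewrite ?sp_absM ?sp_negM.
    by rewrite [sp_abs (flip _)]/sp_abs /= mul1g.
  by rewrite [sp_neg (flip _)]/sp_neg [sp_neg (sp_of _)]/sp_neg /= !ffunE addbF
    mem_enum.
by apply: genM => //; apply: gen_flip; apply: enum_uniq.
Qed.

Definition sp_length w : nat := ex_minn (word_exists w).

Lemma reduced_word_exists w :
  exists a : (sp_length w).-tuple 'I_n, word_prod a == w.
Proof. by rewrite /sp_length; case: ex_minnP => k /existsP. Qed.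

(* An arbitrary word of minimal length.  The operators below do not depend on *)
(* this choice because they satisfy the braid relations.                      *)
Definition reduced_word w : seq 'I_n := xchoose (reduced_word_exists w).

End SignedPermGroup.

(* Z[X, Y] is {mpoly int[n + n]}, where x_i is the variable [lshift n i] and  *)
(* y_i is the variable [rshift n i]; Z[X] is {mpoly int[n]}.                  *)
Section Variables.
Variable n : nat.

Definition varX : n.-tuple {mpoly int[n + n]} := [tuple 'X_(lshift n i) | i < n].
Definition varY : n.-tuple {mpoly int[n + n]} := [tuple 'X_(rshift n i) | i < n].
Definition var_revY : n.-tuple {mpoly int[n + n]} :=
  [tuple 'X_(rshift n (rev_ord i)) | i < n].
Definition var_opp_revX : n.-tuple {mpoly int[n + n]} :=
  [tuple - 'X_(lshift n (rev_ord i)) | i < n].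

Definition var_rev : n.-tuple {mpoly int[n]} := [tuple 'X_(rev_ord i) | i < n].

Definition at_Y0 (f : {mpoly int[n + n]}) : {mpoly int[n]} :=
  f \mPo cat_tuple [tuple 'X_i | i < n] [tuple 0 | i < n].

End Variables.

Section DividedDifferences.
Variable n : nat.
Implicit Types (i j : 'I_n) (f g : {mpoly int[n + n]}) (w : signed_perm n).

(* w sends x_j to x_{w_j}, where x_{-k} = - x_k, and fixes the y_j.           *)
Definition sp_act w f : {mpoly int[n + n]} :=
  f \mPo cat_tuple
    [tuple (-1) ^+ sp_neg w j * 'X_(lshift n (sp_abs w j)) | j < n] (varY n).

Definition ddiff_den i : {mpoly int[n + n]} :=
  if i == 0 :> nat then 2 * 'X_(lshift n i)
  else 'X_(lshift n (ord_below i)) - 'X_(lshift n i).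

Lemma ddiff_exists i f :
  exists g, g * ddiff_den i == f - sp_act (simple_sp i) f.
Proof.
pose D h := exists g, g * ddiff_den i == h - sp_act (simple_sp i) h.
have D1 : D 1 by exists 0; rewrite mul0r /sp_act comp_mpoly1 subrr.
have DM h k : D h -> D k -> D (h * k).
  move=> [g /eqP gE] [g' /eqP g'E].
  exists (g * k + sp_act (simple_sp i) h * g').
  rewrite mulrDl mulrAC gE -mulrA g'E mulrBl mulrBr.
  by rewrite addrA subrK /sp_act rmorphM.
have DX (j : 'I_(n + n)) : D 'X_j.
  rewrite /D /sp_act comp_mpolyXU -tnth_nth.
  case: (split_ordP j) => {}j ->; last first.
    by exists 0; rewrite tnth_rshift tnth_mktuple mul0r subrr.
  rewrite tnth_lshift tnth_mktuple /ddiff_den /simple_sp.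
  case: ifP => i0; rewrite /sp_abs /sp_neg /= !ffunE.
    rewrite perm1; case: eqP => [->|_].
      by exists 1; rewrite mul1r expr1 mulN1r opprK -mulr2n mulr_natl.
    by exists 0; rewrite mul0r expr0 mul1r subrr.
  rewrite expr0 mul1r; case: tpermP => [->|->|_ _].
  - by exists 1; rewrite mul1r.
  - by exists (-1); rewrite mulN1r opprB.
  - by exists 0; rewrite mul0r subrr.
elim/mpolyind: f => [|c m p _ _ [g /eqP gE]].
  by exists 0; rewrite mul0r /sp_act comp_mpoly0 subrr.
have [h /eqP hE] : D 'X_[m].
  rewrite mpolyXE_id; apply: big_ind => // j _.
  by elim: (m j) => [|k IHk]; rewrite ?expr0 ?exprS //; apply: DM.
exists (c *: h + g); rewrite mulrDl gE -scalerAl hE /sp_act comp_mpolyD.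
by rewrite comp_mpolyZ scalerBr opprD addrACA.
Qed.

(* The exact quotient; it is unique since Z[X, Y] is an integral domain.      *)
Definition ddiff i f : {mpoly int[n + n]} := xchoose (ddiff_exists i f).

Definition ddiff' i f : {mpoly int[n + n]} :=
  if i == 0 :> nat then ddiff i f else - ddiff i f.

Definition ddiff'_w w f : {mpoly int[n + n]} := foldr ddiff' f (reduced_word w).

End DividedDifferences.

(* Sum over the perfect matchings of {0, ..., 2m - 1}, each represented by    *)
(* the permutation s with s 0 < s 1, s 2 < s 3, ... and s 0 < s 2 < s 4 ...;  *)
(* only the entries A i j with i < j are used.                                *)
Section Pfaffian.
Variables (R : comNzRingType) (m : nat).

Definition dbl_ord (i : 'I_m) : 'I_m.*2 :=
  Ordinal (etrans (ltn_double i m) (ltn_ord i)).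
Definition dblS_ord (i : 'I_m) : 'I_m.*2 :=
  Ordinal (etrans (ltn_Sdouble i m) (ltn_ord i)).

Definition pfaffian (A : 'I_m.*2 -> 'I_m.*2 -> R) : R :=
  \sum_(s : 'S_m.*2 |
          [forall i : 'I_m, s (dbl_ord i) < s (dblS_ord i)]%N
          && [forall i : 'I_m, forall j : 'I_m,
                (i < j) ==> (s (dbl_ord i) < s (dbl_ord j))]%N)
    (-1) ^+ s * \prod_(i < m) A (s (dbl_ord i)) (s (dblS_ord i)).

End Pfaffian.

Section QTilde.
Variable n : nat.

Definition Qtilde2 (i j : nat) : {mpoly int[n]} :=
  mesym n int i * mesym n int j
  + 2 * \sum_(1 <= k < j.+1)
          (-1) ^+ k * mesym n int (i + k) * mesym n int (j - k).

(* [nth 0] appends a zero part when the number of parts is odd.               *)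
Definition Qtilde (la : seq nat) : {mpoly int[n]} :=
  pfaffian (m := uphalf (size la))
    (fun i j => Qtilde2 (nth 0%N la i) (nth 0%N la j)).

(* A strict partition with parts at most n is given by its set of parts, the  *)
(* ordinal i standing for the part i + 1; the dual partition is then ~: la.   *)
Definition parts (la : {set 'I_n}) : seq nat :=
  [seq (i : 'I_n).+1 | i <- rev (enum la)].

Definition Qtilde_strict (la : {set 'I_n}) : {mpoly int[n]} :=
  Qtilde (parts la).

Definition strict_word (la : {set 'I_n}) : seq 'I_n :=
  rev (enum la) ++ enum (~: la).

Lemma strict_word_inj (la : {set 'I_n}) :
  injective (fun i : 'I_n => nth i (strict_word la) i).
Proof.
move=> i j /eqP.
have size_w : size (strict_word la) = n.
  by rewrite size_cat size_rev -!cardE cardsC card_ord.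
have uniq_w : uniq (strict_word la).
  rewrite cat_uniq rev_uniq !enum_uniq andbT /=.
  by apply/hasPn => k; rewrite mem_rev !mem_enum inE.
rewrite (set_nth_default i j) ?size_w ?ltn_ord //.
by rewrite nth_uniq ?size_w ?ltn_ord // => /eqP/val_inj.
Qed.

Definition strict_sp (la : {set 'I_n}) : signed_perm n :=
  SignedPerm (perm (@strict_word_inj la), [ffun i : 'I_n => (i < #|la|)%N]).

Definition rho_set : {set 'I_n} := setT.

Definition QtildeXY : {mpoly int[n + n]} :=
  \sum_(la : {set 'I_n})
    (Qtilde_strict la \mPo varX n) * (Qtilde_strict (~: la) \mPo varY n).

Definition DeltaXY : {mpoly int[n + n]} :=
  \prod_(i < n) \prod_(j < n | (i.+1 + j.+1 <= n)%N)
    ('X_(lshift n i) - 'X_(rshift n j)).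

Definition schubertA_longest : {mpoly int[n]} :=
  \prod_(i < n) 'X_i ^+ (n - i.+1).

Definition schubertC (w : signed_perm n) : {mpoly int[n + n]} :=
  (-1) ^+ (n * (n - 1))./2
    * ddiff'_w (w^-1 * longest_sp n)%g (DeltaXY * QtildeXY).

End QTilde.

(* Main.v *)
From HB Require Import structures.
Require Import Defs.
From mathcomp Require Import all_boot all_order all_algebra all_fingroup.
From mathcomp Require Import mpoly ring zify.

Set Implicit Arguments.
Unset Strict Implicit.
Unset Printing Implicit Defensive.

Import GroupScope GRing.Theory Num.Theory Order.TTheory.
Local Open Scope ring_scope.

(** Write P_w for the given family, F for its top member, and c for P_1.  The
    hypothesis P_longest expresses F through the members P_w at Y = 0 for w a
    permutation or the word of a strict partition.  The proof determines both
    kinds from F itself and substitutes them back.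

    Operators.  The primed divided differences satisfy the braid relations
    (divided_comm, divided_braid3, divided_braid4), so the image of F under a
    reduced word depends only on the product of the word (matsumoto).  Hence
    P_(w s_k) is the image of P_w under the operator of k if k is a descent of
    w, and this operator kills P_w otherwise (dd_family_desc, dd_family_asc).
    Every operator lowers the degree by one, so P_w is homogeneous of degree the
    length of w (family_homog).  At X = Y = 0 all members vanish except P_1,
    which is the constant c.  Setting Y = 0 in P_longest therefore leaves
    one term, and by P_longest_perm and P_rho

      F(X, 0) = (-1)^(n(n-1)/2) c^2 x_1^(n-1) x_2^(n-2) ... x_(n-1) Q_rho(X),

    where Q stands for Q-tilde.

    Strict partitions.  The word of a strict partition is reached from
    (-1, ..., -n) by examining the letters 1, ..., n in turn (walk).  A letter
    that is a part moves to the right past the letters not yet examined, and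
    the operators only strip the staircase monomial (keep_step).  A letter that
    is not a part first loses its bar, and then moves to the end.  The operator
    of index 0 acts on a Pfaffian Q_mu as a contraction,

      sum_i (-1)^(i-1) e_(k-1)(x_2, ..., x_n) Q_(mu without k),  k = mu_i,

    (dd_qtilde), and the operators that follow annihilate every coefficient but
    that of the letter in motion (remove_step, dds_up_stair_tail_last).  So
    P_lambda = c^2 Q_lambda for all lambda (walk_strict).  The empty partition
    gives c = c^2, and c = 0 would make the member of the longest permutation
    vanish at Y = 0; so c = 1.

    Permutations.  The sum of P_(s w)(X) P_s(Y), with w the longest permutation
    and all members taken at Y = 0, equals the product of the x_i + y_j over
    i + j > n + 1 (cauchy).  Both sides take the same value under the operator
    of n - i in X and that of i in Y, both are free of y_1, and they agree at
    Y = 0; a polynomial with the first two properties that vanishes at Y = 0 is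
    zero (intertwined_eq0).

    The substitution of -x_(n+1-i) for x_i and y_(n+1-i) for y_i turns this
    product into (-1)^(n(n-1)/2) Delta (theta_cauchy_kernel), so that
    P_longest reads F = (-1)^(n(n-1)/2) Delta Q(X, Y) (reconstruction), and the
    operators give all the P_w.

    The operators are studied on an arbitrary integral domain with an action of
    the group (divdiff); Z[X, Y] enters only at the end. *)

(** * Length and descents of signed permutations *)

Section Length.
Variable n : nat.
Implicit Types (u v w : signed_perm n) (i j k : 'I_n).
Local Notation s_ := (@simple_sp n).

Definition entry w i : int := (-1) ^+ sp_neg w i * (sp_abs w i).+1%:Z.

(** The two cases are one: a descent at k says that the entry in position k + 1
    is smaller than the one before it, where 0 stands before the first entry. *)
Definition sp_desc w k : bool :=
  if k == 0 :> nat then entry w k < 0 else entry w k < entry w (ord_below k).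

Definition inv_at w i j : nat :=
  (entry w j < entry w i)%R + (entry w i + entry w j < 0)%R.

(** The number of positive roots that w makes negative: a pair of positions
    contributes the roots e_j - e_i and e_i + e_j, a position the root 2 e_i. *)
Definition sp_inversions w : nat :=
  (\sum_(p : 'I_n * 'I_n | p.1 < p.2) inv_at w p.1 p.2
   + \sum_(i < n) (entry w i < 0)%R)%N.

Lemma entry_abs w i : `|entry w i|%N = (sp_abs w i).+1.
Proof. by rewrite /entry abszMsign. Qed.

Lemma entry_neq0 w i : entry w i != 0.
Proof. by rewrite -absz_eq0 entry_abs. Qed.

Lemma entry_absI w i j : `|entry w i|%N = `|entry w j|%N -> i = j.
Proof. by rewrite !entry_abs => -[] /val_inj/perm_inj. Qed.

Lemma entry_inj w : injective (entry w).
Proof. by move=> i j ij; apply: (@entry_absI w); rewrite ij. Qed.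

Lemma entry_sum_neq0 w i j : i != j -> entry w i + entry w j != 0.
Proof.
apply: contraNneq => /eqP; rewrite addr_eq0 => /eqP ij.
by apply/eqP/(@entry_absI w); rewrite ij abszN.
Qed.

Lemma signed_perm_eq u v : entry u =1 entry v -> u = v.
Proof.
move=> uv; apply: signed_permP => i.
  have := congr1 absz (uv i); rewrite !entry_abs => -[] /val_inj.
  exact.
have lt0 w : (entry w i < 0) = sp_neg w i.
  by rewrite /entry; case: (sp_neg w i); rewrite ?mulN1r ?mul1r ?oppr_lt0.
by rewrite -!lt0 uv.
Qed.

Lemma entry_neg w i : (entry w i < 0) = sp_neg w i.
Proof.
by rewrite /entry; case: (sp_neg w i); rewrite ?mulN1r ?mul1r ?oppr_lt0.
Qed.

Lemma entryM u v i :
  entry (u * v)%g i = (-1) ^+ sp_neg v i * entry u (sp_abs v i).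
Proof. by rewrite /entry sp_negM signr_addb -mulrA sp_absM permM. Qed.

Lemma entry_simple0 w k i : k = 0%N :> nat ->
  entry (w * simple_sp k)%g i = if i == k then - entry w i else entry w i.
Proof.
move=> k0; rewrite entryM /simple_sp k0 eqxx /sp_abs /sp_neg /= ffunE perm1.
by case: (i == k); rewrite ?mulN1r ?mul1r.
Qed.

Lemma entry_simple w k i : k != 0%N :> nat ->
  entry (w * simple_sp k)%g i = entry w (tperm (ord_below k) k i).
Proof.
move=> k0; rewrite entryM /simple_sp (negPf k0) /sp_abs /sp_neg /= ffunE.
by rewrite mul1r.
Qed.

Lemma ord_below_neq k : k != 0%N :> nat -> ord_below k != k.
Proof. by move=> k0; apply/eqP => /(congr1 val) /=; lia. Qed.

Lemma tperm_belowE k i : (tperm (ord_below k) k i : nat) =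
  if i == k.-1 :> nat then k : nat else if i == k :> nat then k.-1 else i.
Proof.
case: tpermP => [->|->|]; rewrite ?eqxx //=.
  by case: eqP => //= /esym; rewrite /=; lia.
by do 2![move/eqP; rewrite -val_eqE /= => /negPf ->].
Qed.

Lemma simple_spK k : (simple_sp k * simple_sp k = 1)%g.
Proof.
apply: signed_perm_eq => i; have [k0|k0] := eqVneq (k : nat) 0%N.
  rewrite -[RHS]/(entry 1%g i) -[X in (X * _)%g]mul1g !entry_simple0 //.
  by case: eqP => // _; rewrite opprK.
by rewrite -[X in (X * _)%g]mul1g !entry_simple // tpermK.
Qed.

Lemma simple_spVg k : (simple_sp k)^-1%g = simple_sp k.
Proof. by apply/eqP; rewrite eq_invg_mul simple_spK. Qed.

Lemma mul_simple_spK w k : (w * simple_sp k * simple_sp k = w)%g.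
Proof. by rewrite -mulgA simple_spK mulg1. Qed.

Lemma sp_desc_simple w k : sp_desc (w * simple_sp k)%g k = ~~ sp_desc w k.
Proof.
rewrite /sp_desc; case: eqVneq => [k0|k0].
  rewrite entry_simple0 // eqxx oppr_lt0 -leNgt le_eqVlt.
  by rewrite eq_sym (negPf (entry_neq0 _ _)).
rewrite !entry_simple // tpermR tpermL -leNgt le_eqVlt (inj_eq (@entry_inj w)).
by rewrite (negPf (ord_below_neq k0)).
Qed.

(** Right multiplication by a simple reflection permutes the positive roots
    other than its own, so exactly one term of the count changes. *)
Lemma sp_inversions_desc w k :
  sp_desc w k -> sp_inversions w = (sp_inversions (w * simple_sp k)%g).+1.
Proof.
rewrite /sp_desc /sp_inversions; case: eqVneq => [k0|k0] dk.
  rewrite -addnS; congr (_ + _)%N; last first.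
    rewrite (bigD1 k) //= [in RHS](bigD1 k) //= entry_simple0 // eqxx.
    rewrite oppr_lt0 dk [(0 < _)%R]ltNge (ltW dk) add1n add0n; congr _.+1.
    by apply: eq_bigr => i /negPf ik; rewrite entry_simple0 // ik.
  apply: eq_bigr => -[i j] /= ij; rewrite /inv_at !entry_simple0 //.
  have -> : (j == k) = false by apply/eqP => jk; move: ij; rewrite jk k0.
  case: eqP => // _; rewrite addnC; congr (nat_of_bool _ + nat_of_bool _)%N.
    by rewrite addrC -ltrBrDr sub0r.
  by rewrite addrC subr_lt0.
pose t := tperm (ord_below k) k.
rewrite -addSn; congr (_ + _)%N; last first.
  rewrite (reindex_inj (@perm_inj _ t)); apply: eq_bigr => i _.
  by rewrite entry_simple.
have bk : (ord_below k < k)%N by rewrite /=; lia.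
have tt : involutive (fun p : 'I_n * 'I_n => (t p.1, t p.2)).
  by move=> [i j]; rewrite /= !tpermK.
rewrite [in RHS](reindex_inj (inv_inj tt)) /=.
rewrite (bigD1 (ord_below k, k)) //= [in RHS](bigD1 (k, ord_below k)) /=; last first.
  by rewrite /t tpermL tpermR.
have -> : inv_at w (ord_below k) k =
    (inv_at (w * simple_sp k)%g (t k) (t (ord_below k))).+1.
  rewrite /inv_at !entry_simple // !tpermK dk addrC.
  by rewrite [(entry w (ord_below k) < _)%R]ltNge (ltW dk).
rewrite addSn; congr (_ + _).+1; apply: eq_big => [[i j] /=|[i j] /= _].
  rewrite !tperm_belowE !xpair_eqE -!val_eqE /=.
  by case: eqP; case: eqP; case: eqP; case: eqP => /=; lia.
by rewrite /inv_at !entry_simple // !tpermK.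
Qed.

Lemma sp_inversions_asc w k :
  ~~ sp_desc w k -> sp_inversions (w * simple_sp k)%g = (sp_inversions w).+1.
Proof.
by move=> ak; rewrite (@sp_inversions_desc _ k) ?mul_simple_spK // sp_desc_simple.
Qed.

Lemma entry1 i : entry 1%g i = i.+1%:Z.
Proof. by rewrite /entry /sp_neg /sp_abs /= ffunE perm1 mul1r. Qed.

Lemma sp_inversions1 : sp_inversions 1%g = 0%N.
Proof.
rewrite /sp_inversions !big1 //= => [i _|[i j] /= ij].
  by rewrite entry1.
by rewrite /inv_at !entry1; lia.
Qed.

(** Without descents the entries are positive and increasing, which forces the
    identity. *)
Lemma sp_desc_ex w : w != 1%g -> exists k, sp_desc w k.
Proof.
move=> w1; apply/existsP; apply: contraNT w1 => /existsPn asc; apply/eqP.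
have posw i : 0 < entry w i.
  case: i; elim=> [|i IHi] lti; last first.
    have := asc (Ordinal lti); rewrite /sp_desc /= -leNgt.
    apply: lt_le_trans; have lti' := ltnW lti.
    rewrite (_ : ord_below _ = Ordinal lti') //.
    by apply/val_inj.
  have := asc (Ordinal lti); rewrite /sp_desc /= -leNgt le_eqVlt.
  by rewrite eq_sym (negPf (entry_neq0 _ _)).
have negw i : sp_neg w i = false.
  by rewrite -entry_neg; apply/negP => /lt_trans /(_ (posw i)); rewrite ltxx.
have entw i : entry w i = (sp_abs w i).+1%:Z by rewrite /entry negw mul1r.
have incw i j : (i < j)%N -> (sp_abs w i < sp_abs w j)%N.
  case: j; elim=> [//|j IHj] ltj ij; have ltj' := ltnW ltj.
  have : (sp_abs w (Ordinal ltj') < sp_abs w (Ordinal ltj))%N.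
    have := asc (Ordinal ltj); rewrite /sp_desc /= -leNgt !entw.
    rewrite (_ : ord_below _ = Ordinal ltj'); last by apply/val_inj.
    rewrite lez_nat ltnS leq_eqVlt => /orP[/eqP/val_inj/perm_inj|//].
    by move/(congr1 val) => /=; lia.
  apply: leq_trans; move: ij; rewrite /= ltnS leq_eqVlt => /orP[/eqP ij|ij].
    by rewrite (_ : i = Ordinal ltj') //; apply/val_inj.
  exact/ltnW/IHj.
have gew i : (i <= sp_abs w i)%N.
  case: i; elim=> [//|i IHi] lti; apply: leq_ltn_trans (IHi (ltnW lti)) _.
  by apply: incw; rewrite /=.
have lew i : (sp_abs w i <= i)%N.
  have [m] := ubnP (n - i)%N; elim: m i => // m IHm i.
  rewrite ltnS => lem.
  have [lti|] := ltnP i.+1 n; last by have := ltn_ord (sp_abs w i); lia.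
  have := incw i (Ordinal lti) (leqnn _) => /leq_trans le_i.
  by rewrite -ltnS; apply/le_i/IHm; rewrite /=; lia.
apply: signed_permP => i; rewrite /sp_abs /sp_neg /=; last by rewrite negw ffunE.
by rewrite perm1; apply/val_inj/anti_leq; rewrite lew gew.
Qed.

Lemma sp_inversions_eq0 w : (sp_inversions w == 0%N) = (w == 1%g).
Proof.
apply/idP/eqP => [|->]; last by rewrite sp_inversions1.
apply: contraTeq => /sp_desc_ex[k dk]; by rewrite (sp_inversions_desc dk).
Qed.

Lemma word_prod_cons k a : word_prod (k :: a) = (simple_sp k * word_prod a)%g.
Proof. by rewrite /word_prod big_cons. Qed.

Lemma word_prodV_cons k a :
  ((word_prod (k :: a))^-1 = (word_prod a)^-1 * simple_sp k)%g.
Proof. by rewrite word_prod_cons invMg simple_spVg. Qed.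

Lemma sp_inversions_simple_le w k :
  (sp_inversions (w * simple_sp k)%g <= (sp_inversions w).+1)%N.
Proof.
have [dk|dk] := boolP (sp_desc w k); last by rewrite sp_inversions_asc.
by rewrite (sp_inversions_desc dk); lia.
Qed.

Lemma sp_inversions_word a : (sp_inversions (word_prod a)^-1%g <= size a)%N.
Proof.
elim: a => [|k a IHa].
  by rewrite /word_prod big_nil invg1 sp_inversions1.
rewrite word_prodV_cons (leq_trans (sp_inversions_simple_le _ _)) //.
Qed.

Lemma short_word_ex w :
  exists2 a, word_prod a = w & size a = sp_inversions w^-1%g.
Proof.
have [m] := ubnP (sp_inversions w^-1%g); elim: m w => // m IHm w.
rewrite ltnS => lem; have [w1|] := eqVneq (w^-1)%g 1%g.
  by exists [::]; rewrite ?w1 ?sp_inversions1 // /word_prod big_nil -[w]invgK w1 invg1.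
case/sp_desc_ex => k dk; have E : sp_inversions w^-1%g = (sp_inversions (simple_sp k * w)^-1%g).+1.
  by rewrite invMg simple_spVg; apply: sp_inversions_desc.
have [|a aE sa] := IHm (simple_sp k * w)%g; first by move: lem; rewrite E.
by exists (k :: a); rewrite ?E /= ?sa // word_prod_cons aE mulgA simple_spK mul1g.
Qed.

(** The inverse appears because the first letter of a word is its leftmost
    factor, while descents are read off on the right. *)
Lemma sp_lengthE w : sp_length w = sp_inversions w^-1%g.
Proof.
rewrite /sp_length; case: ex_minnP => m /existsP[a /eqP aE] min.
apply/eqP; rewrite eqn_leq; apply/andP; split; last first.
  by rewrite -aE (leq_trans (sp_inversions_word a)) // size_tuple.
have [b bE sb] := short_word_ex w; apply: min.
rewrite -sb; apply/existsP; exists (in_tuple b); exact/eqP.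
Qed.

Lemma reduced_wordP w :
  word_prod (reduced_word w) = w
  /\ size (reduced_word w) = sp_inversions w^-1%g.
Proof.
rewrite /reduced_word; split; last by rewrite size_tuple sp_lengthE.
exact/eqP/(xchooseP (reduced_word_exists w)).
Qed.

Lemma entry_longestM w i : entry (longest_sp n * w)%g i = - entry w i.
Proof.
rewrite entryM /entry [sp_neg (longest_sp n)]/sp_neg /= ffunE expr1.
by rewrite /sp_abs /= perm1 mulN1r mulrN.
Qed.

Lemma sp_desc_longestM w k : sp_desc (longest_sp n * w)%g k = ~~ sp_desc w k.
Proof.
rewrite /sp_desc; case: eqP => [k0|/eqP k0]; rewrite !entry_longestM.
  by rewrite oppr_lt0 -leNgt le_eqVlt eq_sym (negPf (entry_neq0 _ _)).
rewrite ltrN2 -leNgt le_eqVlt (inj_eq (@entry_inj w)).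
by rewrite (negPf (ord_below_neq k0)).
Qed.

(** The longest element negates every entry, so it exchanges the roots kept
    positive with those made negative. *)
Lemma sp_inversions_longestM w :
  (sp_inversions (longest_sp n * w)%g + sp_inversions w
   = sp_inversions (longest_sp n))%N.
Proof.
have flip (x y : int) : x != y -> ((- x < - y)%R + (x < y)%R = 1)%N.
  by rewrite ltrN2 => xy; case: ltgtP xy.
have pair u i j : i != j ->
    (inv_at (longest_sp n * u)%g i j + inv_at u i j = 2)%N.
  move=> ij; rewrite /inv_at !entry_longestM -opprD addnACA flip; last first.
    by rewrite (inj_eq (@entry_inj u)) eq_sym.
  by rewrite oppr_lt0; have := entry_sum_neq0 u ij; case: ltgtP.
have pos u : (sp_inversions (longest_sp n * u)%g + sp_inversions u
   = \sum_(p : 'I_n * 'I_n | p.1 < p.2) 2 + \sum_(i < n) 1)%N.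
  rewrite /sp_inversions addnACA -!big_split /=; congr (_ + _)%N.
    apply: eq_bigr => -[i j] /= ij; apply: pair.
    by rewrite -val_eqE neq_ltn ij.
  apply: eq_bigr => i _; rewrite entry_longestM oppr_lt0.
  by have := entry_neq0 u i; case: ltgtP.
by rewrite pos -(pos 1%g) mulg1 sp_inversions1 addn0.
Qed.

Lemma simple_sp_comm i j : (i.+1 < j)%N -> (s_ i * s_ j = s_ j * s_ i)%g.
Proof.
move=> ij; apply: signed_perm_eq => k.
have j0 : j != 0%N :> nat by rewrite -lt0n (leq_trans _ ij).
rewrite -[(s_ i * _)%g]mul1g -[(s_ j * _)%g]mul1g !mulgA.
have [i0|i0] := eqVneq (i : nat) 0%N.
  rewrite !(entry_simple _ _ j0, entry_simple0 _ _ i0) -!val_eqE /= tperm_belowE i0.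
  by do ?case: eqP => //=; lia.
rewrite !(entry_simple _ _ j0, entry_simple _ _ i0); congr entry.
by apply/val_inj; rewrite /= !tperm_belowE; do ?case: eqP => //=; lia.
Qed.

Lemma simple_sp_braid3 i j : i != 0%N :> nat -> j = i.+1 :> nat ->
  (s_ i * s_ j * s_ i = s_ j * s_ i * s_ j)%g.
Proof.
move=> i0 ji; have j0 : j != 0%N :> nat by rewrite ji.
apply: signed_perm_eq => k.
rewrite -[(s_ i * _ * _)%g]mul1g -[(s_ j * _ * _)%g]mul1g !mulgA.
rewrite !(entry_simple _ _ j0, entry_simple _ _ i0); congr entry.
by apply/val_inj; rewrite /= !tperm_belowE ji; do ?case: eqP => //=; lia.
Qed.

Lemma simple_sp_braid4 i j : i = 0%N :> nat -> j = 1%N :> nat ->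
  (s_ i * s_ j * s_ i * s_ j = s_ j * s_ i * s_ j * s_ i)%g.
Proof.
move=> i0 j1; have j0 : j != 0%N :> nat by rewrite j1.
apply: signed_perm_eq => k.
rewrite -[(s_ i * _ * _ * _)%g]mul1g -[(s_ j * _ * _ * _)%g]mul1g !mulgA.
rewrite !(entry_simple _ _ j0, entry_simple0 _ _ i0).
rewrite -!val_eqE /= !tperm_belowE i0 j1.
by do ?case: eqP => //=; try lia; rewrite ?opprK.
Qed.

End Length.

(** * Substitutions in Z[X, Y] *)

Lemma comp_mpoly_comp (k l m : nat) (t : k.-tuple {mpoly int[l]})
    (u : l.-tuple {mpoly int[m]}) (f : {mpoly int[k]}) :
  (f \mPo t) \mPo u = f \mPo [tuple tnth t i \mPo u | i < k].
Proof.
rewrite [f \mPo t]comp_mpolyEX [RHS]comp_mpolyEX raddf_sum; apply: eq_bigr => a _ /=.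
rewrite comp_mpolyZ; congr (_ *: _); rewrite !comp_mpolyX rmorph_prod.
by apply: eq_bigr => i _; rewrite rmorphXn tnth_mktuple.
Qed.

Section Substitution.
Variable n : nat.

(** All the operations on Z[X, Y] that occur (the action of the group, setting Y
    to zero, exchanging X and Y) are of this form, hence ring morphisms that
    are determined by the images of the variables. *)
Definition subst (m : nat) (a b : 'I_n -> {mpoly int[m]}) :
    {mpoly int[n + n]} -> {mpoly int[m]} :=
  fun f => f \mPo cat_tuple [tuple a i | i < n] [tuple b i | i < n].

HB.instance Definition _ m (a b : 'I_n -> {mpoly int[m]}) :=
  GRing.RMorphism.copy (subst a b)
    (comp_mpoly (cat_tuple [tuple a i | i < n] [tuple b i | i < n])).

Lemma substX m (a b : 'I_n -> {mpoly int[m]}) i :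
  subst a b 'X_(lshift n i) = a i.
Proof. by rewrite /subst comp_mpolyXU -tnth_nth tnth_lshift tnth_mktuple. Qed.

Lemma substY m (a b : 'I_n -> {mpoly int[m]}) i :
  subst a b 'X_(rshift n i) = b i.
Proof. by rewrite /subst comp_mpolyXU -tnth_nth tnth_rshift tnth_mktuple. Qed.

Lemma eq_subst m (a b c d : 'I_n -> {mpoly int[m]}) :
  a =1 c -> b =1 d -> subst a b =1 subst c d.
Proof.
move=> ac bd f; rewrite /subst; congr (_ \mPo _); apply: eq_from_tnth => i.
by case: (split_ordP i) => j ->; rewrite ?tnth_lshift ?tnth_rshift !tnth_mktuple.
Qed.

Lemma subst_comp_mpoly m (a b : 'I_n -> {mpoly int[m]}) k
    (t : k.-tuple {mpoly int[n + n]}) (f : {mpoly int[k]}) :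
  subst a b (f \mPo t) = f \mPo [tuple subst a b (tnth t i) | i < k].
Proof. exact: comp_mpoly_comp. Qed.

End Substitution.

(** * Divided differences on an integral domain *)

Definition root_of (n : nat) (A : nzRingType) (x : 'I_n -> A) (i : 'I_n) : A :=
  if i == 0 :> nat then 2 * x i else x (ord_below i) - x i.

(** Divided differences enter the argument only through these properties.  The
    interface has two instances on the same ring, one acting on the variables
    x_i and one on the variables y_i. *)
Record divdiff (n : nat) (A : idomainType) := DivDiff {
  dd_x : 'I_n -> A;
  dd_act : signed_perm n -> {rmorphism A -> A};
  dd_op : 'I_n -> A -> A;
  dd_actM : forall u v f, dd_act u (dd_act v f) = dd_act (u * v)%g f;
  dd_act1 : forall f, dd_act 1%g f = f;
  dd_actX : forall w i,
    dd_act w (dd_x i) = (-1) ^+ sp_neg w i * dd_x (sp_abs w i);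
  dd_root_neq0 : forall i, root_of dd_x i != 0;
  dd_opP : forall i f,
    dd_op i f * root_of dd_x i = f - dd_act (simple_sp i) f }.

(** These identities are the relations between two divided differences once
    every operator is expanded in a fraction field.  There f is a polynomial, f
    followed by a word in i and j is its image under the corresponding product
    of reflections, p and q are the two roots if the reflections commute, and
    a, b, c are the variables that the reflections move. *)
Section DihedralIdentities.
Variable K : fieldType.
Implicit Types (f a b c : K).

Lemma divided_comm f fi fj fij p q : p != 0 -> q != 0 ->
  ((f - fj) / q - (fi - fij) / q) / p = ((f - fi) / p - (fj - fij) / p) / q.
Proof. by move=> p0 q0; field; rewrite p0 q0. Qed.

Lemma divided_braid3 f fi fj fij fji fiji a b c :
    a - b != 0 -> b - c != 0 -> a - c != 0 ->
  (((f - fi) / (a - b) - (fj - fji) / (a - c)) / (b - c)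
   - ((fi - f) / (b - a) - (fij - fiji) / (b - c)) / (a - c)) / (a - b)
  = (((f - fj) / (b - c) - (fi - fij) / (a - c)) / (a - b)
   - ((fj - f) / (c - b) - (fji - fiji) / (a - b)) / (a - c)) / (b - c).
Proof.
move=> ab bc ac; field; rewrite ab bc ac /=.
by rewrite -[b - a]opprB -[c - b]opprB !oppr_eq0 ab bc.
Qed.

Lemma divided_braid4 f fi fj fij fji fiji fjij fijij a b :
    2 != 0 :> K -> a != 0 -> b != 0 -> a - b != 0 -> a + b != 0 ->
  ((((f - fj) / (a - b) - (fi - fij) / (- a - b)) / (2 * a) - ((fj - f) /
   (b - a) - (fji - fjij) / (- b - a)) / (2 * b)) / (a - b) - (((fi - fij)
   / (- a - b) - (f - fj) / (- - a - b)) / (2 * (- a)) - ((fij - fi) / (b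
   - (- a)) - (fiji - fijij) / (- b - (- a))) / (2 * b)) / (- a - b)) / (2
   * a)
  = ((((f - fi) / (2 * a) - (fj - fji) / (2 * b)) / (a - b) - ((fi - f) /
   (2 * (- a)) - (fij - fiji) / (2 * b)) / (- a - b)) / (2 * a) - (((fj -
   fji) / (2 * b) - (f - fi) / (2 * a)) / (b - a) - ((fji - fj) / (2 * (-
   b)) - (fjij - fijij) / (2 * a)) / (- b - a)) / (2 * b)) / (a - b).
Proof.
move=> n2 a0 b0 ab pab; field.
rewrite -[- b - a]opprD -[b - a]opprB opprK [b + a]addrC !oppr_eq0.
by rewrite n2 a0 b0 ab pab.
Qed.

End DihedralIdentities.

Section DividedDifference.
Variables (n : nat) (A : idomainType) (S : divdiff n A).
Implicit Types (f g h : A) (i j k : 'I_n) (u v w : signed_perm n).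

Local Notation x := (dd_x S).
Local Notation act := (dd_act S).
Local Notation D := (dd_op S).
Local Notation den := (root_of x).
Local Notation s_ := simple_sp.

Lemma act_sK i f : act (s_ i) (act (s_ i) f) = f.
Proof. by rewrite dd_actM simple_spK dd_act1. Qed.

Lemma act_simple0 i j : i = 0%N :> nat ->
  act (s_ i) (x j) = if j == i then - x j else x j.
Proof.
move=> i0; rewrite dd_actX /simple_sp i0 eqxx /sp_neg /sp_abs /= ffunE perm1.
by case: eqP; rewrite ?mulN1r ?mul1r.
Qed.

Lemma act_simple i j : i != 0%N :> nat ->
  act (s_ i) (x j) = x (tperm (ord_below i) i j).
Proof.
move=> i0; rewrite dd_actX /simple_sp (negPf i0) /sp_neg /sp_abs /= ffunE.
by rewrite mul1r.
Qed.

Lemma den0 i : i = 0%N :> nat -> den i = 2 * x i.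
Proof. by rewrite /root_of => ->. Qed.

Lemma denS i : i != 0%N :> nat -> den i = x (ord_below i) - x i.
Proof. by rewrite /root_of => /negPf ->. Qed.

Lemma dd_unique i f g : g * den i = f - act (s_ i) f -> D i f = g.
Proof. by rewrite -dd_opP => /(mulIf (dd_root_neq0 S i)). Qed.

Lemma act_den i : act (s_ i) (den i) = - den i.
Proof.
have [i0|i0] := eqVneq (i : nat) 0%N.
  by rewrite den0 // rmorphM rmorph_nat /= act_simple0 // eqxx mulrN.
by rewrite denS // rmorphB /= !act_simple // tpermL tpermR opprB.
Qed.

Lemma dd_inv i f : act (s_ i) f = f -> D i f = 0.
Proof. by move=> sf; apply: dd_unique; rewrite sf subrr mul0r. Qed.

Lemma dd_eq0 i f : D i f = 0 -> act (s_ i) f = f.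
Proof.
by move=> d0; have /eqP := dd_opP S i f; rewrite d0 mul0r eq_sym subr_eq0 => /eqP.
Qed.

Lemma ddB i f g : D i (f - g) = D i f - D i g.
Proof.
apply: dd_unique; rewrite mulrBl !dd_opP rmorphB !opprB /=.
by rewrite addrACA [RHS]addrACA [- act _ _ + _]addrC.
Qed.

Lemma dd0 i : D i 0 = 0.
Proof. by apply: dd_inv; rewrite rmorph0. Qed.

Lemma ddN i f : D i (- f) = - D i f.
Proof. by rewrite -sub0r ddB dd0 sub0r. Qed.

Lemma ddD i f g : D i (f + g) = D i f + D i g.
Proof. by rewrite -[g]opprK ddB !ddN. Qed.

Lemma dd_sum i (I : Type) (r : seq I) (p : pred I) (F : I -> A) :
  D i (\sum_(a <- r | p a) F a) = \sum_(a <- r | p a) D i (F a).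
Proof. exact: (big_morph (D i) (ddD i) (dd0 i)). Qed.

Lemma ddM i f g : D i (f * g) = D i f * g + act (s_ i) f * D i g.
Proof.
apply: dd_unique; rewrite mulrDl [_ * g * _]mulrAC -[X in _ + X]mulrA !dd_opP.
by rewrite rmorphM /= mulrBl mulrBr addrA subrK.
Qed.

Lemma ddMl i f g : act (s_ i) f = f -> D i (f * g) = f * D i g.
Proof. by move=> sf; rewrite ddM dd_inv // mul0r add0r sf. Qed.

Lemma ddMr i f g : act (s_ i) g = g -> D i (f * g) = D i f * g.
Proof. by move=> sg; rewrite mulrC ddMl // mulrC. Qed.

Lemma dd_sign i (m : nat) f : D i ((-1) ^+ m * f) = (-1) ^+ m * D i f.
Proof. by apply: ddMl; rewrite rmorph_sign. Qed.

Lemma act_dd i f : act (s_ i) (D i f) = D i f.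
Proof.
apply: (mulIf (dd_root_neq0 S i)); apply: oppr_inj.
rewrite -[in LHS]mulrN -act_den -rmorphM /= dd_opP rmorphB /=.
by rewrite act_sK opprB.
Qed.

Lemma dd_dd i f : D i (D i f) = 0.
Proof. exact/dd_inv/act_dd. Qed.

Definition dds i f : A := if i == 0 :> nat then D i f else - D i f.

Local Notation D' := dds.

Lemma ddsE i f : D' i f = (-1) ^+ (i != 0 :> nat) * D i f.
Proof. by rewrite /dds; case: eqP => _; rewrite ?mul1r ?mulN1r. Qed.

Lemma ddsB i f g : D' i (f - g) = D' i f - D' i g.
Proof. by rewrite !ddsE ddB mulrBr. Qed.

Lemma ddsD i f g : D' i (f + g) = D' i f + D' i g.
Proof. by rewrite !ddsE ddD mulrDr. Qed.

Lemma dds0 i : D' i 0 = 0.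
Proof. by rewrite ddsE dd0 mulr0. Qed.

Lemma dds_sum i (I : Type) (r : seq I) (p : pred I) (F : I -> A) :
  D' i (\sum_(a <- r | p a) F a) = \sum_(a <- r | p a) D' i (F a).
Proof. exact: (big_morph (D' i) (ddsD i) (dds0 i)). Qed.

Lemma dds_eq0 i f : D' i f = 0 -> act (s_ i) f = f.
Proof. by move/eqP; rewrite ddsE mulf_eq0 signr_eq0 => /eqP/dd_eq0. Qed.

Lemma dds_inv i f : act (s_ i) f = f -> D' i f = 0.
Proof. by move=> sf; rewrite ddsE dd_inv // mulr0. Qed.

Lemma ddsMl i f g : act (s_ i) f = f -> D' i (f * g) = f * D' i g.
Proof. by move=> sf; rewrite !ddsE ddMl // mulrCA. Qed.

Lemma ddsMr i f g : act (s_ i) g = g -> D' i (f * g) = D' i f * g.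
Proof. by move=> sg; rewrite mulrC ddsMl // mulrC. Qed.

Lemma dds_sign i (m : nat) f : D' i ((-1) ^+ m * f) = (-1) ^+ m * D' i f.
Proof. by apply: ddsMl; rewrite rmorph_sign. Qed.

Lemma dds_dds i f : D' i (D' i f) = 0.
Proof. by rewrite [D' i f]ddsE dds_sign ddsE dd_dd !mulr0. Qed.

(** In a field a composite of divided differences is a combination of images of f
    with explicit coefficients, and a braid relation becomes an identity of
    rational functions; the exact quotients of the ring have no such
    expansion. *)
Section InField.
Variables (K : fieldType) (tof : {rmorphism A -> K}).
Hypothesis tof_inj : injective tof.

Lemma tof_eq0 f : (tof f == 0) = (f == 0).
Proof. by rewrite -(inj_eq tof_inj) rmorph0. Qed.

Lemma act_neq0 w f : f != 0 -> act w f != 0.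
Proof.
apply: contraNneq => wf0; rewrite -[f](dd_act1 S) -(mulVg w) -dd_actM wf0.
by rewrite rmorph0.
Qed.

(** The expansion rule, with an element w in front so that it applies again to
    the terms it produces. *)
Lemma frac_dd w i f : tof (act w (D i f)) =
  (tof (act w f) - tof (act (w * s_ i)%g f)) / tof (act w (den i)).
Proof.
have nz : tof (act w (den i)) != 0.
  by rewrite tof_eq0 act_neq0 // dd_root_neq0.
apply: (mulIf nz); rewrite mulfVK // -!rmorphM /= dd_opP.
by rewrite !rmorphB dd_actM.
Qed.

Lemma act_mulR w i f : act (w * s_ i)%g f = act w (act (s_ i) f).
Proof. by rewrite dd_actM. Qed.

Lemma dd_comm_in i j f : (i.+1 < j)%N -> D i (D j f) = D j (D i f).
Proof.
move=> ij; have sij := simple_sp_comm ij.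
have j0 : j != 0%N :> nat by rewrite -lt0n (leq_trans _ ij).
have si_den : act (s_ i) (den j) = den j.
  rewrite denS // rmorphB /=.
  have [i0|i0] := eqVneq (i : nat) 0%N.
    rewrite !act_simple0 // -!val_eqE /= i0.
    by do ?case: eqP => //=; lia.
  by rewrite !act_simple // !tpermD // -val_eqE /=; apply/eqP; lia.
have sj_den : act (s_ j) (den i) = den i.
  have [i0|i0] := eqVneq (i : nat) 0%N.
    rewrite den0 // rmorphM rmorph_nat /= act_simple // tpermD // -val_eqE /=;
    by apply/eqP; lia.
  by rewrite denS // rmorphB /= !act_simple // !tpermD // -val_eqE /=;
    apply/eqP; lia.
have nz k : tof (den k) != 0 by rewrite tof_eq0 dd_root_neq0.
apply/eqP; rewrite -(inj_eq tof_inj) -[D i (D j f)](dd_act1 S) -[D j (D i f)](dd_act1 S).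
rewrite !frac_dd !mul1g !dd_act1 si_den sj_den sij; apply/eqP.
exact: divided_comm.
Qed.

Lemma dd_braid3_in i j f : i != 0%N :> nat -> j = i.+1 :> nat ->
  D i (D j (D i f)) = D j (D i (D j f)).
Proof.
move=> i0 ji; have j0 : j != 0%N :> nat by rewrite ji.
have bj : ord_below j = i by apply/val_inj; rewrite /= ji.
set a := ord_below i.
have ai : a != i by exact: ord_below_neq.
have ij : i != j by rewrite -bj ord_below_neq.
have aj : a != j by rewrite -val_eqE /=; apply/eqP; lia.
have [sia sii] : act (s_ i) (x a) = x i /\ act (s_ i) (x i) = x a.
  by rewrite !act_simple // tpermL tpermR.
have sij : act (s_ i) (x j) = x j by rewrite act_simple // tpermD // eq_sym.
have [sji sjj] : act (s_ j) (x i) = x j /\ act (s_ j) (x j) = x i.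
  by rewrite !act_simple // bj tpermL tpermR.
have sja : act (s_ j) (x a) = x a.
  by rewrite act_simple // bj tpermD // eq_sym.
have sE := (sia, sii, sij, sji, sjj, sja).
have nz b c : x b - x c = den i \/ x b - x c = den j
    \/ x b - x c = act (s_ i) (den j) -> tof (x b) - tof (x c) != 0.
  rewrite -rmorphB tof_eq0.
  by case=> [|[]] ->; rewrite ?act_neq0 ?dd_root_neq0.
have nz_ai : tof (x a) - tof (x i) != 0 by apply: nz; left; rewrite denS.
have nz_ij : tof (x i) - tof (x j) != 0.
  by apply: nz; right; left; rewrite denS // bj.
have nz_aj : tof (x a) - tof (x j) != 0.
  by apply: nz; do 2!right; rewrite denS // bj rmorphB /= !sE.
have br := simple_sp_braid3 i0 ji.
apply/eqP; rewrite -(inj_eq tof_inj) -[D i (D j (D i f))](dd_act1 S)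
  -[D j (D i (D j f))](dd_act1 S).
rewrite !frac_dd !mul1g. rewrite br !(denS j0, denS i0) bj -/a !dd_act1 !act_mulR.
rewrite !(rmorphB, sE) /= !act_sK.
exact/eqP/divided_braid3.
Qed.

Lemma dd_braid4_in i j f : i = 0%N :> nat -> j = 1%N :> nat ->
  D i (D j (D i (D j f))) = D j (D i (D j (D i f))).
Proof.
move=> i0 j1; have j0 : j != 0%N :> nat by rewrite j1.
have bj : ord_below j = i by apply/val_inj; rewrite /= j1 i0.
have ij : (j == i) = false by rewrite -val_eqE /= i0 j1.
have [sii sij] : act (s_ i) (x i) = - x i /\ act (s_ i) (x j) = x j.
  by rewrite !act_simple0 // eqxx ij.
have [sji sjj] : act (s_ j) (x i) = x j /\ act (s_ j) (x j) = x i.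
  by rewrite !act_simple // bj tpermL tpermR.
have sE := (sii, sij, sji, sjj).
have nz b : b = den i \/ b = den j \/ b = act (s_ j) (den i)
    \/ b = - act (s_ i) (den j) -> tof b != 0.
  rewrite tof_eq0.
  by case=> [|[|[]]] ->; rewrite ?oppr_eq0 ?act_neq0 ?dd_root_neq0.
have /andP[n2 nz_i] : (2 != 0 :> K) && (tof (x i) != 0).
  have := nz _ (or_introl erefl); rewrite den0 // rmorphM rmorph_nat /=.
  by rewrite mulf_eq0 negb_or.
have nz_j : tof (x j) != 0.
  have := nz _ (or_intror (or_intror (or_introl erefl))).
  by rewrite den0 // rmorphM rmorph_nat /= sE rmorphM mulf_eq0 negb_or => /andP[].
have nz_ij : tof (x i) - tof (x j) != 0.
  by have := nz _ (or_intror (or_introl erefl)); rewrite denS // bj rmorphB.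
have nz_pij : tof (x i) + tof (x j) != 0.
  have := nz _ (or_intror (or_intror (or_intror erefl))).
  by rewrite denS // bj rmorphB /= !sE opprB opprK addrC rmorphD.
have br := simple_sp_braid4 i0 j1.
apply/eqP; rewrite -(inj_eq tof_inj) -[D i (D j (D i (D j f)))](dd_act1 S)
  -[D j (D i (D j (D i f)))](dd_act1 S).
rewrite !frac_dd !mul1g -br !(denS j0, den0 i0) bj !dd_act1 !act_mulR.
rewrite !(rmorphB, rmorphM, rmorph_nat, rmorphN, sE) /= !act_sK.
exact/eqP/divided_braid4.
Qed.

End InField.

Lemma frac_inj : injective (@tofrac A).
Proof. by move=> f g /eqP; rewrite tofrac_eq => /eqP. Qed.

Lemma dd_comm i j f : (i.+1 < j)%N -> D i (D j f) = D j (D i f).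
Proof. exact: dd_comm_in frac_inj _ _ _. Qed.

Lemma dd_braid3 i j f : i != 0%N :> nat -> j = i.+1 :> nat ->
  D i (D j (D i f)) = D j (D i (D j f)).
Proof. exact: dd_braid3_in frac_inj _ _ _. Qed.

Lemma dd_braid4 i j f : i = 0%N :> nat -> j = 1%N :> nat ->
  D i (D j (D i (D j f))) = D j (D i (D j (D i f))).
Proof. exact: dd_braid4_in frac_inj _ _ _. Qed.

End DividedDifference.

(** * Independence of the reduced word *)

Section ReducedWords.
Variable n : nat.
Implicit Types (i j k : 'I_n) (u v w : signed_perm n) (a b c : seq 'I_n).
Local Notation s_ := (@simple_sp n).

Definition reduced a := size a == sp_inversions (word_prod a)^-1%g.

Lemma reduced_tl k a : reduced (k :: a) ->
  reduced a /\ sp_desc (word_prod (k :: a))^-1%g k.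
Proof.
rewrite /reduced word_prodV_cons /= => /eqP sa.
have := sp_inversions_word a; rewrite leq_eqVlt => /orP[/eqP E|lt]; last first.
  by have := sp_inversions_simple_le (word_prod a)^-1%g k; rewrite -sa ltnS leqNgt lt.
split; first by rewrite E.
rewrite sp_desc_simple; apply/negP => /sp_inversions_desc; rewrite E -sa; lia.
Qed.

Lemma reduced_hd k a : reduced a ->
  ~~ sp_desc (word_prod a)^-1%g k -> reduced (k :: a).
Proof.
by rewrite /reduced word_prodV_cons => /eqP E /sp_inversions_asc ->; rewrite /= E.
Qed.

Lemma longest_spK : (longest_sp n * longest_sp n = 1)%g.
Proof.
by apply: signed_perm_eq => i; rewrite entry_longestM -[longest_sp n]mulg1
  entry_longestM opprK.
Qed.

Lemma longest_spV : (longest_sp n)^-1%g = longest_sp n.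
Proof. by apply/eqP; rewrite eq_invg_mul longest_spK. Qed.

End ReducedWords.

Section Matsumoto.
Variables (n : nat) (A : idomainType) (S : divdiff n A).
Implicit Types (i j k : 'I_n) (u v w : signed_perm n) (a b c : seq 'I_n).
Implicit Types (f g : A).
Local Notation s_ := (@simple_sp n).
Local Notation D' := (dds S).

Definition dd_word a f : A := foldr D' f a.

Lemma dd_word_cat a b f : dd_word (a ++ b) f = dd_word a (dd_word b f).
Proof. exact: foldr_cat. Qed.

Lemma dd_word_sign a (m : nat) f :
  dd_word a ((-1) ^+ m * f) = (-1) ^+ m * dd_word a f.
Proof. by elim: a => //= i a ->; rewrite dds_sign. Qed.

(** Two descents i and j of u extend to the two alternating words of the longest
    element of the dihedral group generated by s_i and s_j: they have the same
    product, the same operator by the braid relations, and can both be split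
    off from u without loss of length.  The lengths 2, 3 and 4 are the three
    cases of the proof. *)
Lemma dihedral_words i j u : (i < j)%N -> sp_desc u i -> sp_desc u j ->
  exists p q, [/\ size p = size q, word_prod (i :: p) = word_prod (j :: q),
    forall f, dd_word (i :: p) f = dd_word (j :: q) f
    & (sp_inversions (u * word_prod (i :: p))%g + (size p).+1
       = sp_inversions u)%N].
Proof.
move=> ij di dj; have j0 : j != 0%N :> nat by rewrite -lt0n (leq_trans _ ij).
have wp0 : word_prod [::] = 1%g :> signed_perm n by rewrite /word_prod big_nil.
have [ij1|ji1] := boolP (i.+1 < j)%N.
  exists [:: j], [:: i]; split=> //.
  - by rewrite !word_prod_cons wp0 !mulg1 simple_sp_comm.
  - by move=> f; rewrite /= !ddsE !dd_sign dd_comm // mulrCA.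
  rewrite !word_prod_cons wp0 mulg1 mulgA /= (sp_inversions_desc di).
  rewrite (@sp_inversions_desc _ (u * s_ i)%g j) ?addn2 //.
  rewrite /sp_desc (negPf j0) in dj *.
  have [i0|i0] := eqVneq (i : nat) 0%N.
    rewrite !entry_simple0 // -!val_eqE /= i0.
    by do ?case: eqP => //=; lia.
  by rewrite !entry_simple // !tpermD // -val_eqE /=; apply/eqP; lia.
have ji : j = i.+1 :> nat by lia.
have bj : ord_below j = i by apply/val_inj; rewrite /= ji.
rewrite /sp_desc (negPf j0) bj in dj.
have iNj : i != j by rewrite -val_eqE /= ji; lia.
have [i0|i0] := eqVneq (i : nat) 0%N; last first.
  have nia : i != ord_below i by rewrite eq_sym ord_below_neq.
  have nja : j != ord_below i by rewrite -val_eqE /= ji; apply/eqP; lia.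
  exists [:: j; i], [:: i; j]; split=> //.
  - by rewrite !word_prod_cons wp0 !mulg1 !mulgA simple_sp_braid3.
  - move=> f; rewrite /= !ddsE !dd_sign dd_braid3 //.
    by rewrite (negPf i0) (negPf j0).
  rewrite !word_prod_cons wp0 !mulg1 !mulgA /= (sp_inversions_desc di).
  rewrite /sp_desc (negPf i0) in di.
  have jNi : j != i by rewrite eq_sym.
  have aNj : ord_below i != j by rewrite eq_sym.
  have aNi := ord_below_neq i0.
  rewrite (@sp_inversions_desc _ (u * s_ i)%g j); last first.
    rewrite /sp_desc (negPf j0) !entry_simple // bj tpermR tpermD //.
    exact: lt_trans di.
  rewrite (@sp_inversions_desc _ (u * s_ i * s_ j)%g i) ?addn3 //.
  rewrite /sp_desc (negPf i0) !entry_simple // bj tpermL.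
  by rewrite (@tpermD _ i j) // tpermL (@tpermD _ (ord_below i) i).
have j1 : j = 1%N :> nat by rewrite ji i0.
exists [:: j; i; j], [:: i; j; i]; split=> //.
- by rewrite !word_prod_cons wp0 !mulg1 !mulgA simple_sp_braid4.
- move=> f; rewrite /= !ddsE !dd_sign dd_braid4 //.
  by rewrite i0 j1 /= !mul1r.
rewrite !word_prod_cons wp0 !mulg1 !mulgA /= (sp_inversions_desc di).
rewrite /sp_desc i0 eqxx in di.
have E0 w k : entry (w * s_ i)%g k = if k == i then - entry w k else entry w k.
  exact: entry_simple0.
have Ej w k : entry (w * s_ j)%g k = entry w (tperm i j k).
  by rewrite entry_simple // bj.
have jNi : (j == i) = false by rewrite eq_sym (negPf iNj).
rewrite (@sp_inversions_desc _ (u * s_ i)%g j); last first.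
  rewrite /sp_desc (negPf j0) bj !E0 eqxx jNi.
  by rewrite (lt_trans dj) // (lt_trans di) // oppr_gt0.
rewrite (@sp_inversions_desc _ (u * s_ i * s_ j)%g i); last first.
  by rewrite /sp_desc i0 eqxx Ej tpermL E0 jNi (lt_trans dj).
rewrite (@sp_inversions_desc _ (u * s_ i * s_ j * s_ i)%g j) ?addn4 //.
rewrite /sp_desc (negPf j0) bj !(E0, Ej) eqxx jNi tpermL tpermR.
by rewrite ?eqxx ?jNi ltrN2.
Qed.

(** Induction on the length.  If the first letters i and j differ, both are
    descents of the inverse; the two words are then compared with reduced words
    that start with the two dihedral words and have a common end c.  Each
    comparison is between words with the same first letter. *)
Theorem matsumoto a b f : reduced a -> reduced b -> word_prod a = word_prod b ->
  dd_word a f = dd_word b f.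
Proof.
have [m] := ubnP (size a); elim: m a b => // m IHm a b sam ra rb ab.
have sab : size a = size b by rewrite (eqP ra) (eqP rb) ab.
case: a b => [|i a] [|j b] // in sam ra rb ab sab *.
have [ra' di] := reduced_tl ra; have [rb' dj] := reduced_tl rb.
have [ij|] := eqVneq i j.
  rewrite /= ij; congr (D' _ _); apply: IHm => //.
  by move: ab; rewrite !word_prod_cons ij => /mulgI.
wlog ij : i j a b sam ra rb ab sab ra' rb' di dj / (i < j)%N.
  move=> IH neq; have [ij|] := ltnP i j; first exact: IH.
  rewrite leq_eqVlt => /orP[/eqP/val_inj ij|ji]; first by rewrite ij eqxx in neq.
  by apply/esym/IH => //; [move: sam => /=; case: sab => -> | rewrite eq_sym].
move=> _; rewrite -ab in dj; set u := (word_prod (i :: a))^-1%g in di dj.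
have [p [q [spq wpq opq invu]]] := dihedral_words ij di dj.
have [c cE sc] := short_word_ex (u * word_prod (i :: p))^-1%g.
rewrite invgK in sc.
have wE : word_prod (i :: p ++ c) = word_prod (i :: a).
  by rewrite -cat_cons word_prod_cat cE invMg mulVKg invgK.
have wE' : word_prod (j :: q ++ c) = word_prod (j :: b).
  by rewrite -cat_cons word_prod_cat -wpq -word_prod_cat wE ab.
have rp : reduced (i :: p ++ c).
  by rewrite /reduced wE -/u -invu -sc /= size_cat addnS addnC.
have rq : reduced (j :: q ++ c).
  by rewrite /reduced wE' -ab -/u -invu -sc /= size_cat addnS addnC spq.
have -> : dd_word (i :: a) f = dd_word (i :: p ++ c) f.
  congr (D' _ _); apply: IHm => //; first by case: (reduced_tl rp).
  by move: wE; rewrite !word_prod_cons => /mulgI.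
have -> : dd_word (j :: b) f = dd_word (j :: q ++ c) f.
  congr (D' _ _); apply: IHm => //; first by move: sam => /=; case: sab => ->.
    by case: (reduced_tl rq).
  by move: wE'; rewrite !word_prod_cons => /mulgI.
by rewrite -!cat_cons !dd_word_cat opq.
Qed.

Section Family.
Variable F : A.

Definition dd_family w : A := dd_word (reduced_word (w^-1 * longest_sp n)%g) F.

Lemma reduced_reduced_word w : reduced (reduced_word w).
Proof. by have [wE sw] := reduced_wordP w; rewrite /reduced wE sw. Qed.

(** If k is a descent of w then w^-1 w_0 becomes longer when s_k is put in
    front of it, so a reduced word of the product can be chosen to start
    with k. *)
Lemma dd_family_desc w k : sp_desc w k ->
  dd_family (w * s_ k)%g = D' k (dd_family w).
Proof.
move=> dk; rewrite /dd_family.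
have [wE _] := reduced_wordP (w^-1 * longest_sp n)%g.
have [wE' _] := reduced_wordP ((w * s_ k)^-1 * longest_sp n)%g.
rewrite -[RHS]/(dd_word (k :: _) _); apply: matsumoto.
- exact: reduced_reduced_word.
- apply: reduced_hd; first exact: reduced_reduced_word.
  by rewrite wE invMg invgK longest_spV sp_desc_longestM negbK.
- by rewrite wE' word_prod_cons wE invMg simple_spVg mulgA.
Qed.

(** At an ascent, P_w is itself an image of the operator of k, whose square
    vanishes. *)
Lemma dd_family_asc w k : ~~ sp_desc w k -> D' k (dd_family w) = 0.
Proof.
move=> ak; rewrite -[w](mul_simple_spK _ k) dd_family_desc ?sp_desc_simple //.
exact: dds_dds.
Qed.

End Family.
End Matsumoto.

(** * Pfaffians as iterated contractions *)

Section AlternatingDeletion.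
Variables (T : Type) (A : comPzRingType).
Implicit Types (phi psi : T -> A) (F G : seq T -> A) (s : seq T) (c : A).

(** The alternating sum over the ways to delete one entry x of s, with weight
    phi x.  This is the contraction by phi of an exterior product of vectors
    indexed by s, composed with F; as on an exterior algebra, two contractions
    anticommute and each has square zero, and all the computations with
    Pfaffians below come down to these two facts. *)
Fixpoint alt_del phi F s {struct s} : A :=
  if s is x :: s' then phi x * F s' - alt_del phi (fun u => F (x :: u)) s'
  else 0.

Lemma eq_alt_del phi psi F G s :
    phi =1 psi -> (forall u, (size u).+1 = size s -> F u = G u) ->
  alt_del phi F s = alt_del psi G s.
Proof.
move=> pp; elim: s F G => //= x s IHs F G FG.
by rewrite pp FG // (IHs _ (fun u => G (x :: u))) // => u us; rewrite FG //= us.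
Qed.

Lemma alt_del0 phi s : alt_del phi (fun=> 0) s = 0.
Proof. by elim: s => //= x s ->; rewrite mulr0 subr0. Qed.

Lemma alt_delD phi F G s :
  alt_del phi (fun u => F u + G u) s = alt_del phi F s + alt_del phi G s.
Proof.
by elim: s F G => [|x s IHs] F G /=; rewrite ?addr0 // IHs mulrDr opprD addrACA.
Qed.

Lemma alt_delZ phi c F s :
  alt_del phi (fun u => c * F u) s = c * alt_del phi F s.
Proof.
by elim: s F => [|x s IHs] F /=; rewrite ?mulr0 // IHs mulrCA mulrBr.
Qed.

Lemma alt_delN phi F s : alt_del phi (fun u => - F u) s = - alt_del phi F s.
Proof.
rewrite -mulN1r -alt_delZ; apply: eq_alt_del => // u _.
by rewrite mulN1r.
Qed.

Lemma alt_delB phi F G s :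
  alt_del phi (fun u => F u - G u) s = alt_del phi F s - alt_del phi G s.
Proof. by rewrite alt_delD alt_delN. Qed.

Lemma alt_del_fD phi psi F s :
  alt_del (fun x => phi x + psi x) F s = alt_del phi F s + alt_del psi F s.
Proof.
by elim: s F => [|x s IHs] F /=; rewrite ?addr0 // IHs mulrDl opprD addrACA.
Qed.

Lemma alt_del_fZ c phi F s :
  alt_del (fun x => c * phi x) F s = c * alt_del phi F s.
Proof.
by elim: s F => [|x s IHs] F /=; rewrite ?mulr0 // IHs mulrBr mulrA.
Qed.

Lemma alt_del_fB phi psi F s :
  alt_del (fun x => phi x - psi x) F s = alt_del phi F s - alt_del psi F s.
Proof.
rewrite alt_del_fD; congr (_ + _); rewrite -mulN1r -alt_del_fZ.
by apply: eq_alt_del => // x; rewrite mulN1r.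
Qed.

Lemma alt_del_anticomm phi psi F s :
  alt_del phi (alt_del psi F) s = - alt_del psi (alt_del phi F) s.
Proof.
elim: s F => [|x s IHs] F /=; first by rewrite oppr0.
by rewrite !alt_delB !alt_delZ IHs; ring.
Qed.

Lemma alt_del_alt_del phi F s : alt_del phi (alt_del phi F) s = 0.
Proof.
elim: s F => [//|x s IHs] F /=.
by rewrite alt_delB alt_delZ IHs subr0 subrr.
Qed.

Lemma alt_del_rcons phi F s z :
  alt_del phi F (rcons s z)
  = alt_del phi (fun u => F (rcons u z)) s + (-1) ^+ size s * (phi z * F s).
Proof.
elim: s F => [|x s IHs] F /=; first by rewrite subr0 add0r mul1r.
by rewrite IHs exprS mulN1r opprD addrA mulNr.
Qed.

Lemma alt_delE x0 phi F s :
  alt_del phi F s =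
  \sum_(j < size s) (-1) ^+ j * phi (nth x0 s j) * F (take j s ++ drop j.+1 s).
Proof.
elim: s F => [|x s IHs] F /=; first by rewrite big_ord0.
rewrite big_ord_recl /= drop0 expr0 mul1r IHs -sumrN; congr (_ + _).
by apply: eq_bigr => j _; rewrite /bump /= add1n exprS mulN1r !mulNr.
Qed.

Variable a : T -> T -> A.

(** The Pfaffian of the entries a x y, by expansion along the first row.  The
    number k of pairs drives the recursion; the value is 0 unless s has 2k
    entries. *)
Fixpoint pf k s : A :=
  match k, s with
  | 0, [::] => 1
  | k'.+1, x :: s' => alt_del (a x) (pf k') s'
  | _, _ => 0
  end.

(** Expansion along the last column; it follows from the expansion along the
    first row because the two contractions involved anticommute. *)
Lemma pf_rcons k s z : size s = k.*2.+1 ->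
  pf k.+1 (rcons s z) = alt_del (a^~ z) (pf k) s.
Proof.
elim: k s => [|k IHk] [|x s] //= [].
  by case: s => //= _; rewrite !subr0.
move=> ss; rewrite alt_del_rcons ss -signr_odd /= negbK odd_double /= expr0 mul1r.
rewrite (eq_alt_del (psi := a x) (G := alt_del (a^~ z) (pf k))) //; last first.
  by move=> u; rewrite ss => -[] uS; rewrite -IHk.
by rewrite alt_del_anticomm addrC.
Qed.

End AlternatingDeletion.

Lemma eq_pf (T : Type) (A : comPzRingType) (a b : T -> T -> A) k s :
  (forall x y, a x y = b x y) -> pf a k s = pf b k s.
Proof.
move=> ab; elim: k s => [|k IHk] [|x s] //=.
by apply: eq_alt_del => // y; apply: ab.
Qed.

Lemma rmorph_alt_del (T : Type) (A B : comPzRingType) (h : {rmorphism A -> B})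
    (phi : T -> A) F s :
  h (alt_del phi F s) = alt_del (fun x => h (phi x)) (fun u => h (F u)) s.
Proof.
elim: s F => [|x s IHs] F /=; first by rewrite rmorph0.
by rewrite rmorphB rmorphM IHs.
Qed.

Lemma rmorph_pf (T : Type) (A B : comPzRingType) (h : {rmorphism A -> B})
    (a : T -> T -> A) k s :
  h (pf a k s) = pf (fun x y => h (a x y)) k s.
Proof.
elim: k s => [|k IHk] [|x s] /=; rewrite ?rmorph0 ?rmorph1 //.
by rewrite rmorph_alt_del; apply: eq_alt_del.
Qed.

Section PfaffianExpansion.
Variable R : comNzRingType.

(** Permutations with a prescribed value at one point are the lifts of the
    permutations of one point less; used twice, this fixes the pair that
    contains the first point of a matching. *)
Lemma lift_perm_ex (n : nat) (i j : 'I_n.+1) (s : 'S_n.+1) :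
  s i = j -> exists t, s = lift_perm i j t.
Proof.
move=> sij; pose g k := odflt k (unlift j (s (lift i k))).
have gP k : s (lift i k) = lift j (g k).
  rewrite /g; case: unliftP => [l -> //|].
  by rewrite -sij => /perm_inj/eqP; rewrite eq_sym (negPf (neq_lift _ _)).
have g_inj : injective g.
  by move=> k l gkl; apply/(@lift_inj _ i)/(@perm_inj _ s); rewrite !gP gkl.
exists (perm g_inj); apply/permP => k.
case: (unliftP i k) => [l|] ->; first by rewrite lift_perm_lift permE.
by rewrite lift_perm_id.
Qed.

Lemma lift_perm_inj (n : nat) (i j : 'I_n.+1) : injective (lift_perm i j).
Proof.
move=> s t st; apply/permP => k; apply: (@lift_inj _ j).
by rewrite -!(lift_perm_lift i) st.
Qed.

Lemma sum_lift_perm (n : nat) (i j : 'I_n.+1) (P : pred 'S_n.+1)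
    (F : 'S_n.+1 -> R) :
  \sum_(s : 'S_n.+1 | P s && (s i == j)) F s
  = \sum_(t : 'S_n | P (lift_perm i j t)) F (lift_perm i j t).
Proof.
rewrite (reindex_omap (lift_perm i j) (fun s => [pick t | s == lift_perm i j t])).
  apply: eq_bigl => t; rewrite lift_perm_id eqxx andbT.
  case: pickP => [u /eqP/lift_perm_inj <-|/(_ t)]; last by rewrite eqxx.
  by rewrite eqxx andbT.
move=> s /andP[_ /eqP/lift_perm_ex[t ->]].
case: pickP => [u /eqP/lift_perm_inj <- //|/(_ t)]; by rewrite eqxx.
Qed.

Definition matching_perm m (s : 'S_m.*2) : bool :=
  [forall i : 'I_m, s (dbl_ord i) < s (dblS_ord i)]%N
  && [forall i : 'I_m, forall j : 'I_m,
        (i < j) ==> (s (dbl_ord i) < s (dbl_ord j))]%N.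

(** The first point is the smaller element of its pair, and this pair comes
    first, so it is at position 0. *)
Lemma matching_perm0 m (s : 'S_m.+1.*2) :
  matching_perm s -> s (ord0 : 'I_m.*2.+2) = ord0 :> 'I_m.*2.+2.
Proof.
case/andP=> /forallP s1 /forallP s2; pose k := (s^-1 (ord0 : 'I_m.*2.+2))%g.
have sk : s k = (ord0 : 'I_m.*2.+2) by rewrite permKV.
have lt0 i : (s i < s k)%N = false by rewrite sk.
have k2 : (k./2 < m.+1)%N by rewrite -ltn_double; have := ltn_ord k; lia.
pose i : 'I_m.+1 := Ordinal k2.
have [kodd|keven] := boolP (odd k).
  have kE : k = dblS_ord i by apply/val_inj; rewrite /=; lia.
  by have := s1 i; rewrite -kE lt0.
have kE : k = dbl_ord i by apply/val_inj; rewrite /=; lia.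
have [i0|i_gt0] := posnP i.
  have k0 : k = (ord0 : 'I_m.*2.+2) by apply/val_inj; rewrite kE; move: i0 => /= ->.
  by move: sk; rewrite k0.
have /forallP/(_ i)/implyP/(_ i_gt0) := s2 ord0.
by rewrite -kE lt0.
Qed.

Lemma lift_ltn n (i : 'I_n.+1) (j k : 'I_n) : (lift i j < lift i k)%N = (j < k)%N.
Proof. by rewrite /= /bump; do 2!case: leqP; lia. Qed.

Section LiftMatching.
Variables (m : nat) (j : 'I_m.*2.+1) (r : 'S_m.*2).

(** The matching that pairs the first point with the point j + 1 and matches the
    remaining points as r does. *)
Definition lift_matching : 'S_m.+1.*2 :=
  lift_perm (ord0 : 'I_m.*2.+2) ord0 (lift_perm ord0 j r).

Lemma dbl_ord_lift (i : 'I_m) :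
  dbl_ord (lift ord0 i) = lift (ord0 : 'I_m.*2.+2) (lift ord0 (dbl_ord i)).
Proof. exact: val_inj. Qed.

Lemma dblS_ord_lift (i : 'I_m) :
  dblS_ord (lift ord0 i) = lift (ord0 : 'I_m.*2.+2) (lift ord0 (dblS_ord i)).
Proof. exact: val_inj. Qed.

Lemma lift_matchingE (i : 'I_m.*2) :
  lift_matching (lift (ord0 : 'I_m.*2.+2) (lift ord0 i))
  = lift (ord0 : 'I_m.*2.+2) (lift j (r i)).
Proof. by rewrite /lift_matching !lift_perm_lift. Qed.

Lemma lift_matching0 : lift_matching (dbl_ord ord0) = (ord0 : 'I_m.*2.+2).
Proof.
rewrite (_ : dbl_ord ord0 = (ord0 : 'I_m.*2.+2)) ?lift_perm_id //.
exact/val_inj.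
Qed.

Lemma lift_matching1 :
  lift_matching (dblS_ord ord0) = lift (ord0 : 'I_m.*2.+2) j.
Proof.
rewrite (_ : dblS_ord ord0 = lift (ord0 : 'I_m.*2.+2) ord0); last exact/val_inj.
by rewrite /lift_matching lift_perm_lift lift_perm_id.
Qed.

Lemma lift_matching_perm : matching_perm lift_matching = matching_perm r.
Proof.
apply/idP/idP => /andP[/forallP r1 /forallP r2]; apply/andP; split.
- apply/forallP => i; have := r1 (lift ord0 i).
  by rewrite dbl_ord_lift dblS_ord_lift !lift_matchingE !lift_ltn.
- apply/forallP => i; apply/forallP => k; apply/implyP => ik.
  have /forallP/(_ (lift ord0 k)) := r2 (lift ord0 i).
  by rewrite lift_ltn ik !dbl_ord_lift !lift_matchingE !lift_ltn.
- apply/forallP => i; case: (unliftP ord0 i) => [k|] ->.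
    by rewrite dbl_ord_lift dblS_ord_lift !lift_matchingE !lift_ltn.
  by rewrite lift_matching0 lift_matching1.
- apply/forallP => i; apply/forallP => k; apply/implyP.
  case: (unliftP ord0 k) => [k'|] -> //.
  case: (unliftP ord0 i) => [i'|] ->.
    rewrite lift_ltn !dbl_ord_lift !lift_matchingE !lift_ltn.
    by have /forallP/(_ k')/implyP := r2 i'.
  by rewrite lift_matching0 dbl_ord_lift lift_matchingE.
Qed.

End LiftMatching.

(** The matchings are classified by the partner of the first point.  Putting
    this partner in second position costs the sign of j. *)
Lemma pfaffian_expand m (B : 'I_m.+1.*2 -> 'I_m.+1.*2 -> R) :
  pfaffian B = \sum_(j < m.*2.+1) (-1) ^+ j * B (ord0 : 'I_m.*2.+2)
      (lift (ord0 : 'I_m.*2.+2) j)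
    * pfaffian (fun k l => B (lift (ord0 : 'I_m.*2.+2) (lift j k))
                             (lift (ord0 : 'I_m.*2.+2) (lift j l))).
Proof.
rewrite /pfaffian -/(matching_perm _).
rewrite (eq_bigl (fun s : 'S_m.*2.+2 =>
    @matching_perm m.+1 s && (s ord0 == ord0))); last first.
  move=> s; rewrite -/(matching_perm _) andbC.
  by case: (boolP (matching_perm _)) => [/matching_perm0 ->|]; rewrite ?eqxx ?andbF.
rewrite (@sum_lift_perm _ ord0 ord0).
rewrite (partition_big (fun t : 'S_m.*2.+1 => t ord0) xpredT) //=.
apply: eq_bigr => j _; rewrite sum_lift_perm big_distrr /=.
apply: eq_big => [r|r _]; first exact: lift_matching_perm.
have -> : odd_perm (lift_matching j r) = odd j (+) odd_perm r.
  by rewrite /lift_matching !odd_lift_perm /=.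
rewrite -/(lift_matching j r) signr_addb signr_odd.
rewrite big_ord_recl lift_matching0 lift_matching1.
rewrite mulrACA !mulrA; congr (_ * _).
apply: eq_bigr => i _.
by rewrite dbl_ord_lift dblS_ord_lift !lift_matchingE.
Qed.

Lemma pfaffian_pf (T : Type) (x0 : T) (a : T -> T -> R) m (s : seq T) :
    size s = m.*2 ->
  pfaffian (fun i j : 'I_m.*2 => a (nth x0 s i) (nth x0 s j)) = pf a m s.
Proof.
elim: m s => [|m IHm] [|x s] //.
  move=> _; rewrite /pfaffian (eq_bigl xpredT).
    rewrite (big_pred1 1%g) => [|t]; last first.
      by apply/esym/eqP/permP => -[].
    by rewrite big_ord0 odd_perm1 mulr1.
  by move=> t; rewrite (introT forallP) ?(introT forallP) // => -[].
move=> [ss]; rewrite pfaffian_expand /= (alt_delE x0) ss.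
apply: eq_bigr => j _; congr (_ * _); rewrite -IHm; last first.
  by rewrite size_cat size_take size_drop ss ltn_ord; have := ltn_ord j; lia.
have nthE (k : 'I_m.*2) :
    nth x0 (x :: s) (lift (ord0 : 'I_m.*2.+2) (lift j k))
    = nth x0 (take j s ++ drop j.+1 s) k.
  rewrite -[nat_of_ord (lift _ _)]/(bump j k).+1 /=.
  rewrite nth_cat size_take ss ltn_ord /bump.
  case: leqP => jk; last by rewrite nth_take.
  by rewrite nth_drop add1n addSn subnKC.
rewrite /pfaffian; apply: eq_bigr => t _; congr (_ * _); apply: eq_bigr => i _.
by rewrite -!nthE.
Qed.

End PfaffianExpansion.

(** * Twisted derivations of Pfaffians *)

(** D is modelled on a divided difference and sg on its reflection, so that sgE
    is the definition of D with root z.  By Da the image of the matrix is the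
    wedge of the vectors De and e, and this is why D turns a Pfaffian into two
    contractions, by e and by De. *)
Section TwistedDerivation.
Variables (T : Type) (A : comNzRingType) (a : T -> T -> A) (e : T -> A).
Variables (D sg : A -> A) (z : A).
Hypothesis DB : forall f g, D (f - g) = D f - D g.
Hypothesis DM : forall f g, D (f * g) = D f * g + sg f * D g.
Hypothesis D1 : D 1 = 0.
Hypothesis sgE : forall f, sg f = f - z * D f.
Hypothesis Da : forall x y, D (a x y) = D (e x) * e y - e x * D (e y).

(** A partition of odd length gets a zero part at its end.  Expanding along the
    last column, whose entries are the e x, replaces this part by a contraction
    with e, so that lists of both parities are treated alike. *)
Definition pf_pad (s : seq T) : A :=
  if odd (size s) then alt_del e (pf a (size s)./2) s else pf a (size s)./2 s.

Let De x := D (e x).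

Let D0 : D 0 = 0.
Proof. by rewrite -{1}(subrr 0) DB subrr. Qed.

Let D_alt_del (phi : T -> A) F s : D (alt_del phi F s) =
  alt_del (fun x => D (phi x)) F s
  + alt_del (fun x => sg (phi x)) (fun u => D (F u)) s.
Proof.
elim: s F => [|x s IHs] F /=; first by rewrite D0 addr0.
by rewrite DB DM IHs opprD addrACA.
Qed.

(** Each factor of a term may be differentiated, the factors before it being
    twisted.  Expanding along the first row, the contributions of the twist
    contain a repeated contraction by De or by e, and vanish. *)
Lemma D_pf_even k s : size s = k.+1.*2 ->
  D (pf a k.+1 s) = alt_del De (alt_del e (pf a k)) s.
Proof.
elim: k s => [|k IHk] [|x s] // [ss]; rewrite [pf _ _ _]/=.
  case: s ss => [|y [|? ?]] //= _.
  rewrite !subr0 !mulr1 Da /De; ring.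
pose q := alt_del e (pf a k).
rewrite D_alt_del (eq_alt_del (psi := fun y => De x * e y - e x * De y)
  (G := pf a k.+1)) //.
rewrite (eq_alt_del (psi := fun y => a x y - z * (De x * e y - e x * De y))
  (G := alt_del De q) (phi := fun y => sg _)); first last.
- by move=> u; rewrite ss => -[] /IHk.
- by move=> y; rewrite sgE Da.
rewrite !(alt_del_fB, alt_del_fZ).
rewrite [alt_del e (alt_del De q) s]alt_del_anticomm.
rewrite (eq_alt_del (phi := De) (F := alt_del e q) (psi := De)
  (G := fun=> 0)) // => [|u _]; last exact: alt_del_alt_del.
rewrite alt_del0 (alt_del_alt_del De) oppr0 !mulr0 subrr mulr0 subr0.
rewrite [RHS]/= alt_delB alt_delZ opprB -addrA; congr (_ + _).
rewrite addrC; congr (_ - _).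
rewrite -/(pf a k.+1) [LHS]alt_del_anticomm -alt_delN.
by apply: eq_alt_del => // u _; rewrite /q alt_del_anticomm opprK.
Qed.

Lemma D_pf_odd k s : size s = k.*2.+1 ->
  D (alt_del e (pf a k) s) = alt_del De (pf a k) s.
Proof.
move=> ss; rewrite D_alt_del -[RHS]addr0; congr (_ + _).
case: k ss => [|k] ss.
  case: s ss => [|x [|? ?]] //= _.
  by rewrite D1 mulr0 subr0.
rewrite (eq_alt_del (psi := fun y => e y - z * De y)
  (G := alt_del De (alt_del e (pf a k)))); first last.
- by move=> u; rewrite ss => -[] uS; rewrite D_pf_even.
- by move=> y; rewrite sgE.
rewrite alt_del_fB alt_del_fZ alt_del_alt_del mulr0 subr0 alt_del_anticomm.
rewrite (eq_alt_del (psi := De) (G := fun=> 0)) ?alt_del0 ?oppr0 // => u _.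
exact: alt_del_alt_del.
Qed.

(** D acts as a contraction by De on the family of all the padded Pfaffians: the
    contraction by e in the even case, and its absence in the odd case, is
    exactly the change of parity in the definition of pf_pad. *)
Lemma D_pf_pad s : D (pf_pad s) = alt_del De pf_pad s.
Proof.
rewrite {1}/pf_pad; case: ifP => so.
  rewrite D_pf_odd; last by have := odd_double_half (size s); rewrite so; lia.
  apply: eq_alt_del => // u us; rewrite /pf_pad.
  have -> : odd (size u) = false by move: so; rewrite -us /=; case: odd.
  by congr (pf a _ u); rewrite -us /= uphalf_half; move: so; rewrite -us /=;
    case: odd.
case E: (size s)./2 => [|k].
  have /size0nil -> : size s = 0%N.
    by have := odd_double_half (size s); rewrite so E.
  exact: D1.
have ss : size s = k.+1.*2 by have := odd_double_half (size s); rewrite so E.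
rewrite D_pf_even //; apply: eq_alt_del => // u; rewrite ss => -[] us.
by rewrite /pf_pad us /= odd_double /= uphalf_double.
Qed.

End TwistedDerivation.

Lemma eq_pf_pad (T : Type) (A : comNzRingType) (a b : T -> T -> A) e e' s :
  (forall x y, a x y = b x y) -> e =1 e' -> pf_pad a e s = pf_pad b e' s.
Proof.
move=> ab ee; rewrite /pf_pad; case: ifP => _; last exact: eq_pf.
by apply: eq_alt_del => // u _; apply: eq_pf.
Qed.

Lemma rmorph_pf_pad (T : Type) (A B : comNzRingType) (h : {rmorphism A -> B})
    (a : T -> T -> A) (e : T -> A) (s : seq T) :
  h (pf_pad a e s) = pf_pad (fun x y => h (a x y)) (h \o e) s.
Proof.
rewrite /pf_pad; case: ifP => _; last exact: rmorph_pf.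
by rewrite rmorph_alt_del; apply: eq_alt_del => // u _; apply: rmorph_pf.
Qed.

(** * Staircase monomials and tail symmetric functions *)

Section ElementarySymmetric.
Variable A : comNzRingType.

Fixpoint elem_sym (l : seq A) k : A :=
  if l is y :: l' then elem_sym l' k + (if k is k'.+1 then y * elem_sym l' k' else 0)
  else (k == 0%N)%:R.

Lemma elem_sym0 l : elem_sym l 0 = 1.
Proof. by elim: l => //= y l ->; rewrite addr0. Qed.

End ElementarySymmetric.

Lemma rmorph_elem_sym (A B : comNzRingType) (h : {rmorphism A -> B}) l k :
  h (elem_sym l k) = elem_sym (map h l) k.
Proof.
elim: l k => [|y l IHl] [|k] /=; rewrite ?rmorph_nat ?rmorphD ?rmorph0 ?IHl //.
by rewrite rmorphM IHl.
Qed.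

Section Staircase.
Variables (n : nat) (A : idomainType) (S : divdiff n A).
Implicit Types (f g : A) (i : 'I_n) (k m : nat).
Local Notation x := (dd_x S).
Local Notation act := (dd_act S).
Local Notation D := (dd_op S).
Local Notation D' := (dds S).
Local Notation s_ := (@simple_sp n).

(** e_k of the variables that remain after the first j.  The operators of index
    j carry these functions for j to those for j + 1, which is why the whole
    filtration of the variables is needed and not only e_k itself. *)
Definition tail_esym (j k : nat) : A := elem_sym (drop j [seq x i | i <- enum 'I_n]) k.
Local Notation es := tail_esym.

Lemma tail_esymS (j : 'I_n) k : es j k.+1 = es j.+1 k.+1 + x j * es j.+1 k.
Proof.
rewrite /tail_esym (drop_nth (x j)); last by rewrite size_map size_enum_ord.
rewrite /=.
by rewrite (nth_map j) ?size_enum_ord // nth_ord_enum.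
Qed.

Lemma tail_esym0 j : es j 0 = 1. Proof. exact: elem_sym0. Qed.

Lemma tail_esym_n k : es n k = (k == 0%N)%:R.
Proof. by rewrite /tail_esym drop_oversize // size_map size_enum_ord. Qed.

Lemma act_simple_id i (j : 'I_n) : i != j -> j.+1 != i :> nat -> act (s_ i) (x j) = x j.
Proof.
move=> ij jSi; have [i0|i0] := eqVneq (i : nat) 0%N.
  by rewrite act_simple0 // eq_sym (negPf ij).
by rewrite act_simple // tpermD // -val_eqE /=; apply/eqP; lia.
Qed.

Lemma act_tail_lt i (j k : nat) : (i < j)%N -> act (s_ i) (es j k) = es j k.
Proof.
move=> ij; rewrite /tail_esym rmorph_elem_sym; congr elem_sym.
rewrite -map_drop -map_comp; apply/eq_in_map => l ll /=.
have jl : (j <= l)%N.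
  have := map_f val ll; rewrite map_drop val_enum_ord => /(nthP 0%N)[m].
  rewrite size_drop size_iota => mn; rewrite nth_drop nth_iota; last by lia.
  by move=> /= <-; rewrite add0n leq_addr.
by rewrite act_simple_id // -?val_eqE /=; apply/eqP; lia.
Qed.

(** Only the reflection at the cut acts nontrivially.  For i < j the variables of
    the tail are fixed; for i > j the function is symmetric in the two variables
    exchanged, as the recursion on the first variable shows. *)
Lemma act_tail i (j k : nat) : i != j :> nat -> act (s_ i) (es j k) = es j k.
Proof.
rewrite neq_ltn => /orP[/act_tail_lt -> //|ji].
have [d dE] : exists d, (i = d.+1 + j :> nat)%N by exists (i - j.+1)%N; lia.
elim: d j k ji dE => [|d IHd] j k ji dE.
  have i0 : i != 0%N :> nat by lia.
  have jb : j = ord_below i by rewrite /=; lia.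
  have bS : (ord_below i).+1 = i by rewrite /=; lia.
  have iS m : act (s_ i) (es i.+1 m) = es i.+1 m by exact: act_tail_lt.
  rewrite jb; case: k => [|k]; first by rewrite tail_esym0 rmorph1.
  rewrite tail_esymS bS; case: k => [|k].
    rewrite tail_esym0 tail_esymS tail_esym0 !mulr1 !rmorphD /= iS.
    by rewrite !act_simple // tpermL tpermR addrAC.
  rewrite !tail_esymS !(rmorphD, rmorphM) /= !iS !act_simple // tpermL tpermR.
  by ring.
have jn : (j < n)%N by rewrite (leq_trans ji) // ltnW.
case: k => [|k]; first by rewrite tail_esym0 rmorph1.
rewrite (tail_esymS (Ordinal jn)) /= rmorphD rmorphM /= !IHd; try lia.
by rewrite act_simple_id // -?val_eqE /=; apply/eqP; lia.
Qed.

Lemma dd_var0 i : i = 0%N :> nat -> D i (x i) = 1.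
Proof.
move=> i0; apply: dd_unique.
by rewrite act_simple0 // eqxx den0 // mul1r opprK mulr_natl.
Qed.

Lemma dds_var i : i != 0%N :> nat -> D' i (x i) = 1.
Proof.
move=> i0; rewrite /dds (negPf i0); apply/eqP; rewrite eqr_oppLR; apply/eqP.
by apply: dd_unique; rewrite act_simple // tpermR denS // mulN1r opprB.
Qed.

Lemma dds_var_below i : i != 0%N :> nat -> D' i (x (ord_below i)) = -1.
Proof.
move=> i0; rewrite /dds (negPf i0); congr (- _).
by apply: dd_unique; rewrite act_simple // tpermL denS // mul1r.
Qed.

Lemma dd_tail_id i (j k : nat) : i != j :> nat -> D i (es j k) = 0.
Proof. by move=> ij; rewrite dd_inv ?act_tail. Qed.

Lemma dds_tail_id i (j k : nat) : i != j :> nat -> D' i (es j k) = 0.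
Proof. by move=> ij; rewrite ddsE dd_tail_id ?mulr0. Qed.

Lemma ord_ltS_neq (j : 'I_n) : (j : nat) != j.+1. Proof. by rewrite neq_ltn leqnn. Qed.

Lemma dds_tail (j : 'I_n) k : j != 0%N :> nat -> D' j (es j k.+1) = es j.+1 k.
Proof.
move=> j0; rewrite tail_esymS ddsD dds_tail_id ?add0r ?ord_ltS_neq //.
by rewrite ddsMr ?act_tail ?dds_var ?mul1r ?ord_ltS_neq.
Qed.

(** The isobaric form of the previous rule: if the function is first multiplied
    by the variable just before the cut, the cut moves and the degree stays. *)
Lemma dds_below_tail (j : 'I_n) k : j != 0%N :> nat ->
  D' j (x (ord_below j) * es j k) = - es j.+1 k.
Proof.
move=> j0; have bS : (ord_below j).+1 = j by rewrite /=; lia.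
have -> : x (ord_below j) * es j k = es (ord_below j) k.+1 - es j k.+1.
  by rewrite tail_esymS bS addrAC subrr add0r.
rewrite ddsB dds_tail // dds_tail_id ?sub0r //=; lia.
Qed.

Lemma dd_tail0 (j : 'I_n) k : j = 0%N :> nat -> D j (es j k.+1) = es j.+1 k.
Proof.
move=> j0; rewrite tail_esymS ddD dd_tail_id ?add0r ?ord_ltS_neq //.
by rewrite ddMr ?act_tail ?dd_var0 ?mul1r ?ord_ltS_neq.
Qed.

Definition symmetric_in f := forall i, i != 0%N :> nat -> act (s_ i) f = f.

(** The monomial that remains of stair m, the product of the x_i to the powers
    m, m - 1, and so on, once the operators of indices 1 to j have each lowered
    one exponent.  The exponents of x_j and x_(j+1) are then equal, which makes
    it invariant under s_j. *)
Definition part_stair (m j : nat) : A := \prod_(i < n) x i ^+ (m - i - (i < j)%N).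
Local Notation M := part_stair.

Definition stair (m : nat) : A := \prod_(i < n) x i ^+ (m - i).

Lemma part_stair0 m : M m 0 = stair m.
Proof. by apply: eq_bigr => i _; rewrite subn0. Qed.

Lemma part_stair_last m j : (m <= j)%N -> M m j = stair m.-1.
Proof. by move=> mj; apply: eq_bigr => i _; congr (_ ^+ _); case: ltnP; lia. Qed.

Lemma part_stair_step m (j : 'I_n) : (0 < j <= m)%N ->
  M m j.-1 = x (ord_below j) * M m j.
Proof.
move=> jm; rewrite /part_stair (bigD1 (ord_below j)) //=.
rewrite [in RHS](bigD1 (ord_below j)) //= mulrA -exprS; congr (_ * _).
  by congr (_ ^+ _); case: ltnP; case: ltnP; lia.
apply: eq_bigr => i; rewrite -val_eqE /= => ij.
by congr (_ ^+ _); do 2!case: ltnP; lia.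
Qed.

Lemma act_part_stair m (j : 'I_n) : j != 0%N :> nat -> act (s_ j) (M m j) = M m j.
Proof.
move=> j0; rewrite /part_stair rmorph_prod /=.
rewrite [RHS](reindex_inj (@perm_inj _ (tperm (ord_below j) j))) /=.
apply: eq_bigr => i _; rewrite rmorphXn /= act_simple //; congr (_ ^+ _).
by rewrite tperm_belowE; case: eqP => ?; [|case: eqP => ?]; lia.
Qed.

Lemma act_stair m (j : 'I_n) : (m.+1 < j)%N -> act (s_ j) (stair m) = stair m.
Proof.
move=> mj; have -> : stair m = M m.+1 j by rewrite part_stair_last //; lia.
by apply: act_part_stair; lia.
Qed.

(** The composite of the operators of indices 1, 2, up to j, the first acting
    first; indices that exceed n - 1 are skipped, so that j ranges over all
    numbers. *)
Fixpoint dds_up (j : nat) f : A :=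
  if j is j'.+1 then
    if insub j is Some i then D' i (dds_up j' f) else dds_up j' f
  else f.

Lemma dds_upS (j : nat) (jn : (j.+1 < n)%N) f :
  dds_up j.+1 f = D' (Ordinal jn) (dds_up j f).
Proof. by rewrite /= insubT. Qed.

Lemma dds_upB j f g : dds_up j (f - g) = dds_up j f - dds_up j g.
Proof. by elim: j => //= j ->; case: insub => // i; rewrite ddsB. Qed.

Lemma dds_up0 j : dds_up j 0 = 0.
Proof. by elim: j => //= j ->; case: insub => // i; rewrite dds0. Qed.

Lemma dds_upMr (j : nat) f g : symmetric_in g -> dds_up j (f * g) = dds_up j f * g.
Proof.
move=> sg; elim: j => //= j ->; case: insubP => // i _ iE.
by rewrite ddsMr // sg // iE.
Qed.

Lemma dds_up_stair m j : (j <= m < n)%N ->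
  dds_up j (stair m) = (-1) ^+ j * M m j.
Proof.
elim: j => [_|j IHj jm]; first by rewrite part_stair0 mul1r.
have jn : (j.+1 < n)%N by lia.
pose i := Ordinal jn.
rewrite dds_upS -/i IHj; last by lia.
have -> : M m j = x (ord_below i) * M m i by apply: (@part_stair_step m i) => /=; lia.
rewrite dds_sign ddsMr ?act_part_stair // dds_var_below // exprS.
by rewrite !mulN1r mulrN mulNr.
Qed.

(** While the staircase still supplies a variable, each operator acts
    isobarically on the tail function. *)
Lemma dds_up_stair_tail m k j : (j <= m < n)%N ->
  dds_up j (stair m * es 1 k) = (-1) ^+ j * (M m j * es j.+1 k).
Proof.
elim: j => [_|j IHj jm]; first by rewrite part_stair0 mul1r.
have jn : (j.+1 < n)%N by lia.
pose i := Ordinal jn.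
rewrite dds_upS -/i IHj; last by lia.
have -> : M m j = x (ord_below i) * M m i by apply: (@part_stair_step m i) => /=; lia.
rewrite dds_sign (mulrAC (x _)) ddsMr ?act_part_stair // dds_below_tail // exprS.
by rewrite mulN1r !mulNr mulrN [es _ _ * _]mulrC.
Qed.

(** After m steps the staircase is used up; each of the n - 1 - m remaining
    operators lowers both the degree and the number of variables of the tail
    function by one, and e_k of n - 1 - m variables survives to a constant
    only for k = n - 1 - m.  This is the mechanism that selects a single part
    of a partition. *)
Lemma dds_up_stair_tail_last m k : (m < n)%N ->
  dds_up n.-1 (stair m * es 1 k)
  = (-1) ^+ m * (stair m.-1 * (k.+1 + m == n)%:R).
Proof.
move=> mn; suff H j : (m <= j < n)%N -> dds_up j (stair m * es 1 k) =
    (-1) ^+ m * (stair m.-1 * (if (j <= k + m)%N then es j.+1 (k + m - j) else 0)).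
  rewrite H; last by lia.
  congr (_ * (_ * _)); rewrite prednK; last by lia.
  rewrite tail_esym_n; case: leqP => kn.
    by rewrite (_ : (_ == n) = ((k + m - n.-1)%N == 0%N)) //; apply/eqP/eqP; lia.
  by case: eqP => // ?; lia.
elim: j => [|j IHj] /andP[mj jn].
  have -> : m = 0%N by lia.
  rewrite dds_up_stair_tail; last by lia.
  by rewrite part_stair_last // addn0 subn0.
have [mj'|] := leqP m j; last first.
  move=> jm; have -> : m = j.+1 by lia.
  rewrite dds_up_stair_tail; last by lia.
  by rewrite part_stair_last // leq_addl addnK.
pose i := Ordinal jn; rewrite dds_upS -/i IHj; last by lia.
have st_inv : act (s_ i) (stair m.-1) = stair m.-1.
  case: (m) mj' => [|m'] mj'; last by apply: act_stair; rewrite /=; lia.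
  by rewrite -(part_stair_last (m := 0) (j := i)) // act_part_stair.
rewrite dds_sign ddsMl //; congr (_ * (_ * _)).
case: ifP => lt1; last by rewrite dds0; case: ifP => //; lia.
case: ifP => lt2; last first.
  by rewrite (_ : (k + m - j)%N = 0%N) ?tail_esym0 ?dds_inv ?rmorph1 //; lia.
rewrite (_ : (k + m - j)%N = (k + m - j.+1).+1); last by lia.
exact: (@dds_tail i).
Qed.

End Staircase.

(** * Removing a part *)

(** The two-row polynomial as a function of the sequence e, so that ring
    morphisms can be pushed into it. *)
Definition qpair (A : pzRingType) (e : nat -> A) (i j : nat) : A :=
  e i * e j + 2 * \sum_(1 <= k < j.+1) (-1) ^+ k * e (i + k)%N * e (j - k)%N.

Lemma qpair0 (A : pzRingType) (e : nat -> A) i : e 0 = 1 -> qpair e i 0 = e i.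
Proof. by move=> e0; rewrite /qpair big_geq // mulr0 addr0 e0 mulr1. Qed.

Lemma rmorph_qpair (A B : pzRingType) (h : {rmorphism A -> B}) (e : nat -> A) i j :
  h (qpair e i j) = qpair (h \o e) i j.
Proof.
rewrite /qpair rmorphD !rmorphM rmorph_nat rmorph_sum; congr (_ + _ * _).
by apply: eq_bigr => k _; rewrite !rmorphM rmorph_sign.
Qed.

Section RemoveParts.
Variables (n : nat) (A : idomainType) (S : divdiff n A).
Implicit Types (f g : A) (i : 'I_n) (k m : nat) (u : seq nat).
Local Notation x := (dd_x S).
Local Notation act := (dd_act S).
Local Notation D := (dd_op S).
Local Notation D' := (dds S).
Local Notation s_ := (@simple_sp n).
Local Notation es := (tail_esym S).

Definition qtilde u : A := pf_pad (qpair (es 0)) (es 0) u.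

Lemma qtilde_sym u : symmetric_in S (qtilde u).
Proof.
move=> i i0; rewrite /qtilde rmorph_pf_pad; apply: eq_pf_pad => [y z|y] /=.
  rewrite rmorph_qpair /qpair /= !act_tail //; congr (_ + _ * _).
  by apply: eq_bigr => k _; rewrite !act_tail.
by rewrite act_tail.
Qed.

(** The function e_k splits off x_1, on which s_0 acts by a sign. *)
Lemma es0_step (o : 'I_n) k : o = 0%N :> nat ->
  es 0 k = es 1 k + x o * (if k is k'.+1 then es 1 k' else 0).
Proof.
move=> o0; case: k => [|k]; first by rewrite !tail_esym0 mulr0 addr0.
by have := tail_esymS S o k; rewrite o0.
Qed.

Definition down k : A := if k is k'.+1 then es 1 k' else 0.

Lemma dd_es0 (o : 'I_n) k : o = 0%N :> nat -> D o (es 0 k) = down k.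
Proof.
move=> o0; case: k => [|k].
  by rewrite tail_esym0 dd_inv // rmorph1.
by have := dd_tail0 S k o0; rewrite o0.
Qed.

(** The images of the products e_a e_b with a + b fixed, taken with alternating
    signs, telescope; what is left is the antisymmetric expression required of
    the entries of the matrix. *)
Lemma dd_qpair (o : 'I_n) (i j : nat) : o = 0%N :> nat ->
  D o (qpair (es 0) i j) = D o (es 0 i) * es 0 j - es 0 i * D o (es 0 j).
Proof.
move=> o0; have es1 k : act (s_ o) (es 1 k) = es 1 k.
  by rewrite act_tail // o0.
have acto k : act (s_ o) (es 0 k) = es 1 k - x o * down k.
  rewrite (es0_step k o0) rmorphD rmorphM /= es1 act_simple0 // eqxx mulNr.
  by case: k => [|k]; rewrite ?rmorph0 ?es1.
have prod a b : D o (es 0 a * es 0 b) = down a * es 1 b + es 1 a * down b.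
  rewrite ddM !dd_es0 // acto [es 0 b](es0_step b o0) -/(down b).
  by ring.
have tele a b : \sum_(1 <= k < b.+1) (-1) ^+ k
    * (down (a + k)%N * es 1 (b - k)%N + es 1 (a + k)%N * down (b - k)%N)
  = - (es 1 a * down b).
  elim: b a => [|b IHb] a; first by rewrite big_geq // mulr0 oppr0.
  rewrite big_ltn // big_add1 /= expr1 addn1 subn1 /=.
  rewrite (eq_big_nat _ _ (F2 := fun k => - ((-1) ^+ k * (down (a.+1 + k)%N
      * es 1 (b - k)%N + es 1 (a.+1 + k)%N * down (b - k)%N)))); last first.
    by move=> k _; rewrite exprS mulN1r mulNr addnS addSn subSS.
  by rewrite sumrN IHb opprK mulN1r opprD -addrA addNr addr0.
rewrite /qpair ddD prod ddMl ?rmorph_nat // dd_sum.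
rewrite (eq_bigr (fun k => (-1) ^+ k
    * (down (i + k)%N * es 1 (j - k)%N + es 1 (i + k)%N * down (j - k)%N))).
  rewrite tele !dd_es0 // (es0_step i o0) (es0_step j o0) -!/(down _); ring.
by move=> k _; rewrite -mulrA dd_sign prod.
Qed.

Lemma dd_qtilde (o : 'I_n) u : o = 0%N :> nat ->
  D o (qtilde u) = alt_del down qtilde u.
Proof.
move=> o0; rewrite /qtilde (D_pf_pad (sg := act (s_ o)) (z := 2 * x o)).
- by apply: eq_alt_del => // k; rewrite dd_es0.
- exact: ddB.
- exact: ddM.
- by rewrite dd_inv ?rmorph1.
- by move=> f; rewrite mulrC -den0 // dd_opP opprB addrC subrK.
- by move=> y z; apply: dd_qpair.
Qed.

(** When a letter keeps its bar the partition does not change: the operators see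
    f as a constant and only lower the staircase. *)
Lemma keep_step m f : (m < n)%N -> symmetric_in S f ->
  dds_up S m (stair S m * f) = (-1) ^+ m * (stair S m.-1 * f).
Proof.
move=> mn sf; rewrite dds_upMr // dds_up_stair ?leqnn //.
by rewrite part_stair_last // mulrA.
Qed.

Lemma additive_alt_del (L : A -> A) (phi psi : nat -> A) (F : seq nat -> A) s :
    (forall f g, L (f - g) = L f - L g) ->
    (forall k c, symmetric_in S c -> L (phi k * c) = psi k * c) ->
    (forall s, symmetric_in S (F s)) ->
  L (alt_del phi F s) = alt_del psi F s.
Proof.
move=> LB Lphi; elim: s F => [|k s IHs] F sF /=; last by rewrite LB Lphi ?IHs.
by rewrite -{1}(subrr 0) LB subrr.
Qed.

Lemma alt_del_delta (F : seq nat -> A) s t a : a \notin s -> a \notin t ->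
  alt_del (fun k => (k == a)%:R) F (s ++ a :: t) = (-1) ^+ size s * F (s ++ t).
Proof.
have notin0 G v : a \notin v -> alt_del (fun k => (k == a)%:R : A) G v = 0.
  elim: v G => //= b v IHv G; rewrite inE negb_or eq_sym => /andP[/negPf-> av].
  by rewrite mul0r IHv // subr0.
elim: s F => [|b s IHs] F /= => [_ ta|].
  by rewrite eqxx !mul1r notin0 // subr0.
rewrite inE negb_or eq_sym => /andP[/negPf-> sa] ta.
by rewrite mul0r sub0r IHs // exprS mulN1r mulNr.
Qed.

(** The value of b is the parity of the exponent; what matters below is that the
    result is proportional to one monomial. *)
Lemma dd_Xn (o : 'I_n) m : o = 0%N :> nat ->
  exists b : bool, D o (x o ^+ m.+1) = b%:R * x o ^+ m.
Proof.
move=> o0; elim: m => [|m [b IHm]].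
  by exists true; rewrite expr1 dd_var0 // mul1r.
exists (~~ b); rewrite exprS ddM dd_var0 // IHm act_simple0 // eqxx mul1r mulNr.
by rewrite mulrCA -exprS; case: b {IHm}; rewrite ?mul1r ?mul0r ?subrr ?subr0.
Qed.

Lemma dds_upD (j : nat) f g :
  dds_up S j (f + g) = dds_up S j f + dds_up S j g.
Proof. by elim: j => //= j ->; case: insub => // i; rewrite ddsD. Qed.

Lemma dds_up_killed (j : nat) (i : 'I_n) f : i = 1%N :> nat -> (0 < j)%N ->
  D' i f = 0 -> dds_up S j f = 0.
Proof.
move=> i1 + dif; elim: j => [//|[|j] IHj] _.
  rewrite /=; case: insubP => [k _ kE|]; last by rewrite -i1 ltn_ord.
  by rewrite (_ : k = i) //; apply/val_inj; rewrite /= i1.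
have -> : dds_up S j.+2 f = if insub j.+2 is Some k
    then D' k (dds_up S j.+1 f) else dds_up S j.+1 f by [].
by rewrite IHj //; case: insub => // k; rewrite dds0.
Qed.

(** When a letter loses its bar, the operator of index 0 may act on the power of
    x_1 or on the polynomial.  In the first case the exponents of x_1 and x_2
    become equal and the next operator gives 0.  In the second case the
    polynomial turns into an alternating sum over its parts k, with e_(k-1) of
    x_2, ..., x_n as coefficient; the remaining operators annihilate all these
    coefficients except that of the part a + 1. *)
Lemma remove_step (o : 'I_n) m u v a : o = 0%N :> nat ->
    (a.+1 + m)%N = n -> a.+1 \notin u -> a.+1 \notin v -> size u = m ->
  dds_up S n.-1 (D o (stair S m * qtilde (u ++ a.+1 :: v)))
  = (-1) ^+ m * (stair S m.-1 * qtilde (u ++ v)).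
Proof.
move=> o0 am ua va su; set f := qtilde _.
have sf : symmetric_in S f by exact: qtilde_sym.
have mn : (m < n)%N by lia.
pose r := \prod_(i < n | i != o) x i ^+ (m - i).
have stE : stair S m = x o ^+ m * r by rewrite /stair (bigD1 o) //= o0 subn0.
have sr : act (s_ o) r = r.
  rewrite rmorph_prod; apply: eq_bigr => i /negPf io.
  by rewrite rmorphXn /= act_simple0 // io.
have -> : D o (stair S m * f)
    = D o (x o ^+ m) * (r * f) + (-1) ^+ m * (stair S m * D o f).
  rewrite stE -mulrA ddM rmorphXn /= act_simple0 // eqxx [(- x o) ^+ m]exprNn.
  by rewrite (ddMl _ sr) !mulrA.
have -> : dds_up S n.-1 (D o (x o ^+ m) * (r * f)
    + (-1) ^+ m * (stair S m * D o f))
    = dds_up S n.-1 ((-1) ^+ m * (stair S m * D o f)).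
  rewrite dds_upD -[RHS]add0r; congr (_ + _).
  case: m => [|m] in am su mn r stE sr *.
    by rewrite expr0 dd_inv ?rmorph1 // mul0r dds_up0.
  have [b ->] := dd_Xn m o0.
  have lt1n : (1 < n)%N by lia.
  pose i := Ordinal lt1n.
  apply: (@dds_up_killed _ i) => //; first by lia.
  have MmE : x o ^+ m * r = part_stair S m.+1 i.
    rewrite /part_stair (bigD1 o) //= o0 subn0 subn1; congr (_ * _).
    apply: eq_bigr => k ko; congr (_ ^+ _); case: ltnP => [k0|]; last by rewrite subn0.
    by case/eqP: ko; apply/val_inj; rewrite /= o0; lia.
  rewrite -!mulrA [x o ^+ m * _]mulrA MmE dds_inv //.
  by rewrite !rmorphM rmorph_nat /= act_part_stair // sf.
rewrite dd_qtilde //.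
(* The composite operator is linear over symmetric factors, so it can be moved
   to the weights of the contraction. *)
rewrite (_ : dds_up S n.-1 ((-1) ^+ m * (stair S m * alt_del down qtilde (u ++ a.+1 :: v)))
  = alt_del (fun k => stair S m.-1 * (k == a.+1)%:R) qtilde (u ++ a.+1 :: v)).
  by rewrite alt_del_fZ alt_del_delta // su mulrCA.
rewrite (additive_alt_del (L := fun f => dds_up S n.-1 ((-1) ^+ m * (stair S m * f)))
  (psi := fun k => stair S m.-1 * (k == a.+1)%:R)) //.
- by move=> g h; rewrite !mulrBr dds_upB.
- move=> k c sc; rewrite !mulrA dds_upMr //; congr (_ * _).
  rewrite -mulrA mulrC dds_upMr; last by move=> i _; rewrite rmorph_sign.
  case: k => [|k] /=; first by rewrite mulr0 dds_up0 mul0r mulr0.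
  rewrite dds_up_stair_tail_last // [_ * (-1) ^+ _]mulrC mulrA -exprD addnn.
  rewrite -signr_odd odd_double mul1r.
  by rewrite (_ : (k.+1 + m == n)%N = (k.+1 == a.+1)) //; apply/eqP/eqP; lia.
- by move=> s; apply: qtilde_sym.
Qed.

End RemoveParts.

(** * From the longest element to the words of strict partitions *)

Section OneLine.
Variable n : nat.
Implicit Types (w : signed_perm n) (i k : 'I_n).
Local Notation s_ := (@simple_sp n).
Local Notation letter := (bool * 'I_n)%type.
Implicit Types (p y : letter) (l t : seq letter).

Definition letter_val p : int := (-1) ^+ p.1 * p.2.+1%:Z.

Definition oneline w : seq letter :=
  [seq (sp_neg w i, sp_abs w i) | i <- enum 'I_n].

Lemma size_oneline w : size (oneline w) = n.
Proof. by rewrite size_map size_enum_ord. Qed.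

Lemma nth_oneline w i d : nth d (oneline w) i = (sp_neg w i, sp_abs w i).
Proof. by rewrite (nth_map i) ?size_enum_ord // nth_ord_enum. Qed.

Lemma oneline_inj : injective oneline.
Proof.
move=> v w vw; apply: signed_permP => i;
  by have := nth_oneline v i (true, i); rewrite vw nth_oneline => -[].
Qed.

Lemma entry_oneline w i d : entry w i = letter_val (nth d (oneline w) i).
Proof. by rewrite nth_oneline. Qed.

Lemma oneline_simple w i l p y t : (size l).+1 = i ->
  oneline w = l ++ p :: y :: t -> oneline (w * s_ i)%g = l ++ y :: p :: t.
Proof.
move=> li wE; have i0 : i != 0%N :> nat by rewrite -li.
apply: (@eq_from_nth _ p) => [|m].
  rewrite (_ : size _ = size (oneline w)); last by rewrite !size_oneline.
  by rewrite wE !size_cat.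
rewrite size_oneline => mn; pose k := Ordinal mn; rewrite -[m]/(k : nat).
have -> : nth p (oneline (w * s_ i)%g) k
    = nth p (oneline w) (tperm (ord_below i) i k).
  rewrite !nth_oneline sp_negM sp_absM permM /simple_sp (negPf i0).
  by rewrite /sp_abs /sp_neg /= ffunE.
rewrite wE !nth_cat tperm_belowE -li /=.
have [->|ml] := eqVneq m (size l).
  by rewrite ltnn subnn ltnNge leqnSn subSnn.
have [->|mSl] := eqVneq m (size l).+1.
  by rewrite ltnn subnn ltnNge leqnSn subSnn.
case: ltnP => // lm.
have [d ->] : exists d, (m - size l = d.+2)%N by exists (m - size l).-2; lia.
by [].
Qed.

Lemma oneline_simple0 w i b k t : i = 0%N :> nat ->
  oneline w = (b, k) :: t -> oneline (w * s_ i)%g = (~~ b, k) :: t.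
Proof.
move=> i0 wE; apply: (@eq_from_nth _ (b, k)) => [|m].
  rewrite (_ : size _ = size (oneline w)); last by rewrite !size_oneline.
  by rewrite wE.
rewrite size_oneline => mn; pose j := Ordinal mn; rewrite -[m]/(j : nat).
have := nth_oneline w j (b, k); rewrite wE => wj.
rewrite nth_oneline sp_negM sp_absM permM.
have [-> ->] : sp_abs (s_ i) j = j /\ sp_neg (s_ i) j = (m == 0%N).
  rewrite /simple_sp i0 eqxx /sp_abs /sp_neg /= ffunE perm1 -val_eqE /= i0.
  by [].
case: m mn @j wj => [|m] mn j /= wj; last by rewrite wj.
by case: wj => <- <-.
Qed.

Lemma entry_nth w i l p t : size l = i -> oneline w = l ++ p :: t ->
  entry w i = letter_val p.
Proof. by move=> li wE; rewrite (entry_oneline w i p) wE -li nth_cat ltnn subnn. Qed.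

End OneLine.

Section Walk.
Variables (n : nat) (A : idomainType) (S : divdiff n A).
Variables (G : signed_perm n -> A).
Local Notation s_ := (@simple_sp n).
Local Notation D := (dd_op S).
Local Notation D' := (dds S).
Hypothesis G_desc : forall w k, sp_desc w k -> G (w * s_ k)%g = D' k (G w).

(** Every step of the move to the right exchanges p with a smaller letter, so it
    is a descent and applies an operator. *)
Lemma walk_right w p l t : oneline w = p :: l ++ t ->
    all (fun y => letter_val y < letter_val p) l ->
  exists2 w', oneline w' = l ++ p :: t & G w' = dds_up S (size l) (G w).
Proof.
elim/last_ind: l t => [|l y IHl] t wE; first by exists w.
rewrite all_rcons => /andP[yp lp].
have [w' w'E GE] := IHl (y :: t) (etrans wE (congr1 _ (cat_rcons _ _ _))) lp.
have ln : ((size l).+1 < n)%N.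
  by have := size_oneline w'; rewrite w'E size_cat /=; lia.
pose i := Ordinal ln; exists (w' * s_ i)%g.
  by rewrite cat_rcons; apply: (oneline_simple _ w'E).
rewrite size_rcons dds_upS -/i G_desc ?GE // /sp_desc /=.
rewrite (entry_nth (l := rcons l p) (p := y) (t := t)) ?cat_rcons ?size_rcons //.
by rewrite (entry_nth (l := l) (p := p) (t := y :: t)).
Qed.

Variable c : A.
Hypothesis c_inv : forall i, dd_act S (s_ i) c = c.
Hypothesis n_gt0 : (0 < n)%N.
Variable la : {set 'I_n}.

Local Notation o := (Ordinal n_gt0).
Local Notation up := (map (fun i : 'I_n => i.+1)).
Local Notation bar := (map (fun i : 'I_n => (true, i))).
Local Notation pos := (map (fun i : 'I_n => (false, i))).
Local Notation en := (enum 'I_n).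

Definition seen_in a := [seq i <- take a en | i \in la].
Definition seen_out a := [seq i <- take a en | i \notin la].

(** The word reached once the letters 1, ..., a have been examined: the letters
    not examined keep their bars and come first, followed by the examined ones
    in the order of the final word.  The partition attached to it contains the
    letters that are still barred. *)
Definition walk_word a := bar (drop a en) ++ bar (rev (seen_in a)) ++ pos (seen_out a).
Definition walk_parts a := up (rev (drop a en)) ++ up (rev (seen_in a)).

Hypothesis G_longest :
  G (longest_sp n) = stair S n.-1 * qtilde S (walk_parts 0) * c.

Lemma drop_enum_ord (i : 'I_n) : drop i en = i :: drop i.+1 en.
Proof. by rewrite (drop_nth i) ?size_enum_ord // nth_ord_enum. Qed.

Lemma take_enum_ord (i : 'I_n) : take i.+1 en = rcons (take i en) i.
Proof. by rewrite (take_nth i) ?size_enum_ord // nth_ord_enum. Qed.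

Lemma mem_drop_enum a i : (i \in drop a en) = (a <= i)%N.
Proof.
have -> : (i \in drop a en) = (val i \in map val (drop a en)).
  by rewrite mem_map //; apply: val_inj.
rewrite map_drop val_enum_ord drop_iota add0n mem_iota.
by have := ltn_ord i; rewrite /=; lia.
Qed.

Lemma mem_take_enum a i : (i \in take a en) = (i < a)%N.
Proof.
have -> : (i \in take a en) = (val i \in map val (take a en)).
  by rewrite mem_map //; apply: val_inj.
rewrite map_take val_enum_ord take_iota mem_iota.
by have := ltn_ord i; rewrite /=; lia.
Qed.

(** The first letter, the smallest not yet examined, moves to the right.  If it
    is a part of the partition it stays barred and passes the letters not
    examined; otherwise it loses its bar and moves to the end. *)
Lemma walk a : (a <= n)%N -> exists2 w, oneline w = walk_word a
  & G w = stair S (n - a.+1) * qtilde S (walk_parts a)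
          * ((-1) ^+ (\sum_(b < a) (n - b.+1)) * c).
Proof.
elim: a => [_|a IHa an].
  exists (longest_sp n); last by rewrite big_ord0 mul1r subn1.
  rewrite /walk_word drop0 /seen_in /seen_out take0 cats0 /oneline.
  by apply: eq_map => i; rewrite /sp_neg /sp_abs /= ffunE perm1.
have [w wE GE] := IHa (ltnW an); pose i := Ordinal an.
set C := (-1) ^+ _ * c in GE.
have C_inv k : dd_act S (s_ k) C = C by rewrite rmorphM rmorph_sign /= c_inv.
have sC : symmetric_in S C by move=> k _.
have dropE : drop a en = i :: drop a.+1 en by rewrite -(drop_enum_ord i).
have takeE : take a.+1 en = rcons (take a en) i by rewrite -(take_enum_ord i).
have size_bar : size (bar (drop a.+1 en)) = (n - a.+1)%N.
  by rewrite size_map size_drop size_enum_ord.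
have i_in : seen_in a.+1 = if i \in la then rcons (seen_in a) i else seen_in a.
  by rewrite /seen_in takeE filter_rcons.
have i_out : seen_out a.+1 = if i \in la then seen_out a else rcons (seen_out a) i.
  by rewrite /seen_out takeE filter_rcons if_neg.
have barE : walk_word a = (true, i) :: bar (drop a.+1 en)
    ++ (bar (rev (seen_in a)) ++ pos (seen_out a)).
  by rewrite /walk_word dropE.
have upE : walk_parts a = up (rev (drop a.+1 en)) ++ i.+1 :: up (rev (seen_in a)).
  by rewrite /walk_parts dropE rev_cons map_rcons cat_rcons.
have signE : (-1) ^+ (\sum_(b < a.+1) (n - b.+1)) * c = (-1) ^+ (n - a.+1) * C.
  by rewrite big_ord_recr /= addnC exprD mulrA.
have [i_la|i_la] := boolP (i \in la); rewrite ?i_la ?(negPf i_la) in i_in i_out.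
  have [|w' w'E G'E] := walk_right (etrans wE barE).
    apply/allP => y /mapP[k]; rewrite mem_drop_enum => ak ->.
    by rewrite /letter_val /= expr1; lia.
  exists w'.
    by rewrite w'E /walk_word i_in i_out rev_rcons.
  rewrite G'E GE size_bar dds_upMr // keep_step; first last.
  - exact: qtilde_sym.
  - by lia.
  have -> : walk_parts a.+1 = walk_parts a.
    by rewrite upE /walk_parts i_in rev_rcons.
  rewrite signE [in RHS]mulrA [_ * (-1) ^+ _]mulrC; congr (_ * (stair _ _ * _) * _).
  by lia.
have dw : sp_desc w o.
  rewrite /sp_desc /= (@entry_nth _ _ _ [::] (true, i) _ _ (etrans wE barE)) //.
set rest := bar (drop a.+1 en) ++ (bar (rev (seen_in a)) ++ pos (seen_out a)) in barE.
have w0E : oneline (w * s_ o)%g = (false, i) :: rest ++ [::].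
  by rewrite cats0 (@oneline_simple0 _ w o true i rest) // wE.
have size_rest : size rest = n.-1.
  by have := size_oneline w; rewrite wE barE /=; lia.
have [|w' w'E G'E] := walk_right w0E.
  apply/allP => y; rewrite !mem_cat => /or3P[] /mapP[k];
    rewrite ?mem_rev ?mem_filter ?mem_drop_enum ?mem_take_enum => ak ->.
  - by rewrite /letter_val /= expr1; lia.
  - by rewrite /letter_val /= expr1; lia.
  - by case/andP: ak => _ ka; rewrite /letter_val /= !expr0 !mul1r; lia.
exists w'.
  rewrite w'E /walk_word i_in i_out /rest map_rcons -!catA; congr (_ ++ (_ ++ _)).
  by rewrite cats1.
have upS : walk_parts a.+1 = up (rev (drop a.+1 en)) ++ up (rev (seen_in a)).
  by rewrite /walk_parts i_in.
rewrite G'E size_rest G_desc // /dds /= GE upE ddMr // dds_upMr //.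
rewrite (@remove_step _ _ _ o (n - a.+1)) //; first last.
- by rewrite size_map size_rev size_drop size_enum_ord.
- apply/negP => /mapP[k]; rewrite mem_rev mem_filter mem_take_enum => /andP[_ ka].
  by move=> [ak]; rewrite ak ltnn in ka.
- apply/negP => /mapP[k]; rewrite mem_rev mem_drop_enum => ak [ka].
  by rewrite -ka ltnn in ak.
- by rewrite /=; lia.
rewrite signE upS [in RHS]mulrA [_ * (-1) ^+ _]mulrC.
by congr (_ * (stair _ _ * _) * _); lia.
Qed.

Lemma seen_inE : seen_in n = enum la.
Proof. by rewrite /seen_in take_oversize ?size_enum_ord // enumT. Qed.

Lemma seen_outE : seen_out n = enum (~: la).
Proof.
rewrite /seen_out take_oversize ?size_enum_ord // enumT.
by apply: eq_filter => i; rewrite [RHS]inE.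
Qed.

Lemma oneline_strict : oneline (strict_sp la) = walk_word n.
Proof.
rewrite /walk_word drop_oversize ?size_enum_ord //= seen_inE seen_outE.
have size_in : size (rev (enum la)) = #|la| by rewrite size_rev -cardE.
have size_all : size (strict_word la) = n.
  by rewrite size_cat size_in -cardE cardsC card_ord.
apply: (@eq_from_nth _ (true, o)) => [|m].
  by rewrite size_oneline -[LHS]size_all !size_cat !size_map.
rewrite size_oneline => mn; pose i := Ordinal mn; rewrite -[m]/(i : nat).
rewrite nth_oneline /sp_neg /sp_abs /= ffunE permE /= nth_cat size_map size_in.
have := size_all; rewrite size_cat size_in /strict_word nth_cat size_in => szE.
case: ltnP => im.
  by rewrite (nth_map i) ?size_in.
by rewrite (nth_map i) // ltn_subLR // szE.
Qed.

Theorem walk_strict : G (strict_sp la)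
  = qtilde S (parts la) * ((-1) ^+ (\sum_(b < n) (n - b.+1)) * c).
Proof.
have [w wE Gw] := walk (leqnn n).
have -> : strict_sp la = w by apply: oneline_inj; rewrite wE oneline_strict.
rewrite Gw; congr (_ * _); rewrite (_ : (n - n.+1)%N = 0%N); last by lia.
rewrite /stair big1 => [|i _]; last by rewrite expr0.
by rewrite mul1r /walk_parts drop_oversize ?size_enum_ord // seen_inE.
Qed.

End Walk.

Lemma walk_parts0 n (la : {set 'I_n}) : walk_parts la 0 = parts (rho_set n).
Proof.
rewrite /walk_parts drop0 /seen_in take0 cats0 /parts /rho_set.
by congr (map _ (rev _)); apply/esym/eq_enum => i; rewrite in_setT.
Qed.

(** * The type A Cauchy identity *)

(** A morphism that commutes with the reflection and fixes the root commutes
    with the divided difference, by uniqueness of the quotient. *)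
Lemma dd_morph n (A : idomainType) (S : divdiff n A) (h : {rmorphism A -> A}) i f :
    (forall g, h (dd_act S (simple_sp i) g) = dd_act S (simple_sp i) (h g)) ->
    h (root_of (dd_x S) i) = root_of (dd_x S) i ->
  h (dds S i f) = dds S i (h f).
Proof.
move=> hs hd; rewrite !ddsE rmorphM rmorph_sign; congr (_ * _).
by apply/esym/dd_unique; rewrite -hd -rmorphM dd_opP rmorphB hs.
Qed.

(** sub a b stands for the substitution of a_i for x_i and b_i for y_i.  By
    sub_ext every identity between composites of substitutions is checked on
    the variables. *)
Section DoublePolynomials.
Variables (n : nat) (A : idomainType) (SX : divdiff n A) (y : 'I_n -> A).
Variable sub : ('I_n -> A) -> ('I_n -> A) -> {rmorphism A -> A}.
Local Notation x := (dd_x SX).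
Local Notation actX := (dd_act SX).
Local Notation DX := (dds SX).
Local Notation s_ := (@simple_sp n).
Implicit Types (f g : A) (i j k : 'I_n) (w : signed_perm n).

Hypothesis subX : forall a b i, sub a b (x i) = a i.
Hypothesis subY : forall a b i, sub a b (y i) = b i.
Hypothesis sub_ext : forall g h : {rmorphism A -> A},
  (forall i, g (x i) = h (x i)) -> (forall i, g (y i) = h (y i)) -> g =1 h.
Hypothesis n_gt0 : (0 < n)%N.
Hypothesis actX_y : forall w i, actX w (y i) = y i.

Definition swap_xy := sub y x.
Definition setY0 := sub x (fun=> 0).
Definition set_x0 := sub (fun i => if i == 0 :> nat then 0 else x i) y.
Definition set_y0 (m : nat) := sub x (fun i => if (i < m)%N then 0 else y i).

Lemma swap_xyK f : swap_xy (swap_xy f) = f.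
Proof.
rewrite -[LHS]/((swap_xy \o swap_xy) f) -[RHS]/((@idfun A) f).
by apply: sub_ext => i /=; rewrite /swap_xy ?subX ?subY ?subX.
Qed.

Definition signed_y w i : A := (-1) ^+ sp_neg w i * y (sp_abs w i).

Definition actY w := sub x (signed_y w).

Definition opY i f := swap_xy (dd_op SX i (swap_xy f)).

Lemma swap_xy_act w f : swap_xy (actX w f) = actY w (swap_xy f).
Proof.
rewrite -[LHS]/((swap_xy \o actX w) f) -[RHS]/((actY w \o swap_xy) f).
apply: sub_ext => i /=; rewrite /swap_xy /actY.
  by rewrite dd_actX rmorphM rmorph_sign !subX subY.
by rewrite actX_y !subY subX.
Qed.

Lemma actYM u v f : actY u (actY v f) = actY (u * v)%g f.
Proof.
rewrite -[f in LHS]swap_xyK -[f in RHS]swap_xyK -!swap_xy_act.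
by rewrite dd_actM.
Qed.

Lemma actY1 f : actY 1%g f = f.
Proof. by rewrite -{1}[f]swap_xyK -swap_xy_act dd_act1 swap_xyK. Qed.

Lemma actY_y w i : actY w (y i) = (-1) ^+ sp_neg w i * y (sp_abs w i).
Proof. exact: subY. Qed.

Lemma swap_xy_root i : swap_xy (root_of x i) = root_of y i.
Proof.
rewrite /root_of; case: ifP => _; rewrite ?rmorphM ?rmorph_nat ?rmorphB /=;
  by rewrite /swap_xy !subX.
Qed.

Lemma root_y_neq0 i : root_of y i != 0.
Proof.
rewrite -swap_xy_root; apply: contraNneq (dd_root_neq0 SX i) => E.
by rewrite -[root_of _ _]swap_xyK E rmorph0.
Qed.

Lemma opYP i f : opY i f * root_of y i = f - actY (s_ i) f.
Proof.
rewrite -swap_xy_root /opY -rmorphM dd_opP rmorphB /= swap_xy_act.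
by rewrite swap_xyK.
Qed.

(** The operators on the variables y_i are those on the x_i conjugated by the
    exchange of the two sets of variables. *)
Definition SY : divdiff n A :=
  DivDiff actYM actY1 actY_y root_y_neq0 opYP.

Local Notation DY := (dds SY).

Lemma swap_xy_dds i f : swap_xy (DX i f) = DY i (swap_xy f).
Proof.
rewrite !ddsE rmorphM rmorph_sign; congr (_ * _).
by rewrite /= /opY swap_xyK.
Qed.

Lemma sub_actX (a b : 'I_n -> A) w f : (forall i, a i = x i) ->
    (forall i, actX w (b i) = b i) ->
  sub a b (actX w f) = actX w (sub a b f).
Proof.
move=> ax wb; rewrite -[LHS]/((sub a b \o actX w) f) -[RHS]/((actX w \o sub a b) f).
apply: sub_ext => i /=; rewrite ?(subX, subY) ?dd_actX ?actX_y ?subY ?wb //.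
by rewrite rmorphM rmorph_sign subX !ax dd_actX.
Qed.

Lemma sub_dds (a b : 'I_n -> A) i f : (forall j, a j = x j) ->
    (forall j, actX (s_ i) (b j) = b j) ->
  sub a b (DX i f) = DX i (sub a b f).
Proof.
move=> ax wb; apply: dd_morph => [g|]; first exact: sub_actX.
rewrite /root_of; case: ifP => _; rewrite ?rmorphM ?rmorph_nat ?rmorphB /=;
  by rewrite !subX !ax.
Qed.

Lemma setY0_dds i f : setY0 (DX i f) = DX i (setY0 f).
Proof. by apply: sub_dds => // j; rewrite rmorph0. Qed.

Lemma set_y0_dds m i f : set_y0 m (DX i f) = DX i (set_y0 m f).
Proof. by apply: sub_dds => // j; case: ifP => _; rewrite ?rmorph0. Qed.

Lemma dds_comm i j f : DX i (DY j f) = DY j (DX i f).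
Proof.
rewrite [DY j f]ddsE dds_sign -[DX i (dd_op SY j f)]/(DX i (dd_op SY j f)).
rewrite [RHS]ddsE; congr (_ * _); apply/esym.
apply: dd_unique; rewrite /=.
have rootX : actX (s_ i) (root_of y j) = root_of y j.
  by rewrite /root_of; case: ifP => _; rewrite ?rmorphM ?rmorph_nat ?rmorphB /= !actX_y.
rewrite -(ddsMr _ rootX) opYP ddsB; congr (_ - _).
rewrite -[RHS]/(sub x (signed_y (s_ j)) (DX i f)) sub_dds // => k.
by rewrite rmorphM rmorph_sign /= actX_y.
Qed.

Lemma set_x0_dds i f : set_x0 (DY i f) = DY i (set_x0 f).
Proof.
apply: dd_morph => [g|].
  rewrite -[LHS]/((set_x0 \o actY (s_ i)) g) -[RHS]/((actY (s_ i) \o set_x0) g).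
  apply: sub_ext => j /=; rewrite /set_x0 /actY ?subX ?subY.
    by case: ifP => _; rewrite ?rmorph0 ?subX.
  by rewrite rmorphM rmorph_sign /= !subY.
by rewrite /root_of; case: ifP => _; rewrite ?rmorphM ?rmorph_nat ?rmorphB /=
  /set_x0 !subY.
Qed.

Lemma set_x0_setY0 f : set_x0 (setY0 f) = setY0 (set_x0 f).
Proof.
rewrite -[LHS]/((set_x0 \o setY0) f) -[RHS]/((setY0 \o set_x0) f).
apply: sub_ext => j /=; rewrite /set_x0 /setY0 ?subX ?subY ?rmorph0 //.
by case: ifP => _; rewrite ?rmorph0 ?subX.
Qed.

Lemma set_y0_swap_xy f : set_y0 1 (swap_xy f) = swap_xy (set_x0 f).
Proof.
rewrite -[LHS]/((set_y0 1 \o swap_xy) f) -[RHS]/((swap_xy \o set_x0) f).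
apply: sub_ext => j /=; rewrite /set_y0 /swap_xy /set_x0 ?subX ?subY ?subX //.
by rewrite ltnS leqn0; case: ifP => _; rewrite ?rmorph0 ?subX.
Qed.

(** Being free of y_1 passes from each variable to the next by the transposition
    that exchanges them. *)
Lemma symmetric_setY0 f :
    (forall i, i != 0%N :> nat -> actY (s_ i) f = f) -> set_y0 1 f = f ->
  setY0 f = f.
Proof.
move=> sf zf; have zm m : (m < n)%N -> set_y0 m.+1 f = f.
  elim: m => [//|m IHm mn]; pose i := Ordinal mn.
  have i0 : i != 0%N :> nat by [].
  have {}IHm := IHm (ltnW mn).
  rewrite -[RHS]IHm -[in RHS](sf i i0) -[in RHS]IHm -[in RHS](sf i i0).
  rewrite -[RHS]/((set_y0 m.+1 \o (actY (s_ i) \o (set_y0 m.+1 \o actY (s_ i)))) f).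
  apply: sub_ext => k /=; first by rewrite /set_y0 /actY !subX.
  have actS l : actY (s_ i) (y l) = y (tperm (ord_below i) i l).
    exact: (act_simple SY).
  rewrite /set_y0 subY actS subY.
  have [tk|tk] := ltnP (tperm (ord_below i) i k) m.+1; rewrite tperm_belowE /= in tk.
    rewrite !rmorph0; case: ltnP => // km; exfalso.
    by move: tk; case: eqP => ?; [|case: eqP => ?]; lia.
  rewrite actS tpermK subY; congr (if _ then _ else _).
  by move: tk; case: eqP => ?; [|case: eqP => ?]; lia.
rewrite -[RHS](zm n.-1) ?prednK //; apply: sub_ext => k /=.
  by rewrite /setY0 /set_y0 !subX.
by rewrite /setY0 /set_y0 !subY ltn_ord.
Qed.

(** The index n - i: conjugation by the longest permutation exchanges s_i and
    s_(n-i). *)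
Definition ord_opp i : 'I_n := rev_ord (ord_below i).

Lemma ord_oppE i : i != 0%N :> nat -> ord_opp i = (n - i)%N :> nat.
Proof. by move=> i0; rewrite /=; lia. Qed.

Definition positive_word (a : seq 'I_n) := all (fun i : 'I_n => i != 0%N :> nat) a.

Hypothesis long_words : forall f, exists m, forall a,
  (m <= size a)%N -> dd_word SX a f = 0.

(** The functional equation shared by both sides of the Cauchy identity. *)
Definition intertwined f :=
  forall i, i != 0%N :> nat -> DX (ord_opp i) f = DY i f.

Lemma ddsY_word i a f : DY i (dd_word SX a f) = dd_word SX a (DY i f).
Proof. by elim: a => //= k a <-; rewrite dds_comm. Qed.

Lemma dd_word_rcons a i f : dd_word SX (rcons a i) f = dd_word SX a (DX i f).
Proof. by rewrite -cats1 dd_word_cat. Qed.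

(** Uniqueness.  All images g of f under words in the x-operators vanish, by
    descending induction on the length of the word, since long words annihilate
    f.  Indeed a y-operator sends g to the image of f under a longer word, so g
    is symmetric in Y; being free of y_1, it is free of Y; and it vanishes at
    Y = 0. *)
Lemma intertwined_eq0 f :
  intertwined f -> setY0 f = 0 -> set_y0 1 f = f -> f = 0.
Proof.
move=> itw f0 f1; have [m km] := long_words f.
suff H d a : (m <= size a + d)%N -> positive_word a -> dd_word SX a f = 0.
  exact: (H m [::]).
elim: d a => [|d IHd] a le_m pa; first by rewrite km // -[size a]addn0.
set g := dd_word SX a f.
have g0 : setY0 g = 0.
  rewrite /g; elim: (a) => //= k b IHb.
  by rewrite setY0_dds IHb dds0.
have g1 : set_y0 1 g = g.
  by rewrite /g; elim: (a) => //= k b IHb; rewrite set_y0_dds IHb.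
rewrite -g0 symmetric_setY0 // => i i0.
apply: (dds_eq0 (S := SY)); rewrite /g ddsY_word -itw // -dd_word_rcons.
apply: IHd; first by rewrite size_rcons addSnnS.
rewrite /positive_word all_rcons; apply/andP; split=> //.
by rewrite ord_oppE //; have := ltn_ord i; lia.
Qed.

(** Numbered from 1, the factors are those with i + j > n + 1, so that neither
    x_1 nor y_1 occurs. *)
Definition cauchy_kernel : A :=
  \prod_(p : 'I_n * 'I_n | (n <= p.1 + p.2)%N) (x p.1 + y p.2).

(** All factors but x_(n-i+1) + y_(i+1) form a product invariant under s_(n-i)
    on X and under s_i on Y, and both operators send this factor to 1. *)
Lemma cauchy_kernel_intertwined : intertwined cauchy_kernel.
Proof.
move=> i i0; set k := ord_opp i.
have kE : k = (n - i)%N :> nat by exact: ord_oppE.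
clearbody k; have i_lt := ltn_ord i.
have k0 : k != 0%N :> nat by rewrite kE -lt0n subn_gt0.
pose N := \prod_(p : 'I_n * 'I_n | (n <= p.1 + p.2)%N && (p != (k, i)))
  (x p.1 + y p.2).
have KE : cauchy_kernel = (x k + y i) * N.
  have nki : (n <= k + i)%N by rewrite kE; have := ltn_ord i; lia.
  by rewrite /cauchy_kernel (bigD1 (k, i)).
have NX : actX (s_ k) N = N.
  pose t := tperm (ord_below k) k.
  have tt : involutive (fun p : 'I_n * 'I_n => (t p.1, p.2)).
    by move=> [a b]; rewrite /= tpermK.
  rewrite rmorph_prod [RHS](reindex_inj (inv_inj tt)) /=.
  apply: eq_big => [[a b]|[a b] _] /=.
    rewrite !xpair_eqE -!val_eqE /= /t tperm_belowE.
    by case: (a =P k.-1 :> nat) => ?; [|case: (a =P k :> nat) => ?]; lia.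
  by rewrite rmorphD /= actX_y act_simple.
have NY : actY (s_ i) N = N.
  pose t := tperm (ord_below i) i.
  have tt : involutive (fun p : 'I_n * 'I_n => (p.1, t p.2)).
    by move=> [a b]; rewrite /= tpermK.
  rewrite rmorph_prod [RHS](reindex_inj (inv_inj tt)) /=.
  apply: eq_big => [[a b]|[a b] _] /=.
    rewrite !xpair_eqE -!val_eqE /= /t tperm_belowE.
    by case: (b =P i.-1 :> nat) => ?; [|case: (b =P i :> nat) => ?]; lia.
  rewrite rmorphD /= {1}/actY subX; congr (_ + _).
  exact: (act_simple SY).
rewrite KE !ddsMr // ddsD [DY i _]ddsD dds_var // (dds_var SY i0).
rewrite dds_inv ?actX_y // (dds_inv (S := SY)); last exact: subX.
by rewrite addr0 add0r.
Qed.

(** The commuting families of x- and y-operators let a word be transferred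
    letter by letter, in the opposite order. *)
Lemma intertwined_word f a : intertwined f -> positive_word a ->
  exists2 b, positive_word b & dd_word SX a f = dd_word SY b f.
Proof.
move=> itw; elim: a => [|i a IHa] /=; first by exists [::].
case/andP=> i0 /IHa[b pb E]; exists (rcons b (ord_opp i)).
  rewrite /positive_word all_rcons; apply/andP; split=> //.
  by rewrite ord_oppE //; have := ltn_ord i; lia.
have oppK : ord_opp (ord_opp i) = i.
  by apply/val_inj; have := ltn_ord i; rewrite /=; lia.
have o0 : ord_opp i != 0%N :> nat.
  by rewrite ord_oppE //; have := ltn_ord i; lia.
rewrite -cats1 dd_word_cat /= -[RHS]/(dd_word SY b (DY (ord_opp i) f)).
rewrite -itw // oppK -[LHS]/(DX i (dd_word SX a f)) E.
by elim: (b) => //= k c IHc; rewrite dds_comm IHc.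
Qed.

(** An x-operator could create x_1, but a y-operator cannot, and the two have
    the same effect here. *)
Lemma cauchy_kernel_word_free a : positive_word a ->
  set_x0 (dd_word SX a cauchy_kernel) = dd_word SX a cauchy_kernel.
Proof.
move=> pa; have [b _ ->] := intertwined_word cauchy_kernel_intertwined pa.
elim: b => [|i b IHb] /=; last by rewrite set_x0_dds IHb.
rewrite /cauchy_kernel rmorph_prod; apply: eq_bigr => -[i j] /= ij.
rewrite rmorphD /= /set_x0 subX subY; case: eqP => // i0.
by move: ij; rewrite i0 add0n leqNgt ltn_ord.
Qed.

Section Cauchy.
Variable G : signed_perm n -> A.
Hypothesis G_desc : forall w k, sp_desc w k -> G (w * s_ k)%g = DX k (G w).
Hypothesis G_asc : forall w k, ~~ sp_desc w k -> DX k (G w) = 0.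
Hypothesis G_setY0 : forall w, setY0 (G w) = G w.
Hypothesis G_const : forall s : 'S_n,
  sub (fun=> 0) (fun=> 0) (G (sp_of s)) = (s == 1%g)%:R.
Local Notation o_ := (longest_perm n).
Hypothesis G_longest : G (sp_of o_) = setY0 cauchy_kernel.

Lemma sp_of1 : sp_of 1%g = 1%g :> signed_perm n.
Proof. by apply: signed_permP => k; rewrite /sp_abs /sp_neg. Qed.

Lemma simple_spE i : i != 0%N :> nat -> s_ i = sp_of (tperm (ord_below i) i).
Proof. by rewrite /simple_sp => /negPf ->. Qed.

Lemma entry_sp_of (s : 'S_n) i : entry (sp_of s) i = (s i).+1%:Z.
Proof. by rewrite /entry /sp_neg /sp_abs /= ffunE mul1r. Qed.

Lemma longest_permE i : o_ i = rev_ord i.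
Proof. by rewrite permE. Qed.

Lemma longest_permK : (o_ * o_ = 1)%g.
Proof. by apply/permP => i; rewrite permM !longest_permE rev_ordK perm1. Qed.

Lemma ord_opp_below i : i != 0%N :> nat -> ord_below (ord_opp i) = rev_ord i.
Proof. by move=> i0; apply/val_inj; have := ltn_ord i; rewrite /=; lia. Qed.

Lemma rev_ord_opp i : rev_ord (ord_opp i) = ord_below i.
Proof. exact: rev_ordK. Qed.

(** Multiplication by the longest permutation reverses the word, so positions i
    and n - i correspond and descents become ascents. *)
Lemma desc_longest (s : 'S_n) i : i != 0%N :> nat ->
  sp_desc (sp_of s * sp_of o_)%g (ord_opp i) = ~~ sp_desc (sp_of s) i.
Proof.
move=> i0; have o0 : ord_opp i != 0%N :> nat.
  by rewrite ord_oppE //; have := ltn_ord i; lia.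
rewrite /sp_desc (negPf i0) (negPf o0) -sp_ofM !entry_sp_of !permM !longest_permE.
rewrite ord_opp_below // rev_ordK rev_ord_opp -leNgt le_eqVlt.
rewrite [X in X || _](_ : _ = false) //.
by rewrite eqz_nat eqSS val_eqE (inj_eq perm_inj) (negPf (ord_below_neq i0)).
Qed.

Lemma longest_simple i : i != 0%N :> nat ->
  (sp_of o_ * s_ (ord_opp i) = s_ i * sp_of o_)%g.
Proof.
move=> i0; have o0 : ord_opp i != 0%N :> nat.
  by rewrite ord_oppE //; have := ltn_ord i; lia.
rewrite !simple_spE // -!sp_ofM ord_opp_below //; congr sp_of.
have oV : o_^-1%g = o_ by apply/eqP; rewrite eq_invg_mul longest_permK.
have -> : ord_opp i = o_ (ord_below i) by rewrite longest_permE.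
rewrite -longest_permE tpermC -tpermJ conjgE oV.
by rewrite -!mulgA longest_permK mulg1.
Qed.

Lemma sp_of_simple (s : 'S_n) i : i != 0%N :> nat ->
  (sp_of s * s_ i)%g = sp_of (tperm (ord_below i) i * s)%g.
Proof. by move=> i0; rewrite simple_spE // sp_ofM. Qed.

(** Induction on the colength: below the longest permutation some ascent i
    exists, and the member for s is the image under the operator of i of the
    member for s s_i. *)
Lemma G_word (s : 'S_n) :
  exists2 a, positive_word a & G (sp_of s) = dd_word SX a (G (sp_of o_)).
Proof.
have [m] := ubnP (sp_inversions (longest_sp n) - sp_inversions (sp_of s))%N.
elim: m s => // m IHm s; rewrite ltnS => le_m.
have [->|s1] := eqVneq s o_; first by exists [::].
have : (sp_of s * sp_of o_)%g != 1%g.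
  rewrite -sp_ofM -sp_of1; apply: contra_neq s1 => -[so].
  by rewrite -[s]mul1g -longest_permK -mulgA so mulg1.
case/sp_desc_ex => k dk.
have k0 : k != 0%N :> nat.
  by apply: contraTneq dk => k0; rewrite /sp_desc k0 eqxx -sp_ofM entry_sp_of.
have oppK : ord_opp (ord_opp k) = k.
  by apply/val_inj; have := ltn_ord k; rewrite /=; lia.
have i0 : ord_opp k != 0%N :> nat.
  by rewrite ord_oppE //; have := ltn_ord k; lia.
set i := ord_opp k in i0 oppK; rewrite -oppK desc_longest // in dk.
have di : sp_desc (sp_of s * s_ i)%g i by rewrite sp_desc_simple.
have inv_s := sp_inversions_asc dk.
have [|a pa E] := IHm (tperm (ord_below i) i * s)%g.
  rewrite -sp_of_simple // inv_s.
  have := sp_inversions_longestM (sp_of s * s_ i)%g.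
  by rewrite inv_s; lia.
exists (i :: a); first by rewrite /positive_word /= i0.
by rewrite /= -/(dd_word SX a _) -E -sp_of_simple // -G_desc // mul_simple_spK.
Qed.

Definition cauchy_sum : A :=
  \sum_(s : 'S_n) G (sp_of s * sp_of o_)%g * swap_xy (G (sp_of s)).

Lemma G_actY w v : actY w (G v) = G v.
Proof.
rewrite -G_setY0 -[LHS]/((actY w \o setY0) (G v)).
by apply: sub_ext => i /=; rewrite /setY0 ?subX ?subY ?rmorph0 // /actY subX.
Qed.

Lemma swap_G_actX w v : actX w (swap_xy (G v)) = swap_xy (G v).
Proof. by rewrite -{2}(G_actY w v) -[in RHS](swap_xyK (G v)) -swap_xy_act swap_xyK. Qed.

(** The x-operator keeps the terms where n - i is a descent of s times the
    longest permutation, that is, where i is an ascent of s; the y-operator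
    keeps those where i is a descent of s.  The bijection s to s s_i matches
    the two sums. *)
Lemma cauchy_intertwined : intertwined cauchy_sum.
Proof.
move=> i i0; rewrite /cauchy_sum !dds_sum.
rewrite [RHS](bigID (fun s : 'S_n => sp_desc (sp_of s) i)) /=.
rewrite [LHS](bigID (fun s : 'S_n => ~~ sp_desc (sp_of s) i)) /=.
congr (_ + _); last first.
  rewrite !big1 // => s ds.
    rewrite (ddsMl (S := SY)) ?G_actY // -swap_xy_dds G_asc // rmorph0.
    exact: mulr0.
  by rewrite ddsMr ?swap_G_actX // G_asc ?mul0r // desc_longest.
pose t := tperm (ord_below i) i.
have tt : involutive (fun s : 'S_n => (t * s)%g).
  by move=> s; rewrite mulgA tperm2 mul1g.
rewrite [RHS](reindex_inj (inv_inj tt)) /=.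
apply: eq_big => [s|s ds].
  by rewrite -sp_of_simple // sp_desc_simple.
rewrite ddsMr ?swap_G_actX // -G_desc ?desc_longest // -mulgA longest_simple //.
rewrite (ddsMl (S := SY)) ?G_actY // -swap_xy_dds -!sp_of_simple //.
by rewrite -G_desc ?sp_desc_simple // mul_simple_spK mulgA.
Qed.

Lemma setY0_swap_G (s : 'S_n) : setY0 (swap_xy (G (sp_of s))) = (s == 1%g)%:R.
Proof.
rewrite -G_const -G_setY0.
rewrite -[LHS]/((setY0 \o (swap_xy \o setY0)) _) -[RHS]/((sub _ _ \o setY0) _).
apply: sub_ext => i /=; rewrite /setY0 /swap_xy ?subX ?subY ?subY //.
by rewrite !rmorph0.
Qed.

(** The member for s is the value at Y = 0 of the image of the kernel under a
    word. *)
Lemma G_free (s : 'S_n) : set_x0 (G (sp_of s)) = G (sp_of s).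
Proof.
have [a pa ->] := G_word s.
have -> : dd_word SX a (G (sp_of o_)) = setY0 (dd_word SX a cauchy_kernel).
  by rewrite G_longest; elim: (a) => //= i b IHb; rewrite setY0_dds IHb.
by rewrite set_x0_setY0 cauchy_kernel_word_free.
Qed.

Lemma set_y0_G m v : set_y0 m (G v) = G v.
Proof.
rewrite -G_setY0 -[LHS]/((set_y0 m \o setY0) (G v)).
by apply: sub_ext => i /=; rewrite /setY0 /set_y0 ?subX ?subY ?rmorph0 ?subX.
Qed.

(** At Y = 0 only the term of the identity survives in the sum, and it is the
    member of the longest permutation, the value of the kernel; both sides are
    intertwined and free of y_1, so they agree. *)
Theorem cauchy : cauchy_sum = cauchy_kernel.
Proof.
apply/eqP; rewrite -subr_eq0; apply/eqP; apply: intertwined_eq0.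
- by move=> i i0; rewrite !ddsB cauchy_intertwined // cauchy_kernel_intertwined.
- rewrite rmorphB /= /cauchy_sum rmorph_sum (bigD1 1%g) //= big1 => [|s s1].
    rewrite addr0 rmorphM /= setY0_swap_G eqxx mulr1 sp_of1 mul1g G_longest.
    rewrite -G_longest G_setY0; exact: subrr.
  by rewrite rmorphM /= setY0_swap_G (negPf s1) mulr0.
rewrite rmorphB; congr (_ - _).
  rewrite rmorph_sum; apply: eq_bigr => s _.
  by rewrite rmorphM /= set_y0_G set_y0_swap_xy G_free.
rewrite /cauchy_kernel rmorph_prod; apply: eq_bigr => -[i j] /= ij.
rewrite rmorphD /= /set_y0 subX subY; case: ltnP => //; rewrite ltnS leqn0 => /eqP j0.
by move: ij; rewrite j0 addn0 leqNgt ltn_ord.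
Qed.

End Cauchy.
End DoublePolynomials.

(** * The operators on Z[X, Y] *)

Section Instance.
Variable n : nat.
Local Notation R := {mpoly int[n + n]}.
Implicit Types (f g : R) (i j k : 'I_n) (u v w : signed_perm n).

Definition xv i : R := 'X_(lshift n i).
Definition yv i : R := 'X_(rshift n i).

Definition signed_x w j : R := (-1) ^+ sp_neg w j * xv (sp_abs w j).

(** Named so that the substitution is presented as a ring morphism, the form in
    which the generic part of the proof takes it. *)
Definition mp_subst (a b : 'I_n -> R) : {rmorphism R -> R} := subst a b.
Definition mp_act w : {rmorphism R -> R} := mp_subst (signed_x w) yv.

Lemma mp_substX a b i : mp_subst a b (xv i) = a i.
Proof. exact: substX. Qed.

Lemma mp_substY a b i : mp_subst a b (yv i) = b i.
Proof. exact: substY. Qed.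

Lemma mpoly_rmorph_ext m (B : comNzRingType) (g h : {rmorphism {mpoly int[m]} -> B}) :
  (forall l : 'I_m, g 'X_l = h 'X_l) -> g =1 h.
Proof.
move=> gh f; elim/mpolyind: f => [|c e p _ _ IHp]; first by rewrite !rmorph0.
rewrite !rmorphD IHp -mul_mpolyC !rmorphM; congr (_ * _ + _).
  by rewrite -[c]intz !rmorph_int.
rewrite mpolyXE_id !rmorph_prod; apply: eq_bigr => i _.
by rewrite !rmorphXn gh.
Qed.

Lemma mp_ext (g h : {rmorphism R -> R}) :
  (forall i, g (xv i) = h (xv i)) -> (forall i, g (yv i) = h (yv i)) -> g =1 h.
Proof.
move=> gx gy; apply: mpoly_rmorph_ext => i.
by case: (split_ordP i) => j ->; [apply: gx | apply: gy].
Qed.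

Lemma mp_actX w i : mp_act w (xv i) = (-1) ^+ sp_neg w i * xv (sp_abs w i).
Proof. exact: substX. Qed.

Lemma mp_actY w i : mp_act w (yv i) = yv i.
Proof. exact: substY. Qed.

Lemma mp_actM u v f : mp_act u (mp_act v f) = mp_act (u * v)%g f.
Proof.
rewrite -[LHS]/((mp_act u \o mp_act v) f); apply: mp_ext => i /=.
  rewrite !mp_actX rmorphM rmorph_sign /= mp_actX sp_negM signr_addb -mulrA.
  by rewrite sp_absM permM.
by rewrite !mp_actY.
Qed.

Lemma mp_act1 f : mp_act 1%g f = f.
Proof.
rewrite -[RHS]/(idfun f); apply: mp_ext => i /=; last by rewrite mp_actY.
by rewrite mp_actX /sp_neg /sp_abs /= ffunE mul1r perm1.
Qed.

Lemma xv_inj : injective xv.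
Proof.
move=> i j /(congr1 (fun p : R => p@_U_(lshift n i))).
rewrite !mcoeffX eqxx; case: eqP => // ji _.
have /eqP := congr1 (fun m : 'X_{1..n + n} => m (lshift n i)) ji.
by rewrite !mnm1E eqxx; have [/lshift_inj ->|] := lshift n j =P lshift n i.
Qed.

Lemma mp_root_neq0 i : root_of xv i != 0.
Proof.
rewrite /root_of; case: (eqVneq (i : nat) 0%N) => i0; last first.
  by rewrite subr_eq0 (inj_eq xv_inj) (negPf (ord_below_neq i0)).
rewrite mulf_neq0 //; last by rewrite -msupp_eq0 msuppX.
by rewrite -mpolyC1 -mpolyCMn mpolyC_eq0.
Qed.

Lemma mp_opP i f : ddiff i f * root_of xv i = f - mp_act (simple_sp i) f.
Proof. exact/eqP/(xchooseP (ddiff_exists i f)). Qed.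

Definition mp_divdiff : divdiff n R :=
  DivDiff mp_actM mp_act1 mp_actX mp_root_neq0 mp_opP.

Local Notation SX := mp_divdiff.

Lemma comp_mpoly_homog m l (t : m.-tuple {mpoly int[l]}) (p : {mpoly int[m]}) d :
    (forall r : 'I_m, tnth t r \is 1.-homog) -> p \is d.-homog ->
  p \mPo t \is d.-homog.
Proof.
move=> t1 /dhomogP pd; rewrite comp_mpolyEX.
rewrite big_seq; apply: rpred_sum => e /pd /= <-; apply: rpredZ.
rewrite comp_mpolyX mdegE.
elim/big_rec2: _ => [|r a b _ IH]; first exact: dhomog1.
by apply: dhomogM => //; have := dhomogMn (e r) (t1 r); rewrite mul1n.
Qed.

Lemma xv_homog i : xv i \is 1.-homog.
Proof. by rewrite dhomogX /= mdeg1. Qed.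

Lemma mp_act_homog w d f : f \is d.-homog -> mp_act w f \is d.-homog.
Proof.
apply: comp_mpoly_homog => i.
case: (split_ordP i) => j ->; rewrite ?tnth_lshift ?tnth_rshift !tnth_mktuple.
  by rewrite /signed_x; case: (sp_neg w j);
    rewrite ?mulN1r ?mul1r ?rpredN xv_homog.
by rewrite dhomogX /= mdeg1.
Qed.

(** A divided difference lowers the degree by one; in degree 0 it gives 0, which
    the truncated predecessor d.-1 would not record.  The predicate is stable
    under products, hence reduces to the variables. *)
Definition dd_homog i d f :=
  [/\ f \is d.-homog, d = 0%N -> dds SX i f = 0 & dds SX i f \is d.-1.-homog].

Lemma dd_homogM i d e f g :
  dd_homog i d f -> dd_homog i e g -> dd_homog i (d + e) (f * g).
Proof.
move=> [fd f0 Df] [ge g0 Dg].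
have sf : mp_act (simple_sp i) f \is d.-homog by exact: mp_act_homog.
have DM : dds SX i (f * g)
    = dds SX i f * g + mp_act (simple_sp i) f * dds SX i g.
  by rewrite !ddsE (ddM SX) mulrDr mulrA mulrCA.
split; first exact: dhomogM.
  by move/eqP; rewrite addn_eq0 => /andP[/eqP d0 /eqP e0];
    rewrite DM f0 // g0 // mul0r mulr0 addr0.
rewrite DM; apply: rpredD.
  case: d fd f0 Df {sf DM} => [|d] fd f0 Df; first by rewrite f0 // mul0r rpred0.
  exact: dhomogM.
case: e ge g0 Dg {DM} => [|e] ge g0 Dg; first by rewrite g0 // mulr0 rpred0.
by rewrite addnS; apply: dhomogM.
Qed.

Lemma dd_homog1 i : dd_homog i 0 1.
Proof.
have D1 : dds SX i 1 = 0 by rewrite (dds_inv (S := SX)) ?rmorph1.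
by split; rewrite ?D1 ?rpred0 // dhomog1.
Qed.

Lemma dd_homogX i (l : 'I_(n + n)) : dd_homog i 1 'X_l.
Proof.
split=> //; first by rewrite dhomogX /= mdeg1.
case: (split_ordP l) => j ->; last first.
  by rewrite (dds_inv (S := SX)) ?rpred0 //; apply: mp_actY.
rewrite -/(xv j); have [ij|ij] := eqVneq i j.
  rewrite -ij; have [i0|i0] := eqVneq (i : nat) 0%N.
    by rewrite /dds i0 (dd_var0 SX i0) dhomog1.
  by rewrite (dds_var SX i0) dhomog1.
have [jSi|jSi] := eqVneq j.+1 (i : nat); last first.
  by rewrite (dds_inv (S := SX)) ?rpred0 // (act_simple_id SX).
have i0 : i != 0%N :> nat by rewrite -jSi.
have -> : j = ord_below i by apply/val_inj; rewrite /= -jSi.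
by rewrite (dds_var_below SX i0) rpredN dhomog1.
Qed.

Lemma dd_homog_mnm i (e : 'X_{1..n + n}) : dd_homog i (mdeg e) 'X_[e].
Proof.
rewrite mpolyXE_id mdegE; elim/big_rec2: _ => [|l a b _ IH].
  exact: dd_homog1.
apply: dd_homogM => //; elim: (e l) => [|k IHk]; first exact: dd_homog1.
by rewrite exprS -add1n; apply: dd_homogM => //; apply: dd_homogX.
Qed.

Lemma dds_monomials i f :
  dds SX i f = \sum_(e <- msupp f) f@_e *: dds SX i 'X_[e].
Proof.
rewrite {1}(mpolyE f) (dds_sum SX); apply: eq_bigr => e _.
rewrite -mul_mpolyC (ddsMl (S := SX)) ?mul_mpolyC //.
by rewrite -[f@_e]intz !rmorph_int.
Qed.

Lemma dds_homog i d f : f \is d.-homog ->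
  (d = 0%N -> dds SX i f = 0) /\ dds SX i f \is d.-1.-homog.
Proof.
move=> /dhomogP fd; rewrite dds_monomials big_seq; split=> [d0|].
  rewrite big1 // => e ef; have [_ D0 _] := dd_homog_mnm i e.
  by rewrite D0 ?scaler0 // (fd _ ef).
apply: rpred_sum => e ef; apply: rpredZ; rewrite -(fd _ ef).
by have [] := dd_homog_mnm i e.
Qed.

Lemma dd_word_homog a d f : f \is d.-homog -> dd_word SX a f != 0 ->
  (size a <= d)%N /\ dd_word SX a f \is (d - size a).-homog.
Proof.
move=> fd; elim: a => [|i a IHa] /=; first by rewrite subn0.
move=> nz; have /IHa[le_d hd] : dd_word SX a f != 0.
  by apply: contraNneq nz => E; rewrite -/(dd_word SX a f) E (dds0 SX).
have [h0 h1] := dds_homog i hd; rewrite subnS; split=> //.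
rewrite ltn_neqAle le_d andbT; apply: contraNneq nz => E.
by rewrite -/(dd_word SX a f) h0 // E subnn.
Qed.

Lemma dd_long_words f : exists m, forall a,
  (m <= size a)%N -> dd_word SX a f = 0.
Proof.
exists (msize f) => a le_a.
rewrite {1}(mpolyE f) big_seq.
have -> : dd_word SX a (\sum_(e <- msupp f | e \in msupp f) f@_e *: 'X_[e])
    = \sum_(e <- msupp f | e \in msupp f) f@_e *: dd_word SX a 'X_[e].
  elim: a {le_a} => //= i a ->; rewrite (dds_sum SX); apply: eq_bigr => e _.
  rewrite -mul_mpolyC (ddsMl (S := SX)) ?mul_mpolyC //.
  by rewrite -[f@_e]intz !rmorph_int.
rewrite big1 // => e ef; have [->|nz] := eqVneq (dd_word SX a 'X_[e]) 0.
  exact: scaler0.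
have Xe : ('X_[e] : R) \is (mdeg e).-homog by rewrite dhomogX.
have [] := dd_word_homog Xe nz.
by have := msize_mdeg_lt ef; lia.
Qed.

End Instance.

(** * The polynomials Q-tilde as contractions *)

Lemma coef_prod_elem_sym (A : comNzRingType) (l : seq A) k :
  (\prod_(y <- l) (1 + y *: 'X))`_k = elem_sym l k.
Proof.
elim: l k => [|y l IHl] k; first by rewrite big_nil coef1.
rewrite big_cons mulrDl mul1r coefD IHl -scalerAl coefZ coefXM.
by case: k => [|k] /=; rewrite ?mulr0 ?addr0 ?IHl.
Qed.

(** Both sides are the coefficients of the product of the 1 + x_i t. *)
Lemma elem_sym_enum (A : comNzRingType) n (x : 'I_n -> A) k :
  elem_sym [seq x i | i <- enum 'I_n] k
  = \sum_(h : {set 'I_n} | #|h| == k) \prod_(i in h) x i.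
Proof.
rewrite -coef_prod_elem_sym big_map big_enum /=.
rewrite (eq_bigr (fun i => \sum_(b : bool) if b then x i *: 'X else 1)); last first.
  by move=> i _; rewrite big_bool addrC.
rewrite bigA_distr_bigA /=.
rewrite (reindex (fun h : {set 'I_n} => [ffun i => i \in h])) /=; last first.
  exists (fun f : {ffun 'I_n -> bool} => [set i | f i]) => [h _|f _].
    by apply/setP => i; rewrite inE ffunE.
  by apply/ffunP => i; rewrite ffunE inE.
rewrite coef_sum [RHS]big_mkcond; apply: eq_bigr => h _ /=.
rewrite (eq_bigr (fun i => if i \in h then x i *: 'X else 1)) => [|i _]; last first.
  by rewrite ffunE.
rewrite -big_mkcond /= scaler_prod prodr_const coefZ coefXn eq_sym.
by case: eqP => _; rewrite ?mulr1 ?mulr0.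
Qed.

Section QtildeX.
Variable n : nat.
Local Notation R := {mpoly int[n + n]}.
Local Notation SX := (mp_divdiff n).

Lemma mesym_varX k : mesym n int k \mPo varX n = tail_esym SX 0 k.
Proof.
rewrite /tail_esym drop0 elem_sym_enum /mesym rmorph_sum; apply: eq_bigr => h _.
rewrite rmorph_prod; apply: eq_bigr => i _.
by rewrite /= comp_mpolyXU -tnth_nth tnth_mktuple.
Qed.

(** For odd length the zero part appended to the list becomes the last column of
    the matrix, with the entries e_k, and pf_rcons turns it into a
    contraction. *)
Lemma Qtilde_varX (la : seq nat) : Qtilde n la \mPo varX n = qtilde SX la.
Proof.
pose s := if odd (size la) then rcons la 0%N else la.
have ss : size s = (uphalf (size la)).*2.
  rewrite /s -[in RHS](odd_double_half (size la)).
  case: ifP => ol; rewrite ?size_rcons -[in LHS](odd_double_half (size la)) ol;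
  by rewrite ?add1n ?add0n /= ?uphalf_double ?doubleK // (half_bit_double _ false).
have nth_s i : nth 0%N s i = nth 0%N la i.
  rewrite /s; case: ifP => // _; rewrite nth_rcons; case: ltngtP => //.
    by move=> ?; rewrite nth_default // ltnW.
  by move=> ->; rewrite nth_default.
have -> : Qtilde n la = pf (@Qtilde2 n) (uphalf (size la)) s.
  rewrite -(pfaffian_pf 0%N) // /Qtilde /pfaffian; apply: eq_bigr => t _.
  by congr (_ * _); apply: eq_bigr => i _; rewrite !nth_s.
rewrite (rmorph_pf (comp_mpoly (varX n))).
have qE i j : Qtilde2 n i j \mPo varX n = qpair (tail_esym SX 0) i j.
  rewrite -[Qtilde2 n i j]/(qpair (mesym n int) i j).
  rewrite (rmorph_qpair (comp_mpoly (varX n))).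
  rewrite /qpair /= !mesym_varX; congr (_ + _ * _).
  by apply: eq_bigr => k _; rewrite !mesym_varX.
rewrite (eq_pf (b := qpair (tail_esym SX 0))) // /qtilde /pf_pad /s.
case: ifP => ol; last first.
  by congr (pf _ _ la); rewrite uphalf_half ol.
rewrite uphalf_half ol add1n pf_rcons.
  by apply: eq_alt_del => // k; rewrite /= qpair0 // tail_esym0.
by rewrite -[LHS]odd_double_half ol.
Qed.

End QtildeX.

(** * Reconstruction of the top polynomial *)

Lemma sum_ord_bin2 n : (\sum_(i < n) i = (n * n.-1)./2)%N.
Proof. by rewrite -bin2 -bin2_sum big_mkord. Qed.

Lemma sum_rev_bin2 n : (\sum_(i < n) (n - i.+1) = (n * n.-1)./2)%N.
Proof.
rewrite -sum_ord_bin2 (reindex_inj rev_ord_inj) /=; apply: eq_bigr => i _.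
by have := ltn_ord i; lia.
Qed.

Lemma sum_ord_lt n m : (m <= n)%N -> (\sum_(i < n | (i < m)%N) 1 = m)%N.
Proof.
by move=> mn; rewrite -(big_ord_widen n (fun=> 1%N) mn) sum_nat_const card_ord muln1.
Qed.

(** Every pair of positions is inverted once, and no entry is barred. *)
Lemma inversions_longest_perm n :
  sp_inversions (sp_of (longest_perm n)) = (n * n.-1)./2.
Proof.
rewrite /sp_inversions [X in (_ + X)%N]big1 ?addn0 => [|i _]; last first.
  by rewrite entry_sp_of.
rewrite -sum_ord_bin2 -(pair_big_dep xpredT (fun i j : 'I_n => (i < j)%N)
  (fun i j => inv_at (sp_of (longest_perm n)) i j)) /=.
rewrite (exchange_big_dep xpredT) //=; apply: eq_bigr => j _.
rewrite -[RHS](sum_ord_lt (ltnW (ltn_ord j))).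
apply: eq_bigr => i ij; rewrite /inv_at !entry_sp_of !longest_permE /=.
by have := ltn_ord j; lia.
Qed.

Lemma strict_sp_eq1 n (n_gt0 : (0 < n)%N) (la : {set 'I_n}) :
  (strict_sp la == 1%g) = (la == set0).
Proof.
apply/eqP/eqP => [E|->].
  apply/eqP; rewrite -cards_eq0 -leqn0 leqNgt.
  have := congr1 (fun w => sp_neg w (Ordinal n_gt0)) E.
  by rewrite /sp_neg /= !ffunE /= => ->.
apply: signed_permP => i; rewrite /sp_neg /sp_abs /= ?ffunE ?cards0 //.
rewrite permE perm1 /strict_word enum_set0 /= setC0.
have -> : enum [set: 'I_n] = enum 'I_n by apply: eq_enum => j; rewrite in_setT.
by rewrite nth_ord_enum.
Qed.

Section Kernel.
Variables (n : nat) (A : idomainType) (SX : divdiff n A) (y : 'I_n -> A).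
Variable sub : ('I_n -> A) -> ('I_n -> A) -> {rmorphism A -> A}.
Hypothesis subX : forall a b i, sub a b (dd_x SX i) = a i.
Hypothesis subY : forall a b i, sub a b (y i) = b i.
Hypothesis sub_ext : forall g h : {rmorphism A -> A},
  (forall i, g (dd_x SX i) = h (dd_x SX i)) ->
  (forall i, g (y i) = h (y i)) -> g =1 h.
Local Notation x := (dd_x SX).
Local Notation eps := (setY0 SX sub).
Local Notation swap := (swap_xy SX y sub).
Local Notation kA := (cauchy_kernel SX y).
Local Notation o_ := (longest_perm n).
Local Notation w0 := (longest_sp n).
Local Notation N := ((n * n.-1)./2).
Implicit Types (f : A) (w : signed_perm n) (la : {set 'I_n}) (s : 'S_n).

Lemma sub_comp (a b c d a' b' : 'I_n -> A) f :
    (forall i, sub c d (a i) = a' i) -> (forall i, sub c d (b i) = b' i) ->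
  sub c d (sub a b f) = sub a' b' f.
Proof.
move=> aa bb; rewrite -[LHS]/((sub c d \o sub a b) f).
by apply: sub_ext => i /=; rewrite ?subX ?subY.
Qed.

(** It carries the sum over permutations in the Cauchy identity, in the variables
    X and Y, to the one in the reproducing identity, where the arguments are
    reversed and those in X negated. *)
Definition theta : {rmorphism A -> A} :=
  sub (fun i => - x (rev_ord i)) (fun i => y (rev_ord i)).

Lemma eps_cauchy_kernel : eps kA = \prod_(i < n) x i ^+ i.
Proof.
rewrite /cauchy_kernel rmorph_prod /=.
rewrite (eq_bigr (fun p : 'I_n * 'I_n => x p.1)) => [|p _]; last first.
  by rewrite rmorphD /= /setY0 subX subY addr0.
rewrite -(pair_big_dep xpredT (fun i j : 'I_n => (n <= i + j)%N)
  (fun i j => x i)) /=.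
apply: eq_bigr => i _; rewrite prodr_const; congr (_ ^+ _).
rewrite -sum1_card (reindex_inj rev_ord_inj) /=.
rewrite -[RHS](sum_ord_lt (ltnW (ltn_ord i))); apply: eq_bigl => j.
by rewrite unfold_in /=; have := ltn_ord j; lia.
Qed.

Lemma theta_cauchy_kernel : theta kA = (-1) ^+ N *
  \prod_(i < n) \prod_(j < n | (i.+1 + j.+1 <= n)%N) (x i - y j).
Proof.
rewrite /cauchy_kernel rmorph_prod /=.
rewrite (pair_big_dep xpredT (fun i j : 'I_n => (i.+1 + j.+1 <= n)%N)
  (fun i j => x i - y j)) /=.
have revK : involutive (fun p : 'I_n * 'I_n => (rev_ord p.1, rev_ord p.2)).
  by move=> [i j]; rewrite /= !rev_ordK.
rewrite (reindex_inj (inv_inj revK)) /=.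
rewrite (eq_bigr (fun p : 'I_n * 'I_n => - 1 * (x p.1 - y p.2))) => [|p _]; last first.
  by rewrite rmorphD /= subX subY !rev_ordK mulN1r opprB addrC.
rewrite big_split /= prodr_const; congr (_ ^+ _ * _).
  rewrite -sum1_card -sum_rev_bin2.
  transitivity (\sum_(p : 'I_n * 'I_n | (p.1.+1 + p.2.+1 <= n)%N) 1)%N.
    apply: eq_bigl => -[i j]; rewrite unfold_in /=.
    by have := ltn_ord i; have := ltn_ord j; lia.
  rewrite -(pair_big_dep xpredT (fun i j : 'I_n => (i.+1 + j.+1 <= n)%N)
    (fun i j => 1%N)) /=.
  apply: eq_bigr => i _; rewrite -[RHS](@sum_ord_lt n) ?leq_subr //.
  by apply: eq_bigl => j; have := ltn_ord i; lia.
by apply: eq_bigl => -[i j]; have := ltn_ord i; have := ltn_ord j; rewrite /=; lia.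
Qed.

Lemma theta_eps_cauchy_kernel : theta (eps kA) = (-1) ^+ N * stair SX n.-1.
Proof.
rewrite eps_cauchy_kernel rmorph_prod /=.
rewrite (eq_bigr (fun i : 'I_n => (-1) ^+ i * x (rev_ord i) ^+ i)) => [|i _].
  rewrite big_split /= -expr_sum sum_ord_bin2; congr (_ * _).
  rewrite (reindex_inj rev_ord_inj) /=; apply: eq_bigr => i _.
  by rewrite rev_ordK; congr (_ ^+ _); have := ltn_ord i; lia.
by rewrite rmorphXn /= subX [LHS]exprNn.
Qed.

Section Reconstruction.
Hypothesis n_gt0 : (0 < n)%N.
Hypothesis actX_y : forall w i, dd_act SX w (y i) = y i.
Hypothesis long_words : forall f, exists m, forall a,
  (m <= size a)%N -> dd_word SX a f = 0.
Variables (P : signed_perm n -> A) (word : signed_perm n -> seq 'I_n).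
Hypothesis P_word : forall w, P w = dd_word SX (word w) (P w0).
Hypothesis P_desc : forall w k,
  sp_desc w k -> P (w * simple_sp k)%g = dds SX k (P w).
Hypothesis P_asc : forall w k, ~~ sp_desc w k -> dds SX k (P w) = 0.
Hypothesis P_sum : P w0 = \sum_(s : 'S_n) \sum_(la : {set 'I_n})
    sub (fun i => - x (rev_ord i)) (fun=> 0) (P (sp_of s * sp_of o_)%g)
    * eps (P (strict_sp (~: la)))
    * sub (fun i => y (rev_ord i)) (fun=> 0) (P (sp_of s))
    * sub y (fun=> 0) (P (strict_sp la)).
Hypothesis P_longest_perm : eps (P (sp_of o_)) = eps kA.
Hypothesis kA_neq0 : eps kA != 0.
Hypothesis P_rho : eps (P (strict_sp (rho_set n))) = qtilde SX (parts (rho_set n)).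
Hypothesis P_const : forall w,
  w != 1%g -> sub (fun=> 0) (fun=> 0) (P w) = 0.
Hypothesis P_id : forall a b, sub a b (P 1%g) = P 1%g.
(** By homogeneity P_1 has degree 0; its value c is not known at first, and is
    found to be 1 only after the members of strict partitions are known up to
    the factor c^2. *)
Let c : A := P 1%g.
Let G w : A := eps (P w).

Let eps_dds i f : eps (dds SX i f) = dds SX i (eps f).
Proof. exact: (setY0_dds subX subY sub_ext actX_y). Qed.

Let G_desc w k : sp_desc w k -> G (w * simple_sp k)%g = dds SX k (G w).
Proof. by move=> dk; rewrite /G P_desc // eps_dds. Qed.

Let G_asc w k : ~~ sp_desc w k -> dds SX k (G w) = 0.
Proof. by move=> ak; rewrite /G -eps_dds P_asc // rmorph0. Qed.

Let sub_eps (a b : 'I_n -> A) f : sub a b (eps f) = sub a (fun=> 0) f.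
Proof. by apply: sub_comp => i; [apply: subX | apply: rmorph0]. Qed.

Let G_eps w : eps (G w) = G w.
Proof. exact: sub_eps. Qed.

Let P_constE w : sub (fun=> 0) (fun=> 0) (P w) = if w == 1%g then c else 0.
Proof. by case: eqVneq => [->|/P_const //]; apply: P_id. Qed.

Let swapG w : swap (G w) = sub y (fun=> 0) (P w).
Proof. exact: sub_eps. Qed.

Let theta_swapG w :
  theta (swap (G w)) = sub (fun i => y (rev_ord i)) (fun=> 0) (P w).
Proof.
by rewrite swapG; apply: sub_comp => i; [apply: subY | apply: rmorph0].
Qed.

(** The double sum factors into a sum over permutations and a sum over
    partitions. *)
Let CS : A := cauchy_sum SX y sub G.
Let QQ : A := \sum_la G (strict_sp (~: la)) * swap (G (strict_sp la)).

Let P_prod : P w0 = theta CS * QQ.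
Proof.
rewrite P_sum /CS /cauchy_sum rmorph_sum big_distrlr /=.
apply: eq_bigr => s _; apply: eq_bigr => la _.
by rewrite rmorphM /= theta_swapG swapG [theta (G _)]sub_eps mulrACA !mulrA.
Qed.

Let eps_swapG w : eps (swap (G w)) = if w == 1%g then c else 0.
Proof.
rewrite -P_constE swapG.
by apply: sub_comp => i; [apply: subY | apply: rmorph0].
Qed.

Let eps_theta_swapG w : eps (theta (swap (G w))) = if w == 1%g then c else 0.
Proof.
rewrite -P_constE theta_swapG.
by apply: sub_comp => i; [apply: subY | apply: rmorph0].
Qed.

Let eps_theta_eps f : eps (theta (eps f)) = theta (eps f).
Proof.
rewrite [theta (eps f)]sub_eps; apply: sub_comp => i; last exact: rmorph0.
by rewrite rmorphN /=; congr (- _); apply: subX.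
Qed.

Let sp_of_eq1 s : (sp_of s == 1%g) = (s == 1%g).
Proof. by rewrite -sp_of1; apply/eqP/eqP => [[]|->]. Qed.

Let eps_QQ : eps QQ = qtilde SX (parts (rho_set n)) * c.
Proof.
rewrite /QQ rmorph_sum (bigD1 set0) //= big1 => [|la la0].
  by rewrite addr0 rmorphM /= eps_swapG strict_sp_eq1 // eqxx setC0 G_eps -P_rho.
by rewrite rmorphM /= eps_swapG strict_sp_eq1 // (negPf la0) mulr0.
Qed.

Let eps_CS : eps (theta CS) = (-1) ^+ N * stair SX n.-1 * c.
Proof.
rewrite /CS /cauchy_sum !rmorph_sum (bigD1 1%g) //= big1 => [|s s1].
  rewrite addr0 !rmorphM /= eps_theta_swapG sp_of_eq1 eqxx sp_of1 mul1g.
  by rewrite /G P_longest_perm eps_theta_eps theta_eps_cauchy_kernel.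
by rewrite !rmorphM /= eps_theta_swapG sp_of_eq1 (negPf s1) mulr0.
Qed.

Let G_longest : G w0 =
  stair SX n.-1 * qtilde SX (parts (rho_set n)) * ((-1) ^+ N * (c * c)).
Proof.
rewrite /G P_prod rmorphM /= eps_CS eps_QQ.
by ring.
Qed.

Let G_strict_c la : G (strict_sp la) = qtilde SX (parts la) * (c * c).
Proof.
rewrite (@walk_strict n _ SX G G_desc ((-1) ^+ N * (c * c)) _ n_gt0 la) //.
- by rewrite sum_rev_bin2 mulrA -exprD addnn -signr_odd odd_double mul1r.
- move=> i; have cE : dd_act SX (simple_sp i) c = c.
    rewrite /c -(P_id (fun=> 0) (fun=> 0)).
    rewrite -[LHS]/((dd_act SX (simple_sp i) \o sub (fun=> 0) (fun=> 0)) _).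
    by apply: sub_ext => j /=; rewrite ?subX ?subY rmorph0.
  by rewrite !rmorphM rmorph_sign /= cE.
- by rewrite walk_parts0 G_longest.
Qed.

(** The empty partition belongs to the identity, so the formula for strict
    partitions computes c itself. *)
Let c_idem : c * c = c.
Proof.
have := G_strict_c set0; rewrite /parts enum_set0 /= mul1r => <-.
have /eqP -> : strict_sp (set0 : {set 'I_n}) == 1%g by rewrite strict_sp_eq1.
exact: P_id.
Qed.

(** If c vanished, so would the top polynomial at Y = 0, and with it the
    prescribed monomial of the longest permutation. *)
Let c1 : c = 1.
Proof.
have [c0|c_neq0] := eqVneq c 0; last first.
  by apply: (mulIf c_neq0); rewrite mul1r c_idem.
case/eqP: kA_neq0; rewrite -P_longest_perm P_word.
elim: (word _) => [|i a IHa] /=.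
  by rewrite -/(G w0) G_longest c0 !mulr0.
by rewrite eps_dds IHa dds0.
Qed.

Let G_strict la : G (strict_sp la) = qtilde SX (parts la).
Proof. by rewrite G_strict_c c1 !mulr1. Qed.

Let G_const s : sub (fun=> 0) (fun=> 0) (G (sp_of s)) = (s == 1%g)%:R.
Proof. by rewrite sub_eps P_constE c1 sp_of_eq1; case: ifP. Qed.

(** Knowing the members of strict partitions gives the sum over partitions; the
    Cauchy identity gives the sum over permutations. *)
Theorem reconstruction :
  P w0 = theta kA * \sum_(la : {set 'I_n}) qtilde SX (parts (~: la)) * swap (qtilde SX (parts la)).
Proof.
rewrite P_prod /CS (cauchy subX subY sub_ext n_gt0 actX_y long_words G_desc G_asc
  G_eps G_const P_longest_perm); congr (_ * _).
by apply: eq_bigr => la _; rewrite !G_strict.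
Qed.

End Reconstruction.
End Kernel.

(** * Degrees and conclusion *)

Lemma mpoly_int_morphC m (B : comNzRingType) (g : {rmorphism {mpoly int[m]} -> B})
  (c : int) : g c%:MP = c%:~R.
Proof. by rewrite -[c in c%:MP]intz !rmorph_int. Qed.

Lemma dhomog0_const m (f : {mpoly int[m]}) : f \is 0.-homog ->
  exists c : int, f = c%:MP.
Proof.
move=> /dhomogP f0; exists f@_0; apply: msize1_polyC.
rewrite msizeE; apply/bigmax_leqP_seq => e ef _.
by rewrite (f0 _ ef).
Qed.

Section Concrete.
Variable n : nat.
Local Notation R := {mpoly int[n + n]}.
Local Notation SX := (mp_divdiff n).
Local Notation sub := (@mp_subst n).
Local Notation xv := (@xv n).
Local Notation yv := (@yv n).
Local Notation eps := (setY0 SX sub).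
Local Notation kA := (cauchy_kernel SX yv).
Local Notation o_ := (longest_perm n).
Local Notation w0 := (longest_sp n).
Local Notation N := ((n * n.-1)./2).
Implicit Types (f : R) (w : signed_perm n) (la : {set 'I_n}).

Lemma atY0_comp f (t : n.-tuple R) :
  at_Y0 f \mPo t = sub (fun i => tnth t i) (fun=> 0) f.
Proof.
rewrite /at_Y0 comp_mpoly_comp; congr (_ \mPo _); apply: eq_from_tnth => i.
rewrite tnth_mktuple; case: (split_ordP i) => j ->.
  by rewrite !tnth_lshift !tnth_mktuple comp_mpolyXU -tnth_nth.
by rewrite !tnth_rshift !tnth_mktuple comp_mpoly0.
Qed.

Lemma atY0_tuple f (a : 'I_n -> R) :
  at_Y0 f \mPo [tuple a i | i < n] = sub a (fun=> 0) f.
Proof.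
by rewrite atY0_comp; apply: eq_subst => // i; rewrite tnth_mktuple.
Qed.

Lemma subst_const (a b : 'I_n -> R) f : f \is 0.-homog -> sub a b f = f.
Proof.
case/dhomog0_const => c ->.
by rewrite mpoly_int_morphC -(mpoly_int_morphC (idfun : {rmorphism R -> R})).
Qed.

Lemma subst0_homog d f : (0 < d)%N -> f \is d.-homog ->
  sub (fun=> 0) (fun=> 0) f = 0.
Proof.
move=> d_gt0 /dhomogP fd; rewrite /= /subst comp_mpolyEX big_seq big1 // => e /fd /=.
move=> de; have [i ei] : exists i, e i != 0%N.
  apply/existsP; apply: contraLR d_gt0 => /existsPn e0.
  by rewrite -de mdegE big1 // => i _; apply/eqP; rewrite -[_ == _]negbK.
rewrite comp_mpolyX (bigD1 i) //= (_ : tnth _ i = 0) ?expr0n ?(negPf ei).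
  by rewrite mul0r scaler0.
by case: (split_ordP i) => j ->; rewrite ?tnth_lshift ?tnth_rshift tnth_mktuple.
Qed.

Lemma subst_homog (a b : 'I_n -> R) d f :
    (forall i, a i \is 1.-homog) -> (forall i, b i \is 1.-homog) ->
  f \is d.-homog -> sub a b f \is d.-homog.
Proof.
move=> ha hb; apply: comp_mpoly_homog => i.
by case: (split_ordP i) => j ->; rewrite ?tnth_lshift ?tnth_rshift tnth_mktuple.
Qed.

Lemma mp_eps_cauchy_kernel : eps kA = \prod_(i < n) xv i ^+ i.
Proof. exact: (@eps_cauchy_kernel n _ SX yv sub (@mp_substX n) (@mp_substY n)). Qed.

Lemma eps_cauchy_kernel_neq0 : eps kA != 0.
Proof.
rewrite mp_eps_cauchy_kernel; apply/prodf_neq0 => i _.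
by rewrite expf_neq0 // -msupp_eq0 msuppX.
Qed.

Lemma eps_cauchy_kernel_homog : eps kA \is N.-homog.
Proof.
rewrite mp_eps_cauchy_kernel -sum_ord_bin2; elim/big_rec2: _ => [|i a b _ IH].
  exact: dhomog1.
apply: dhomogM => //; have := dhomogMn i (xv_homog i).
by rewrite mul1n.
Qed.

Lemma schubertA_longest_rev :
  (schubertA_longest n \mPo var_rev n) \mPo varX n = eps kA.
Proof.
rewrite comp_mpoly_comp /schubertA_longest rmorph_prod mp_eps_cauchy_kernel.
rewrite [RHS](reindex_inj rev_ord_inj) /=; apply: eq_bigr => i _.
rewrite rmorphXn /= comp_mpolyXU -tnth_nth !tnth_mktuple comp_mpolyXU -tnth_nth.
by rewrite tnth_mktuple.
Qed.

Lemma swap_varX la : swap_xy SX yv sub (qtilde SX (parts la))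
  = Qtilde_strict la \mPo varY n.
Proof.
rewrite -Qtilde_varX; rewrite -[LHS]/(subst yv xv _) subst_comp_mpoly.
congr (_ \mPo _); apply: eq_from_tnth => i.
by rewrite !tnth_mktuple; apply: mp_substX.
Qed.

Section Degrees.
Variable P : signed_perm n -> R.
Hypothesis P_homog : exists d : nat, P w0 \is d.-homog.
Hypothesis P_def : forall w, P w = ddiff'_w (w^-1 * w0)%g (P w0).
Hypothesis P_longest_perm : eps (P (sp_of o_)) = eps kA.

(** The degree of the top polynomial is not given.  It is found by comparison
    with the member of the longest permutation, a nonzero polynomial whose
    degree at Y = 0 is known, and then the degree of P_w is the length
    of w. *)
Lemma family_homog w : P w \is (sp_inversions w).-homog.
Proof.
have [d Pd] := P_homog; set K := sp_inversions w0.
have size_word v : (size (reduced_word (v^-1 * w0)%g) + sp_inversions v = K)%N.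
  have [_ ->] := reduced_wordP (v^-1 * w0)%g.
  by rewrite invMg invgK longest_spV sp_inversions_longestM.
have hom v : P v != 0 -> (size (reduced_word (v^-1 * w0)%g) <= d)%N /\
    P v \is (d - size (reduced_word (v^-1 * w0)%g)).-homog.
  by rewrite P_def => nz; apply: dd_word_homog.
have dK : d = K.
  have nz : P (sp_of o_) != 0.
    apply: contraNneq eps_cauchy_kernel_neq0 => P0.
    by rewrite -P_longest_perm P0 rmorph0.
  have [le_d hd] := hom _ nz; have := size_word (sp_of o_).
  rewrite inversions_longest_perm.
  suff -> : N = (d - size (reduced_word ((sp_of o_)^-1 * w0)%g))%N by lia.
  apply: (dhomog_uniq eps_cauchy_kernel_neq0 eps_cauchy_kernel_homog).
  rewrite -P_longest_perm; apply: subst_homog hd => i; last exact: rpred0.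
  exact: xv_homog.
have [->|nz] := eqVneq (P w) 0; first exact: rpred0.
have [le_d hd] := hom _ nz; have E := size_word w.
by rewrite (_ : sp_inversions w = d - size (reduced_word (w^-1 * w0)%g))%N //; lia.
Qed.

End Degrees.
End Concrete.

Theorem proposition3 (n : nat) (n_ge1 : (1 <= n)%N)
    (P : signed_perm n -> {mpoly int[n + n]})
    (P_homog : exists d : nat, P (longest_sp n) \is d.-homog)
    (P_def : forall w : signed_perm n,
       P w = ddiff'_w (w^-1 * longest_sp n)%g (P (longest_sp n)))
    (P_longest :
       P (longest_sp n) =
       \sum_(s : 'S_n) \sum_(la : {set 'I_n})
         (at_Y0 (P (sp_of s * sp_of (longest_perm n))%g) \mPo var_opp_revX n)
         * (at_Y0 (P (strict_sp (~: la))) \mPo varX n)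
         * (at_Y0 (P (sp_of s)) \mPo var_revY n)
         * (at_Y0 (P (strict_sp la)) \mPo varY n))
    (P_longest_perm :
       at_Y0 (P (sp_of (longest_perm n))) = schubertA_longest n \mPo var_rev n)
    (P_rho : at_Y0 (P (strict_sp (rho_set n))) = Qtilde_strict (rho_set n)) :
  forall w : signed_perm n, P w = schubertC w.
Proof.
have epsE f : setY0 (mp_divdiff n) (@mp_subst n) f = at_Y0 f \mPo varX n.
  by rewrite atY0_tuple.
have long_eps : setY0 (mp_divdiff n) (@mp_subst n) (P (sp_of (longest_perm n)))
    = setY0 (mp_divdiff n) (@mp_subst n) (cauchy_kernel (mp_divdiff n) (@yv n)).
  by rewrite epsE P_longest_perm schubertA_longest_rev.
have P_deg := family_homog P_homog P_def long_eps.
have F_E := @reconstruction n _ (mp_divdiff n) (@yv n) (@mp_subst n)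
  (@mp_substX n) (@mp_substY n) (@mp_ext n) n_ge1 (@mp_actY n)
  (@dd_long_words n) P (fun w => reduced_word (w^-1 * longest_sp n)%g) P_def.
have FE : P (longest_sp n)
    = (-1) ^+ (n * n.-1)./2 * (DeltaXY n * QtildeXY n).
  rewrite F_E.
  - rewrite mulrA; congr (_ * _).
      exact: (@theta_cauchy_kernel n _ (mp_divdiff n) (@yv n) (@mp_subst n)
        (@mp_substX n) (@mp_substY n)).
    rewrite /QtildeXY (reindex_inj (@setC_inj _)); apply: eq_bigr => la _.
    rewrite swap_varX setCK; congr (_ * _).
    by rewrite -Qtilde_varX.
  - move=> v k dk; rewrite [LHS]P_def [P v in RHS]P_def.
    exact: (dd_family_desc (mp_divdiff n)).
  - move=> v k ak; rewrite [P v]P_def.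
    exact: (dd_family_asc (mp_divdiff n)).
  - rewrite [LHS]P_longest; apply: eq_bigr => s _; apply: eq_bigr => la _.
    congr (_ * _ * _ * _); first exact: atY0_tuple.
    + by rewrite epsE.
    + exact: atY0_tuple.
    + exact: atY0_tuple.
  - exact: long_eps.
  - exact: eps_cauchy_kernel_neq0.
  - by rewrite epsE P_rho Qtilde_varX.
  - move=> v v1; apply: subst0_homog (P_deg v).
    by rewrite lt0n sp_inversions_eq0.
  - move=> a b; apply: subst_const; have := P_deg 1%g.
    by rewrite sp_inversions1.
move=> w; rewrite [LHS]P_def FE /schubertC subn1.
exact: (dd_word_sign (mp_divdiff n)).
Qed.
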